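(* Consider the following 44 points $[\widetilde e_{pqrs}]\in X$, which are the points of the Cayley Grassmannian $X$ fixed by the torus $T$; here $pqrs$ ranges over $$0123,\ 0145,\ 0167,\ 2345,\ 2367,\ 4567,\ 0156,\ 2356,\ 1356,\ 0256,\ 1256,\ 0356,$$ $$1235,\ 1567,\ 0135,\ 3567,\ 0126,\ 2456,\ 0236,\ 0456,\ 1237,\ 1457,\ 0137,\ 3457,$$ $$0124,\ 2467,\ 0234,\ 0467,\ 0147,\ 2347,\ 1347,\ 0247,\ 1247,\ 0347,$$ $$1357,\ 1257,\ 0357,\ 1246,\ 0346,\ 0246,\ 1245,\ 1267,\ 0345,\ 0367.$$ Among these fixed points, all are smooth points of $X$ except the following six, which are not smooth points of $X$: $$\widetilde e_{0246},\ \widetilde e_{0347},\ \widetilde e_{0356},\ \widetilde e_{1247},\ \widetilde e_{1256},\ \widetilde e_{1357}.$$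
   Context: **Octonions.** Let $\mathbb H$ be the complex quaternion algebra with $\mathbb C$-basis $1,\mathbf i,\mathbf j,\mathbf k$, $\mathbf i^2=\mathbf j^2=\mathbf k^2=\mathbf i\mathbf j\mathbf k=-1$, and conjugation $\overline{a+b\mathbf i+c\mathbf j+d\mathbf k}=a-b\mathbf i-c\mathbf j-d\mathbf k$. Let $\mathbb O=\mathbb H\oplus\mathbf l\,\mathbb H\cong\mathbb C^8$ be the complex octonion algebra with product $(a+\mathbf l b)(c+\mathbf l d)=(ac-d\bar b)+\mathbf l(cb+\bar a d)$ for $a,b,c,d\in\mathbb H$. Its standard basis is $e_0=1,e_1=\mathbf i,e_2=\mathbf j,e_3=\mathbf k,e_4=\mathbf l,e_5=\mathbf l\mathbf i,e_6=\mathbf l\mathbf j,e_7=\mathbf l\mathbf k$. $\mathrm{Re}$ is the projection onto $\mathbb C\cdot 1$, $\mathrm{Im}$ the projection onto $\langle e_1,\dots,e_7\rangle$, and $\bar u=\mathrm{Re}(u)-\mathrm{Im}(u)$. **Cayley Grassmannian.** Put $u\times v\times w=\frac12\big((u\bar v)w-(w\bar v)u\big)$ and $$x\times u\times v\times w=-\tfrac14\big[(x\times u\times v)\bar w-(w\times x\times u)\bar v+(v\times w\times x)\bar u-(u\times v\times w)\bar x\big].$$ A 4-dimensional subspace of $\mathbb O$ spanned by $x,u,v,w$ is a Cayley plane if $\mathrm{Im}(x\times u\times v\times w)=0$. The Cayley Grassmannian $X$ is the set of all Cayley planes, viewed as a (12-dimensional) projective variety inside $\mathrm{Gr}(4,\mathbb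 O)\subset\mathbb P(\Lambda^4\mathbb O)$ via the Plücker embedding. With $p_{ijkl}$ the Plücker coordinates with respect to $e_0,\dots,e_7$, $X$ is the subvariety of $\mathrm{Gr}(4,\mathbb O)$ cut out by - $-p_{0247}-p_{0256}+p_{0346}-p_{0357}+p_{1246}-p_{1257}+p_{1347}+p_{1356}=0$, - $p_{0147}+p_{0156}-p_{0345}-p_{0367}-p_{1245}-p_{1267}+p_{2347}+p_{2356}=0$, - $-p_{0146}+p_{0157}+p_{0245}+p_{0267}-p_{1345}-p_{1367}-p_{2346}+p_{2357}=0$, - $-p_{0127}+p_{0136}-p_{0235}+p_{0567}+p_{1234}-p_{1467}+p_{2457}-p_{3456}=0$, - $-p_{0126}-p_{0137}+p_{0234}-p_{0467}+p_{1235}-p_{1567}+p_{2456}+p_{3457}=0$, - $p_{0125}-p_{0134}-p_{0237}+p_{0457}+p_{1236}-p_{1456}-p_{2567}+p_{3467}=0$, - $p_{0124}+p_{0135}+p_{0236}-p_{0456}+p_{1237}-p_{1457}-p_{2467}-p_{3567}=0$. **Torus.** For $\lambda\in\mathbb C^*$ let $L_\lambda=\begin{pmatrix}\frac{\lambda+\lambda^{-1}}2&-i\frac{\lambda-\lambda^{-1}}2\\ i\frac{\lambda-\lambda^{-1}}2&\frac{\lambda+\lambda^{-1}}2\end{pmatrix}$. With respect to $e_0,\dots,e_7$, let $A_\lambda=L_\lambda\oplus L_\lambda\oplus L_\lambda\oplus L_\lambda$, $B_\mu=L_\mu\oplus L_{\mu^{-1}}\oplus I_4$, $C_\gamma=I_4\oplus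 L_\gamma\oplus L_{\gamma^{-1}}$, and $h(\lambda,\mu,\gamma)=A_\lambda B_\mu C_\gamma$. $T$ is the image of $h:(\mathbb C^* )^3\to \mathrm{SL}(8,\mathbb C)$; it acts on $X$. **Eigenvectors.** $\widetilde e_0=e_0+ie_1$, $\widetilde e_1=e_0-ie_1$, $\widetilde e_2=e_2+ie_3$, $\widetilde e_3=e_2-ie_3$, $\widetilde e_4=e_4+ie_5$, $\widetilde e_5=e_4-ie_5$, $\widetilde e_6=e_6+ie_7$, $\widetilde e_7=e_6-ie_7$, where $i\in\mathbb C$ is the imaginary unit, and $\widetilde e_{pqrs}=\widetilde e_p\wedge\widetilde e_q\wedge\widetilde e_r\wedge\widetilde e_s$. The symbol $\widetilde e_{pqrs}$ also denotes the corresponding point of $\mathbb P(\Lambda^4\mathbb O)$. *)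

(* Defs.v *)
From mathcomp Require Import all_boot all_order all_algebra.
From mathcomp Require Import classical_sets reals.
From mathcomp.real_closed Require Import complex.
From mathcomp.multinomials Require Import mpoly.

Set Implicit Arguments.
Unset Strict Implicit.
Unset Printing Implicit Defensive.

Import GRing.Theory Num.Theory.

Local Open Scope classical_set_scope.
Local Open Scope ring_scope.

(* A subset of the projective space P(C^n) is represented by the set of all
   the nonzero vectors that are homogeneous coordinates of its points, and a
   point by any of its vectors of homogeneous coordinates. *)
Section ProjectiveGeometry.
Variables (R : realType) (n : nat).
Local Notation C := R[i].
Implicit Types (Z W : set 'rV[C]_n) (p v : 'rV[C]_n).

Definition same_point p v : Prop :=
  [/\ p != 0, v != 0 & exists2 c : C, c != 0 & v = c *: p].

Definition zariski_closed Z : Prop :=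
  exists S : set {mpoly C[n]},
    (forall F, S F -> exists d : nat, F \is d.-homog) /\
    (forall x, Z x <-> x != 0 /\ (forall F, S F -> F.@[x 0] = 0)).

Definition irreducible_closed Z : Prop :=
  [/\ zariski_closed Z, Z !=set0 &
      forall Z1 Z2, zariski_closed Z1 -> zariski_closed Z2 ->
        Z `<=` Z1 `|` Z2 -> Z `<=` Z1 \/ Z `<=` Z2].

Definition irreducible_chain Z p (k : nat) : Prop :=
  exists W : nat -> set 'rV[C]_n,
    (forall i, (i <= k)%N -> [/\ irreducible_closed (W i), W i p & W i `<=` Z])
    /\ (forall i, (i < k)%N -> W i `<` W i.+1).

(* The local (Krull) dimension of Z at p, i.e. dim O_{Z,p} = d. *)
Definition local_dim Z p (d : nat) : Prop :=
  irreducible_chain Z p d /\ (forall k, irreducible_chain Z p k -> (k <= d)%N).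

Definition in_homog_ideal Z (F : {mpoly C[n]}) : Prop :=
  (exists d : nat, F \is d.-homog) /\ (forall x, Z x -> F.@[x 0] = 0).

(* v is tangent at p to the affine cone over Z, for the reduced structure on Z:
   the differentials at p of all the elements of the homogeneous ideal of Z
   vanish at v. *)
Definition cone_tangent Z p v : Prop :=
  forall F, in_homog_ideal Z F -> \sum_(j < n) (F^`M(j)).@[p 0] * v 0 j = 0.

(* The tangent space of the cone contains the line spanned by p, and its
   quotient by that line is (up to a twist) the Zariski tangent space of Z
   at the point p, whose dimension is d. *)
Definition tangent_dim Z p (d : nat) : Prop :=
  exists2 U : {vspace 'rV[C]_n},
    forall v, v \in U <-> cone_tangent Z p v & \dim U = d.+1.

Definition smooth_point Z p : Prop :=
  Z p /\ exists2 d : nat, local_dim Z p d & tangent_dim Z p d.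

End ProjectiveGeometry.

Section Octonions.
Variable R : realType.
Local Notation C := R[i].

(* Coordinates with respect to 1, i, j, k. *)
Local Notation quat := 'rV[C]_4.

Definition mkquat (a b c d : C) : quat := \row_(m < 4) [:: a; b; c; d]`_m.

Definition qcoord (x : quat) (m : nat) : C := x 0 (inord m).

Definition qmul (x y : quat) : quat :=
  let a := qcoord x 0 in let b := qcoord x 1 in
  let c := qcoord x 2 in let d := qcoord x 3 in
  let a' := qcoord y 0 in let b' := qcoord y 1 in
  let c' := qcoord y 2 in let d' := qcoord y 3 in
  mkquat (a * a' - b * b' - c * c' - d * d')
         (a * b' + b * a' + c * d' - d * c')
         (a * c' - b * d' + c * a' + d * b')
         (a * d' + b * c' - c * b' + d * a').

Definition qconj (x : quat) : quat :=
  mkquat (qcoord x 0) (- qcoord x 1) (- qcoord x 2) (- qcoord x 3).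

(* The octonion a + l b is row_mx a b, so that the coordinates are those with
   respect to e_0, ..., e_7. *)
Local Notation oct := 'rV[C]_(4 + 4).

Definition omul (x y : oct) : oct :=
  let a := lsubmx x in let b := rsubmx x in
  let c := lsubmx y in let d := rsubmx y in
  row_mx (qmul a c - qmul d (qconj b)) (qmul c b + qmul (qconj a) d).

Definition obasis (k : nat) : oct := delta_mx 0 (inord k).

Definition oRe (x : oct) : oct := x 0 0 *: obasis 0.
Definition oIm (x : oct) : oct := x - oRe x.
Definition oconj (x : oct) : oct := oRe x - oIm x.

Definition cross3 (u v w : oct) : oct :=
  2^-1 *: (omul (omul u (oconj v)) w - omul (omul w (oconj v)) u).

Definition cross4 (x u v w : oct) : oct :=
  - (4^-1 *: (omul (cross3 x u v) (oconj w) - omul (cross3 w x u) (oconj v)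
              + omul (cross3 v w x) (oconj u) - omul (cross3 u v w) (oconj x))).

End Octonions.

(* The subsequences of length k of s; for s = [:: 0; ...; 7] and k = 4 these
   are the 70 indices of the Pluecker coordinates. *)
Fixpoint subseqs_of_size (k : nat) (s : seq nat) : seq (seq nat) :=
  match k, s with
  | 0, _ => [:: [::]]
  | _.+1, [::] => [::]
  | k'.+1, x :: s' =>
      [seq x :: t | t <- subseqs_of_size k' s'] ++ subseqs_of_size k s'
  end.

Definition plucker_index : seq (seq nat) := subseqs_of_size 4 (iota 0 8).

Lemma size_plucker_index : size plucker_index = 70.
Proof. by []. Qed.

Section CayleyGrassmannian.
Variable R : realType.
Local Notation C := R[i].
Local Notation O := 'rV[C]_(4 + 4).
Implicit Types (x u v w : O) (P : {vspace O}).

(* x /\ u /\ v /\ w in Lambda^4 O = C^70. *)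
Definition wedge4 x u v w : 'rV[C]_70 :=
  \row_(k < 70) \det (\matrix_(a < 4, b < 4)
    (nth 0 [:: x; u; v; w] a) 0 (inord (nth 0%N (nth [::] plucker_index k) b))).

Definition cayley_plane P : Prop :=
  \dim P = 4%N /\
  exists x u v w : O,
    P = <<[:: x; u; v; w]>>%VS /\ oIm (cross4 x u v w) = 0.

(* omega is a vector of homogeneous coordinates of the image of P under the
   Pluecker embedding (scalars are absorbed by the choice of the basis). *)
Definition plucker_point P (omega : 'rV[C]_70) : Prop :=
  \dim P = 4%N /\
  exists x u v w : O,
    P = <<[:: x; u; v; w]>>%VS /\ omega = wedge4 x u v w.

Definition cayley_grassmannian : set 'rV[C]_70 :=
  [set omega | exists2 P : {vspace O}, cayley_plane P & plucker_point P omega].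

Definition block_diag4 (M0 M1 M2 M3 : 'M[C]_2) : 'M[C]_(4 + 4) :=
  block_mx (block_mx M0 0 0 M1 : 'M_(2 + 2)) 0
           0 (block_mx M2 0 0 M3 : 'M_(2 + 2)).

Definition torus_L (l : C) : 'M[C]_2 :=
  \matrix_(a < 2, b < 2)
    if a == b then (l + l^-1) / 2
    else if a == 0 then - 'i%C * ((l - l^-1) / 2)
    else 'i%C * ((l - l^-1) / 2).

Definition torus_A (l : C) : 'M[C]_(4 + 4) :=
  block_diag4 (torus_L l) (torus_L l) (torus_L l) (torus_L l).
Definition torus_B (m : C) : 'M[C]_(4 + 4) :=
  block_diag4 (torus_L m) (torus_L m^-1) 1%:M 1%:M.
Definition torus_C (g : C) : 'M[C]_(4 + 4) :=
  block_diag4 1%:M 1%:M (torus_L g) (torus_L g^-1).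

Definition torus : set 'M[C]_(4 + 4) :=
  [set h | exists l m g : C,
     [/\ l != 0, m != 0, g != 0 & h = torus_A l *m torus_B m *m torus_C g]].

(* Matrices act on column vectors, whereas octonions are rows. *)
Definition mx_act (h : 'M[C]_(4 + 4)) P : {vspace O} :=
  (linfun (mulmxr h^T) @: P)%VS.

Definition torus_fixed (omega : 'rV[C]_70) : Prop :=
  forall h P, torus h -> plucker_point P omega ->
    plucker_point (mx_act h P) omega.

Definition etilde (k : nat) : O :=
  obasis R (k./2).*2 + (-1) ^+ odd k * 'i%C *: obasis R (k./2).*2.+1.

Definition etilde4 (s : seq nat) : 'rV[C]_70 :=
  wedge4 (etilde (nth 0%N s 0)) (etilde (nth 0%N s 1))
         (etilde (nth 0%N s 2)) (etilde (nth 0%N s 3)).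

End CayleyGrassmannian.

Arguments cayley_grassmannian : clear implicits.

Definition fixed_labels : seq (seq nat) :=
  [:: [:: 0; 1; 2; 3]; [:: 0; 1; 4; 5]; [:: 0; 1; 6; 7]; [:: 2; 3; 4; 5];
      [:: 2; 3; 6; 7]; [:: 4; 5; 6; 7]; [:: 0; 1; 5; 6]; [:: 2; 3; 5; 6];
      [:: 1; 3; 5; 6]; [:: 0; 2; 5; 6]; [:: 1; 2; 5; 6]; [:: 0; 3; 5; 6];
      [:: 1; 2; 3; 5]; [:: 1; 5; 6; 7]; [:: 0; 1; 3; 5]; [:: 3; 5; 6; 7];
      [:: 0; 1; 2; 6]; [:: 2; 4; 5; 6]; [:: 0; 2; 3; 6]; [:: 0; 4; 5; 6];
      [:: 1; 2; 3; 7]; [:: 1; 4; 5; 7]; [:: 0; 1; 3; 7]; [:: 3; 4; 5; 7];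
      [:: 0; 1; 2; 4]; [:: 2; 4; 6; 7]; [:: 0; 2; 3; 4]; [:: 0; 4; 6; 7];
      [:: 0; 1; 4; 7]; [:: 2; 3; 4; 7]; [:: 1; 3; 4; 7]; [:: 0; 2; 4; 7];
      [:: 1; 2; 4; 7]; [:: 0; 3; 4; 7]; [:: 1; 3; 5; 7]; [:: 1; 2; 5; 7];
      [:: 0; 3; 5; 7]; [:: 1; 2; 4; 6]; [:: 0; 3; 4; 6]; [:: 0; 2; 4; 6];
      [:: 1; 2; 4; 5]; [:: 1; 2; 6; 7]; [:: 0; 3; 4; 5]; [:: 0; 3; 6; 7]].

Definition singular_labels : seq (seq nat) :=
  [:: [:: 0; 2; 4; 6]; [:: 0; 3; 4; 7]; [:: 0; 3; 5; 6]; [:: 1; 2; 4; 7];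
      [:: 1; 2; 5; 6]; [:: 1; 3; 5; 7]].

(* Main.v *)
Require Import Defs.
From mathcomp Require Import all_boot all_order all_algebra all_fingroup.
From mathcomp Require Import boolp classical_sets reals.
From mathcomp.real_closed Require Import complex.
From mathcomp.multinomials Require Import mpoly.
From mathcomp Require Import ring zify.

Set Implicit Arguments.
Unset Strict Implicit.
Unset Printing Implicit Defensive.

Import Order.TTheory GRing.Theory Num.Theory.

Local Open Scope classical_set_scope.
Local Open Scope ring_scope.

(** Let q_abcd denote the Pluecker coordinates with respect to the eigenbasis
    e~_0, ..., e~_7 of the torus. In these coordinates the seven linear
    equations of the Cayley Grassmannian X become, up to invertible linear
    combinations, equations with coefficients 1 and -1 such as q_0257 = q_1346;
    they are the seven components of [cayley_form], and
    [cayley_frame_etilde] is this change of coordinates. Hence X is the set of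
    the points [pluck (A *m etilde_mx)] with [A] of rank 4 and
    [cayley_eqs A]. An invertible matrix that can replace [etilde_mx] here is called a frame;
    a linear substitution of the eight coordinates that preserves the seven
    equations turns a frame into another one ([cayley_frame_op]), that is, it
    is a symmetry of X.

    Fixed points. The element h(2,3,5) of the torus has eight distinct
    eigenvalues on e~_0, ..., e~_7. If the minor of [A] in the columns I is
    nonzero at a fixed point, then every minor whose columns are I with one
    column exchanged belongs to another weight and vanishes, so that the plane
    is the coordinate plane e~_I ([fixed_point_label]). Of the 70 coordinate
    planes, 44 satisfy the equations, which is a finite check.

    Smooth points. On the cell where q_0247 is not 0, the columns 0, 2, 4, 7 of
    [A] can be made the identity matrix. Four of the seven equations then
    express four of the sixteen other entries as polynomials in the remaining
    twelve, and the other three equations follow: X is an affine space of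
    dimension 12 there, hence smooth ([affine_chart_smooth],
    [frame_chart_smooth]). A suitable product of five unipotent symmetries of X
    moves all the 38 points in question into that cell at once
    ([nonsingular_label_smooth]).

    Singular points. A symmetry of order six that permutes the vectors e~_j
    permutes the six points cyclically, so that only e~_0246 matters. On the
    cell where q_0246 is not 0 there are again sixteen coordinates, the point is
    the origin, only one of the equations has a nonzero linear part, and X
    contains fifteen lines through the origin with independent directions; so
    the tangent space has dimension at least 15 ([singular_tangent_dim]). But X satisfies a quadratic equation besides the
    linear one, so that its dimension there is at most 14
    ([singular_chain_leq]).

    Dimensions are lengths of chains of irreducible closed sets through the
    point, so upper bounds need an argument. In a chain of length k, a form
    that vanishes on each member but not on the next one gives k functions
    without algebraic relations on the largest member
    ([chain_monomial_free]). If that member is, generically, parametrized by d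
    coordinates, a dimension count of spaces of polynomials shows that k is
    at most d ([chain_length_leq]). *)

(** * Homogeneous forms on closed cones and chains of irreducible sets *)

Section LinearForms.
Variables (R : realType) (n : nat).
Local Notation C := R[i].
Implicit Types (W Z : set 'rV[C]_n) (F G : {mpoly C[n]}) (x p : 'rV[C]_n).

Definition vanishes F W := forall x, W x -> F.@[x 0] = 0.

Definition linform (l : 'cV[C]_n) : {mpoly C[n]} := \sum_(j < n) l j 0 *: 'X_j.

Lemma linformE l x : (linform l).@[x 0] = (x *m l) 0 0.
Proof.
rewrite raddf_sum mxE /=; apply: eq_bigr => j _.
by rewrite mevalZ mevalXU mulrC.
Qed.

Lemma linform_homog l : linform l \is 1.-homog.
Proof.
by apply: rpred_sum => j _; apply/dhomogZ; rewrite dhomogX /= mdeg1.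
Qed.

Lemma homog_evalZ d F (c : C) x :
  F \is d.-homog -> F.@[(c *: x) 0] = c ^+ d * F.@[x 0].
Proof.
move=> Fd; rewrite !mevalE mulr_sumr; apply: eq_big_seq => m mF.
have /= <- := dhomog_mf Fd mF.
rewrite mulrCA; congr (_ * _); rewrite mdegE -prodrXr.
rewrite -big_split /=; apply: eq_bigr => i _.
by rewrite mxE exprMn.
Qed.

(** The members of a closed set are homogeneous coordinates, hence
    form a cone without its vertex. *)
Lemma zariski_closedZ W x (c : C) :
  zariski_closed W -> c != 0 -> W x -> W (c *: x).
Proof.
move=> [S [Sh WS]] c0 /WS[x0 Fx]; apply/WS; split.
  by rewrite scaler_eq0 negb_or c0.
by move=> F SF; have [d Fd] := Sh F SF; rewrite (homog_evalZ _ _ Fd) Fx// mulr0.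
Qed.

Lemma zariski_closed_hypersurface d F :
  F \is d.-homog -> zariski_closed [set x : 'rV[C]_n | x != 0 /\ F.@[x 0] = 0].
Proof.
move=> Fd; exists [set F]; split=> [G ->|x]; first by exists d.
by split=> [[x0 Fx]|[x0 Fx]]; split => //; [move=> G -> | exact: Fx].
Qed.

Lemma irreducible_closed_neq0 W x : irreducible_closed W -> W x -> x != 0.
Proof. by move=> [[S [_ WS]] _ _] /WS[]. Qed.

(** The homogeneous ideal of an irreducible set is prime: the zero sets of the
    two factors cover it. *)
Lemma irreducible_closed_vanishesM W d e F G : irreducible_closed W ->
  F \is d.-homog -> G \is e.-homog -> vanishes (F * G) W ->
  vanishes F W \/ vanishes G W.
Proof.
move=> Wirr Fd Ge FG0; have [Wcl _ Wirr'] := Wirr.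
have [] := Wirr' _ _ (zariski_closed_hypersurface Fd)
  (zariski_closed_hypersurface Ge).
- move=> x Wx; have x0 := irreducible_closed_neq0 Wirr Wx.
  have /eqP := FG0 _ Wx; rewrite mevalM mulf_eq0 => /orP[]/eqP; by [left|right].
- by move=> WF; left=> x /WF[].
- by move=> WG; right=> x /WG[].
Qed.

Lemma irreducible_closed_vanishesX W d F m : irreducible_closed W ->
  F \is d.-homog -> vanishes (F ^+ m) W -> vanishes F W.
Proof.
move=> Wirr Fd; elim: m => [V x Wx|m IH].
  by have /eqP := V x Wx; rewrite expr0 meval1 oner_eq0.
by rewrite exprS => /(irreducible_closed_vanishesM Wirr Fd (dhomogMn m Fd))[].
Qed.

End LinearForms.

Section Homogenization.
Variables (R : realType) (n d : nat).
Local Notation C := R[i].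
Variables (l0 : 'cV[C]_n) (l : 'M[C]_(n, d)).

(** In the chart where the form [l0] is 1, the columns of [l] are affine
    coordinates; a polynomial [G] in them becomes a form of degree [msize G],
    which exceeds the degree of [G] by one. *)
Definition homogenize (G : {mpoly C[d]}) : {mpoly C[n]} :=
  \sum_(m <- msupp G) G@_m *: (linform l0 ^+ (msize G - mdeg m) *
                               \prod_(i < d) linform (col i l) ^+ m i).

Lemma homogenize_homog G : homogenize G \is (msize G).-homog.
Proof.
rewrite /homogenize big_seq; apply: rpred_sum => m mG; apply: dhomogZ.
have le_m : (mdeg m <= msize G)%N by apply/ltnW/msize_mdeg_lt.
rewrite -{2}(subnK le_m); apply: dhomogM.
  by have := dhomogMn (msize G - mdeg m) (linform_homog l0); rewrite mul1n.
rewrite mdegE; elim/big_ind2: _ => [|e F e' F'|i _]; first exact: dhomog1.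
  by move=> ? ?; apply: dhomogM.
by have := dhomogMn (m i) (linform_homog (col i l)); rewrite mul1n.
Qed.

Lemma homogenizeE G (x : 'rV[C]_n) : (x *m l0) 0 0 != 0 ->
  (homogenize G).@[x 0] =
  ((x *m l0) 0 0) ^+ msize G * G.@[(((x *m l0) 0 0)^-1 *: (x *m l)) 0].
Proof.
move=> x0; rewrite raddf_sum [in RHS]mevalE mulr_sumr /=.
apply: eq_big_seq => m mG.
have le_m : (mdeg m <= msize G)%N by apply/ltnW/msize_mdeg_lt.
rewrite mevalZ mulrCA; congr (_ * _).
rewrite mevalM rmorphXn /= linformE rmorph_prod /=.
under [X in _ = _ * X]eq_bigr do rewrite mxE exprMn.
rewrite big_split /= prodrXr -mdegE mulrA exprVn -expfB_cond //; last first.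
  by rewrite (negbTE x0).
congr (_ * _); apply: eq_bigr => i _.
rewrite rmorphXn /= linformE; congr (_ ^+ _).
by rewrite !mxE; apply: eq_bigr => j _; rewrite mxE.
Qed.

End Homogenization.

Section ChainIndependence.
Variables (R : realType) (n : nat).
Local Notation C := R[i].
Variables (W : nat -> set 'rV[C]_n) (p : 'rV[C]_n).
Variables (L : {mpoly C[n]}) (F : nat -> {mpoly C[n]}) (deg : nat -> nat).
Variable k : nat.
Hypothesis Wirr : forall i, (i <= k)%N -> irreducible_closed (W i).
Hypothesis Wp : forall i, (i <= k)%N -> W i p.
Hypothesis WS : forall i, (i < k)%N -> W i `<=` W i.+1.
Hypothesis L_homog : L \is 1.-homog.
Hypothesis Lp : L.@[p 0] != 0.
Hypothesis F_homog : forall i, (i < k)%N -> F i \is (deg i).-homog.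
Hypothesis F0 : forall i, (i < k)%N -> vanishes (F i) (W i).
Hypothesis FS : forall i, (i < k)%N -> ~ vanishes (F i) (W i.+1).
Variable N : nat.
Hypothesis N_gt0 : (0 < N)%N.

(** The form [F 0 ^+ a_0 * ... * F j.-1 ^+ a_(j-1)], where the [a_i] are the
    digits of [a] in base [N], times the power of [L] that makes its degree
    independent of [a]. *)
Fixpoint chain_monomial (j a : nat) : {mpoly C[n]} :=
  if j is j'.+1 then
    chain_monomial j' (a %% N ^ j') *
    (F j' ^+ (a %/ N ^ j') * L ^+ (deg j' * (N.-1 - a %/ N ^ j')))
  else 1.

Lemma chain_monomial_homog j a : (j <= k)%N -> (a < N ^ j)%N ->
  chain_monomial j a \is (N.-1 * \sum_(i < j) deg i).-homog.
Proof.
elim: j a => [|j IH] a jk aN /=; first by rewrite big_ord0 muln0 dhomog1.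
rewrite big_ord_recr mulnDr /=; apply: dhomogM.
  by apply: IH; [exact: ltnW | rewrite ltn_mod expn_gt0 N_gt0].
have le_N : (a %/ N ^ j <= N.-1)%N.
  by rewrite -ltnS prednK// ltn_divLR ?expn_gt0 ?N_gt0// -expnS.
have {2}-> : (N.-1 = a %/ N ^ j + (N.-1 - a %/ N ^ j))%N by rewrite subnKC.
rewrite mulnDl [(a %/ _ * _)%N]mulnC [((_ - _) * _)%N]mulnC; apply: dhomogM.
  exact/dhomogMn/F_homog.
by have := dhomogMn (deg j * (N.-1 - a %/ N ^ j)) L_homog; rewrite mul1n.
Qed.

(** Induction along the chain: on [W j.+1] the form [F j] does not vanish,
    so that the lowest power of it can be divided out of a linear relation;
    restricting the quotient to [W j], where [F j] vanishes, leaves a relation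
    between monomials in the earlier forms. On [W 0] the only monomial is 1. *)
Lemma chain_monomial_free j (c : nat -> C) : (j <= k)%N ->
  vanishes (\sum_(0 <= a < N ^ j) c a *: chain_monomial j a) (W j) ->
  forall a, (a < N ^ j)%N -> c a = 0.
Proof.
elim: j c => [|j IH] c jk.
  rewrite expn0 big_nat1 /= => V [|//] _.
  by have := V p (Wp jk); rewrite mevalZ meval1 mulr1.
have jk' : (j <= k)%N by exact: ltnW.
have Nj_gt0 : (0 < N ^ j)%N by rewrite expn_gt0 N_gt0.
pose S m := \sum_(0 <= a < N ^ j) c (m * N ^ j + a)%N *: chain_monomial j a.
have S_homog m : S m \is (N.-1 * \sum_(i < j) deg i).-homog.
  rewrite /S big_nat; apply: rpred_sum => a aN; apply: dhomogZ.
  exact: chain_monomial_homog.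
have -> : \sum_(0 <= a < N ^ j.+1) c a *: chain_monomial j.+1 a =
    \sum_(0 <= m < N) S m * (F j ^+ m * L ^+ (deg j * (N.-1 - m))).
  rewrite expnS big_nat_mul; apply: eq_bigr => m _.
  rewrite mulSn -{1}[(m * _)%N]add0n big_addn addnK /S mulr_suml.
  rewrite big_nat [RHS]big_nat; apply: eq_bigr => a /andP[_ aN] /=.
  rewrite addnC modnMDl modn_small// divnMDl// divn_small// addn0.
  by rewrite -scalerAl.
move=> V.
suff c0 m : (m < N)%N -> forall a, (a < N ^ j)%N -> c (m * N ^ j + a)%N = 0.
  move=> a aN; rewrite (divn_eq a (N ^ j)); apply: c0; last by rewrite ltn_mod.
  by rewrite ltn_divLR// -expnS.
(* [m] is the exponent of [F j] that is being eliminated; all the lower ones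
   have vanishing coefficients by [IHm]. *)
elim/ltn_ind: m => m IHm mN; apply: IH => //.
pose T := \sum_(m <= i < N) S i * (F j ^+ (i - m) * L ^+ (deg j * (N.-1 - i))).
have FT0 : vanishes (F j ^+ m * T) (W j.+1).
  move=> x Wx; rewrite -(V x Wx); congr (_.@[_]).
  rewrite (big_cat_nat (n := m)) //=; last exact: ltnW.
  rewrite [X in _ = X + _]big_nat [X in _ = X + _]big1 => [|i /andP[_ im]]; last first.
    rewrite [S i](_ : _ = 0) ?mul0r// /S big_nat big1// => a aN.
    by rewrite IHm ?scale0r// (ltn_trans im).
  rewrite add0r /T mulr_sumr; apply: eq_big_nat => i /andP[mi _].
  by rewrite mulrCA [F j ^+ m * _]mulrA -exprD subnKC.
have T0 : vanishes T (W j.+1).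
  have T_homog : T \is (N.-1 * \sum_(i < j) deg i + deg j * (N.-1 - m)).-homog.
    rewrite /T big_nat; apply: rpred_sum => i /andP[mi iN].
    apply: dhomogM => //.
    have -> : (deg j * (N.-1 - m) = deg j * (i - m) + deg j * (N.-1 - i))%N.
      rewrite -mulnDr addnC addnBA// subnK// -ltnS prednK//.
    apply: dhomogM; first exact/dhomogMn/F_homog.
    by have := dhomogMn (deg j * (N.-1 - i)) L_homog; rewrite mul1n.
  have [|//] := irreducible_closed_vanishesM (Wirr jk)
    (dhomogMn m (F_homog jk)) T_homog FT0.
  by move/(irreducible_closed_vanishesX (Wirr jk) (F_homog jk)) => /(FS jk).
have SL0 : vanishes (S m * L ^+ (deg j * (N.-1 - m))) (W j).
  move=> x Wx; rewrite -(T0 x (WS jk Wx)) /T big_ltn// subnn expr0 mul1r.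
  rewrite mevalD raddf_sum /= [X in _ + X]big_nat big1 ?addr0// => i /andP[mi _].
  rewrite !mevalM rmorphXn /= (F0 jk Wx) expr0n subn_eq0 leqNgt mi /=.
  by rewrite mul0r mulr0.
have [//|] := irreducible_closed_vanishesM (Wirr jk') (S_homog m)
  (dhomogMn _ L_homog) SL0.
move/(irreducible_closed_vanishesX (Wirr jk') L_homog) => /(_ p (Wp jk'))/eqP.
by rewrite (negbTE Lp).
Qed.

End ChainIndependence.

(** * Upper bound for the length of a chain *)

(** The monomials of degree less than [B] in [d] variables have all their
    exponents below [B], so that they span a space of dimension at most
    [B ^ d]. *)
Lemma mpoly_linear_dependence (K : fieldType) (d B M : nat)
    (g : 'I_M -> {mpoly K[d]}) :
  (forall i, (msize (g i) <= B)%N) -> (B ^ d < M)%N ->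
  exists2 c : 'I_M -> K, exists i, c i != 0 & \sum_i c i *: g i = 0.
Proof.
move=> gB ltM; pose mon (f : {ffun 'I_d -> 'I_B}) := [multinom (f t : nat) | t < d].
pose A := \matrix_(i < M, j < #|{ffun 'I_d -> 'I_B}|) (g i)@_(mon (enum_val j)).
have nfree : ~~ row_free A.
  rewrite /row_free neq_ltn (leq_ltn_trans (rank_leq_col A))//.
  by rewrite card_ffun !card_ord.
move: nfree; rewrite -kermx_eq0 => /rowV0Pn[u /sub_kermxP uA u0].
exists (u 0).
  apply/existsP; apply: contraR u0; rewrite negb_exists => /forallP u0.
  by apply/eqP/rowP => i; rewrite mxE; have /negPn/eqP := u0 i.
apply/mpolyP => m; rewrite mcoeff0 raddf_sum /=.
have gZ i : (u 0 i *: g i)@_m = u 0 i * (g i)@_m by rewrite mcoeffZ.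
rewrite (eq_bigr _ (fun i _ => gZ i)).
have [Bm|mB] := leqP B (mdeg m).
  rewrite big1// => i _; rewrite memN_msupp_eq0 ?mulr0//.
  exact/msize_mdeg_ge/(leq_trans (gB i)).
have mtB t : (m t < B)%N.
  by apply: leq_ltn_trans mB; rewrite mdegE (bigD1 t)//= leq_addr.
pose f := [ffun t => Ordinal (mtB t)].
have := congr1 (fun v : 'rV_ _ => v 0 (enum_rank f)) uA.
rewrite !mxE => uAf; rewrite -[RHS]uAf; apply: eq_bigr => i _; rewrite mxE enum_rankK.
by congr (_ * _@_ _); apply/mnmP => t; rewrite mnmE ffunE.
Qed.

Lemma msizeM_leq (K : idomainType) (d a b : nat) (f g : {mpoly K[d]}) :
  (msize f <= a.+1)%N -> (msize g <= b.+1)%N -> (msize (f * g) <= (a + b).+1)%N.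
Proof.
move=> fa gb; have [->|f0] := eqVneq f 0; first by rewrite mul0r msize0.
have [->|g0] := eqVneq g 0; first by rewrite mulr0 msize0.
by rewrite msizeM// -ltnS (leq_trans (leqSpred _))// ltnS; lia.
Qed.

Lemma msizeX_leq (K : idomainType) (d a m : nat) (f : {mpoly K[d]}) :
  (msize f <= a.+1)%N -> (msize (f ^+ m) <= (m * a).+1)%N.
Proof.
move=> fa; elim: m => [|m IH]; first by rewrite expr0 msize1.
by rewrite exprS mulSn; apply: msizeM_leq.
Qed.

Lemma msize_comp_leq (K : idomainType) (n d e v : nat) (F : {mpoly K[n]})
    (N : n.-tuple {mpoly K[d]}) :
  F \is e.-homog -> (forall j, (msize (tnth N j) <= v.+1)%N) ->
  (msize (F \mPo N) <= (e * v).+1)%N.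
Proof.
move=> Fe Nv; rewrite comp_mpolyEX.
apply: leq_trans (msize_sum _ _ _) _; apply/bigmax_leqP_seq => m mF _.
apply: leq_trans (msizeZ_le _ _) _.
have /= <- := dhomog_mf Fe mF; rewrite comp_mpolyX mdegE big_distrl /=.
apply: (@big_ind2 _ _ (fun (f : {mpoly K[d]}) a => (msize f <= a.+1)%N)).
- by rewrite msize1.
- by move=> f a g b; apply: msizeM_leq.
- by move=> i _; apply: msizeX_leq.
Qed.

Lemma chain_separation (R : realType) (n k : nat) (W : nat -> set 'rV[R[i]]_n) :
  (forall i, (i <= k)%N -> irreducible_closed (W i)) ->
  (forall i, (i < k)%N -> W i `<` W i.+1) ->
  exists (F : nat -> {mpoly R[i][n]}) (deg : nat -> nat), forall i, (i < k)%N ->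
    [/\ F i \is (deg i).-homog, vanishes (F i) (W i) & ~ vanishes (F i) (W i.+1)].
Proof.
move=> Wirr Wlt.
have sep i : exists Fd : {mpoly R[i][n]} * nat, (i < k)%N ->
    [/\ Fd.1 \is Fd.2.-homog, vanishes Fd.1 (W i) & ~ vanishes Fd.1 (W i.+1)].
  have [ik|] := boolP (i < k)%N; last by exists (0, 0%N).
  have [_ /existsNP[x /not_implyP[Wx nWx]]] := Wlt i ik.
  have [[S [Sh WS]] _ _] := Wirr i (ltnW ik).
  have x0 := irreducible_closed_neq0 (Wirr _ ik) Wx.
  have /existsNP[F /not_implyP[SF Fx]] : ~ forall F, S F -> F.@[x 0] = 0.
    by move=> Sx; apply: nWx; apply/WS.
  have [e Fe] := Sh F SF; exists (F, e) => _; split=> //=.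
    by move=> y /WS[_]; exact.
  by move=> /(_ x Wx).
have [Fd Fd_sep] := choice sep.
by exists (fun i => (Fd i).1), (fun i => (Fd i).2) => i /Fd_sep.
Qed.

(** On the chart [l0 = 1] of [W k], outside the zeros of [D], the point [x] is
    determined by the [d] coordinates [x *m l] through the polynomials [N].
    The [M ^ k] monomials in [k] separating forms are linearly independent on
    [W k], but they pull back to polynomials in [d] variables whose degree is
    at most [M] times a constant [c]; these span a space of dimension
    at most [(M * c) ^ d], less than [M ^ k] if [k > d] and [M] is large. The
    denominator [D] allows a parametrization that is only rational. *)
Lemma chain_length_leq (R : realType) (n d k : nat) (W : nat -> set 'rV[R[i]]_n)
    (p q : 'rV[R[i]]_n) (l0 : 'cV[R[i]]_n) (l : 'M[R[i]]_(n, d))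
    (D : {mpoly R[i][d]}) (N : n.-tuple {mpoly R[i][d]}) :
  (forall i, (i <= k)%N -> irreducible_closed (W i)) ->
  (forall i, (i <= k)%N -> W i p) ->
  (forall i, (i < k)%N -> W i `<` W i.+1) ->
  (p *m l0) 0 0 != 0 ->
  W k q -> (q *m l0) 0 0 = 1 -> D.@[(q *m l) 0] != 0 ->
  (forall x, W k x -> (x *m l0) 0 0 = 1 ->
     forall j, D.@[(x *m l) 0] * x 0 j = (tnth N j).@[(x *m l) 0]) ->
  (k <= d)%N.
Proof.
move=> Wirr Wp Wlt p0 Wq q1 Dq DN; rewrite leqNgt; apply/negP => lt_dk.
have [F [deg FW]] := chain_separation Wirr Wlt.
pose L := linform l0; have L1 : L \is 1.-homog := linform_homog l0.
have Lp : L.@[p 0] != 0 by rewrite linformE.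
have [Wcl _ _] := Wirr k (leqnn k).
pose v := \max_(j < n) msize (tnth N j).
have Nv j : (msize (tnth N j) <= v.+1)%N.
  by apply: leqW; exact: (leq_bigmax j).
pose delta := (\sum_(i < k) deg i)%N.
(* [M] is chosen so that [(M * c) ^ d < M ^ d.+1]. *)
pose c := (delta * v).+1; pose M := (c ^ d).+1.
have F_homog i : (i < k)%N -> F i \is (deg i).-homog by move=> /FW[].
have F0 i : (i < k)%N -> vanishes (F i) (W i) by move=> /FW[].
have FS i : (i < k)%N -> ~ vanishes (F i) (W i.+1) by move=> /FW[].
have WS i : (i < k)%N -> W i `<=` W i.+1 by move=> /Wlt[].
pose mon a := chain_monomial L F deg M k a.
pose E := (M.-1 * delta)%N.
have mon_homog a : (a < M ^ k)%N -> mon a \is E.-homog.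
  exact: (chain_monomial_homog L1 F_homog (ltn0Sn _) (leqnn k)).
have mon_size (a : 'I_(M ^ k)) : (msize (mon a \mPo N) <= M * c)%N.
  apply: leq_trans (msize_comp_leq (mon_homog a (ltn_ord a)) Nv) _.
  by rewrite /E /M /c mulSn -mulnA mulnS; lia.
have [|b [a0 ba0] bN] := mpoly_linear_dependence mon_size.
  rewrite expnMn (leq_trans _ (leq_pexp2l _ lt_dk))// expnS mulnC.
  by rewrite ltn_pmul2r ?expn_gt0.
pose b' a := if insub a is Some i then b i else 0.
pose S := \sum_(0 <= a < M ^ k) b' a *: mon a.
have S_homog : S \is E.-homog.
  rewrite /S big_nat; apply: rpred_sum => a /andP[_ aM]; apply: dhomogZ.
  exact: mon_homog.
have SE : S = \sum_(a < M ^ k) b a *: mon a.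
  by rewrite /S big_mkord; apply: eq_bigr => a _; rewrite /b' valK.
have S0 x : W k x -> (x *m l0) 0 0 = 1 -> D.@[(x *m l) 0] != 0 -> S.@[x 0] = 0.
  move=> Wx x1 Dx; apply/eqP; rewrite -(mulrI_eq0 _ (mulfI (expf_neq0 E Dx))).
  rewrite -(homog_evalZ _ _ S_homog).
  have -> : S.@[(D.@[(x *m l) 0] *: x) 0] = (S \mPo N).@[(x *m l) 0].
    by rewrite comp_mpoly_meval; apply: meval_eq => j; rewrite mxE DN.
  have -> : S \mPo N = \sum_(a < M ^ k) b a *: (mon a \mPo N).
    by rewrite SE raddf_sum; apply: eq_bigr => a _; exact: comp_mpolyZ.
  by rewrite bN meval0.
(* The relation [S] holds where [l0] and [D] are nonzero, so [L * Dh * S]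
   vanishes on all of [W k]; by irreducibility so does [S], as [q] shows that
   [L * Dh] does not. *)
pose Dh := homogenize l0 l D.
have LDS : vanishes (L * Dh * S) (W k).
  move=> x Wx; rewrite !mevalM.
  have [->|Lx] := eqVneq L.@[x 0] 0; first by rewrite !mul0r.
  rewrite linformE in Lx; set a := (x *m l0) 0 0 in Lx.
  have Wy := zariski_closedZ Wcl (invr_neq0 Lx) Wx.
  have y1 : (a^-1 *: x *m l0) 0 0 = 1 by rewrite -scalemxAl mxE mulVf.
  rewrite /Dh homogenizeE// -/a scalemxAl.
  have [->|Dy] := eqVneq D.@[(a^-1 *: x *m l) 0] 0.
    by rewrite mulr0 mulr0 mul0r.
  have -> : x = a *: (a^-1 *: x) by rewrite scalerA mulfV// scale1r.
  by rewrite (homog_evalZ _ _ S_homog) (S0 _ Wy y1 Dy) !mulr0.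
have Sv : vanishes S (W k).
  have [|//] := irreducible_closed_vanishesM (Wirr k (leqnn k))
    (dhomogM L1 (homogenize_homog l0 l D)) S_homog LDS.
  move=> /(_ q Wq); rewrite mevalM linformE q1 homogenizeE q1 ?oner_eq0//.
  by rewrite expr1n invr1 scale1r !mul1r => /eqP; rewrite (negbTE Dq).
have := chain_monomial_free Wirr Wp WS L1 Lp F_homog F0 FS (ltn0Sn _) (leqnn k) Sv.
move=> /(_ a0 (ltn_ord a0)) /eqP; rewrite /b' valK.
by rewrite (negbTE ba0).
Qed.

(** * Tangent vectors from curves *)

Lemma mpoly_ring_ind (n : nat) (K : comNzRingType) (P : {mpoly K[n]} -> Prop) :
  (forall c, P c%:MP) -> (forall i, P 'X_i) ->
  (forall F G, P F -> P G -> P (F + G)) ->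
  (forall F G, P F -> P G -> P (F * G)) -> forall F, P F.
Proof.
move=> PC PX PD PM; apply: mpolyind; first by rewrite -mpolyC0.
move=> c m F _ _ PF; apply: PD => //; rewrite -mul_mpolyC; apply: (PM _ _) => //.
rewrite mpolyXE_id; apply: (big_ind P) => [||i _]; [by rewrite -mpolyC1|exact: PM|].
elim: (m i) => [|e IH]; first by rewrite expr0 -mpolyC1.
by rewrite exprS; apply: PM.
Qed.

Lemma poly_vanishing_everywhere (K : numDomainType) (f : {poly K}) :
  (forall t, f.[t] = 0) -> f = 0.
Proof.
move=> f0; apply/eqP; apply/negPn/negP => fn0.
have := max_poly_roots (rs := [seq j%:R | j <- iota 0 (size f)]) fn0.
rewrite size_map size_iota ltnn map_inj_uniq ?iota_uniq; last first.
  by move=> a b /eqP; rewrite eqr_nat => /eqP.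
by move=> /(_ _ isT) H; suff: false by []; apply: H; apply/allP => x _; apply/rootP.
Qed.

Section CurvesAndTangents.
Variables (R : realType) (n : nat).
Local Notation C := R[i].
Variable gamma : 'I_n -> {poly C}.

Definition pullback (F : {mpoly C[n]}) : {poly C} := (map_mpoly polyC F).@[gamma].

Lemma pullbackC c : pullback c%:MP = c%:P.
Proof. by rewrite /pullback map_mpolyC mevalC. Qed.

Lemma pullbackX j : pullback 'X_j = gamma j.
Proof. by rewrite /pullback map_mpolyX mevalXU. Qed.

Lemma pullbackD F G : pullback (F + G) = pullback F + pullback G.
Proof.
exact: etrans (congr1 (meval gamma) (rmorphD (map_mpoly polyC) F G)) (mevalD _ _ _).
Qed.

Lemma pullbackM F G : pullback (F * G) = pullback F * pullback G.
Proof.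
exact: etrans (congr1 (meval gamma) (rmorphM (map_mpoly polyC) F G)) (mevalM _ _ _).
Qed.

Lemma horner_pullback F t : (pullback F).[t] = F.@[fun j => (gamma j).[t]].
Proof.
apply: (@mpoly_ring_ind _ _ (fun F => (pullback F).[t] = F.@[fun j => (gamma j).[t]])).
- by move=> c; rewrite pullbackC hornerC mevalC.
- by move=> j; rewrite pullbackX mevalXU.
- by move=> f g f_t g_t; rewrite pullbackD hornerD mevalD; congr (_ + _).
- by move=> f g f_t g_t; rewrite pullbackM hornerM mevalM; congr (_ * _).
Qed.

Lemma deriv_pullback F :
  (pullback F)^`() = \sum_(j < n) pullback F^`M(j) * (gamma j)^`().
Proof.
apply: (@mpoly_ring_ind _ _ (fun F =>
  (pullback F)^`() = \sum_(j < n) pullback F^`M(j) * (gamma j)^`())).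
- move=> c; rewrite pullbackC derivC big1// => j _.
  by rewrite mderivC -mpolyC0 pullbackC mul0r.
- move=> k; rewrite pullbackX (bigD1 k)//= big1 => [|j jk].
    rewrite mderivX mnmE eqxx scale1r.
    have -> : (U_(k) - U_(k) = 0 :> 'X_{1..n})%MM.
      by apply/mnmP => j; rewrite mnmBE subnn mnm0E.
    by rewrite mpolyX0 -mpolyC1 pullbackC mul1r addr0.
  by rewrite mderivX mnmE eq_sym (negbTE jk) scale0r -mpolyC0 pullbackC mul0r.
- move=> f g f' g'; rewrite pullbackD derivD f' g' -big_split.
  by apply: eq_bigr => j _ /=; rewrite mderivD pullbackD mulrDl.
- move=> f g f' g'; rewrite pullbackM derivM f' g'.
  rewrite [X in X + _]mulr_suml [X in _ + X]mulr_sumr -big_split.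
  apply: eq_bigr => j _ /=; rewrite mderivM pullbackD !pullbackM mulrDl.
  by congr (_ + _); [rewrite mulrAC | rewrite mulrA].
Qed.

(** The velocity of a polynomial curve in the cone is a tangent vector. The
    curve may leave [Z] at the finitely many zeros of [b]: polynomials
    that vanish along it elsewhere still vanish identically. *)
Lemma cone_tangent_curve (Z : set 'rV[C]_n) (b : {poly C}) (t0 : C) : b != 0 ->
  (forall t, b.[t] != 0 -> Z (\row_j (gamma j).[t])) ->
  cone_tangent Z (\row_j (gamma j).[t0]) (\row_j (gamma j)^`().[t0]).
Proof.
move=> b0 Zg F [_ FZ].
have F0 : pullback F = 0.
  apply/eqP; rewrite -(mulrI_eq0 _ (mulfI b0)); apply/eqP.
  apply: poly_vanishing_everywhere => t; rewrite hornerM.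
  have [->|bt] := eqVneq b.[t] 0; first by rewrite mul0r.
  rewrite horner_pullback -[X in _ * X = _](_ : F.@[(\row_j (gamma j).[t]) 0] = _).
    by rewrite FZ ?mulr0//; exact: Zg.
  by apply: meval_eq => j; rewrite mxE.
have := congr1 (fun f => f.[t0]) (deriv_pullback F).
rewrite F0 deriv0 horner0 horner_sum => pb0; rewrite [RHS]pb0.
apply: eq_bigr => j _.
rewrite hornerM horner_pullback mxE; congr (_ * _).
by apply: meval_eq => i; rewrite mxE.
Qed.

End CurvesAndTangents.

(** Computes linear forms on a velocity vector from their values along the
    curve. *)
Lemma deriv_linear_functional (R : realType) (n : nat) (g : 'I_n -> {poly R[i]})
    (w : 'cV[R[i]]_n) (f : {poly R[i]}) (t0 : R[i]) :
  (forall t, ((\row_j (g j).[t]) *m w) 0 0 = f.[t]) ->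
  ((\row_j (g j)^`().[t0]) *m w) 0 0 = f^`().[t0].
Proof.
move=> gf; have -> : f = \sum_j w j 0 *: g j.
  apply/eqP; rewrite -subr_eq0; apply/eqP/poly_vanishing_everywhere => s.
  rewrite hornerD hornerN -gf horner_sum mxE -sumrB big1// => j _.
  by rewrite hornerZ mxE mulrC subrr.
rewrite (raddf_sum (@deriv R[i])) horner_sum mxE; apply: eq_bigr => j _ /=.
by rewrite derivZ hornerZ mulrC mxE.
Qed.

(** * Smoothness from an affine chart *)

Section ConeTangentSpace.
Variables (R : realType) (n : nat).
Local Notation C := R[i].
Variables (Z : set 'rV[C]_n) (p : 'rV[C]_n).

Lemma cone_tangentD c u v :
  cone_tangent Z p u -> cone_tangent Z p v -> cone_tangent Z p (c *: u + v).
Proof.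
move=> tu tv F FZ; transitivity
  (c * (\sum_(j < n) F^`M(j).@[p 0] * u 0 j) + \sum_(j < n) F^`M(j).@[p 0] * v 0 j).
  rewrite mulr_sumr -big_split; apply: eq_bigr => j _ /=.
  by rewrite !mxE mulrDr mulrCA.
by rewrite tu// tv// mulr0 addr0.
Qed.

Lemma cone_tangent0 : cone_tangent Z p 0.
Proof. by move=> F _; rewrite big1// => j _; rewrite mxE mulr0. Qed.

Lemma cone_tangent_sum (I : Type) (r : seq I) (c : I -> C) (v : I -> 'rV[C]_n) :
  (forall i, cone_tangent Z p (v i)) ->
  cone_tangent Z p (\sum_(i <- r) c i *: v i).
Proof.
move=> tv; elim: r => [|i r IH]; first by rewrite big_nil; exact: cone_tangent0.
by rewrite big_cons; exact: cone_tangentD.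
Qed.

(** The cone contains the curve [(1 + t) *: p]. *)
Lemma cone_tangent_self : zariski_closed Z -> Z p -> cone_tangent Z p p.
Proof.
move=> Zcl Zp; pose g j := (p 0 j)%:P * (1 + 'X).
have gp : \row_j (g j).[0] = p.
  by apply/rowP => j; rewrite mxE /g !hornerE ?addr0 ?mulr1.
have g'p : \row_j (g j)^`().[0] = p.
  apply/rowP => j; rewrite mxE /g derivM derivC mul0r add0r derivD derivX.
  by rewrite -[1]/(1%:P) derivC add0r mulr1 hornerC.
have := @cone_tangent_curve R n g Z (1 + 'X) 0; rewrite gp g'p; apply.
  by rewrite -size_poly_eq0 addrC -[1]/(1%:P) size_XaddC.
move=> t; rewrite !hornerE => t0.
rewrite [X in Z X](_ : _ = (1 + t) *: p); first exact: zariski_closedZ.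
by apply/rowP => j; rewrite !mxE /g !hornerE mulrC.
Qed.

End ConeTangentSpace.

Section AffineChart.
Variables (R : realType) (n d : nat).
Local Notation C := R[i].
Variables (Z : set 'rV[C]_n) (l0 : 'cV[C]_n) (l : 'M[C]_(n, d)).
Variable phi : n.-tuple {mpoly C[d]}.

Definition chart_map (t : 'rV[C]_d) : 'rV[C]_n := \row_j (tnth phi j).@[t 0].

Lemma chart_mapE t j : chart_map t 0 j = (tnth phi j).@[t 0].
Proof. exact: mxE. Qed.

Hypothesis Zcl : zariski_closed Z.
Hypothesis phiZ : forall t, Z (chart_map t).
Hypothesis phi_l0 : forall t, (chart_map t *m l0) 0 0 = 1.
Hypothesis phi_l : forall t, chart_map t *m l = t.
Hypothesis Zphi :
  forall x, Z x -> (x *m l0) 0 0 = 1 -> x = chart_map (x *m l).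

Lemma zariski_closed_neq0 x : Z x -> x != 0.
Proof. by move: Zcl => [S [_ ZS]] /ZS[]. Qed.

Section Slices.
Variable t0 : 'rV[C]_d.

(** The slices of increasing dimension through [t0] in the parameter space; the
    closures of their images are the members of a chain of length [d]. *)
Definition chart_slice (k : nat) : set 'rV[C]_d :=
  [set t | forall i : 'I_d, (k <= i)%N -> t 0 i = t0 0 i].

Definition slice_closure (k : nat) : set 'rV[C]_n :=
  [set x : 'rV[C]_n | x != 0 /\ forall F, (exists e, F \is e.-homog) ->
    (forall t, chart_slice k t -> F.@[(chart_map t) 0] = 0) -> F.@[x 0] = 0].

Lemma slice_closure_closed k : zariski_closed (slice_closure k).
Proof.
exists [set F | (exists e, F \is e.-homog) /\
  forall t, chart_slice k t -> F.@[(chart_map t) 0] = 0].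
split=> [F []//|x]; split=> [[x0 Fx]|[x0 Fx]]; split=> // F.
  by move=> [Fh Ft]; exact: Fx.
by move=> Fh Ft; apply: Fx.
Qed.

Lemma slice_closure_chart k t : chart_slice k t -> slice_closure k (chart_map t).
Proof. by move=> tk; split=> [|F Fh]; [exact: zariski_closed_neq0 | exact]. Qed.

Lemma slice_closure_sub k : slice_closure k `<=` Z.
Proof.
move: Zcl => [S [Sh ZS]] x [x0 Fx]; apply/ZS; split=> // F SF.
by apply: Fx => [|t _]; [exact: Sh | have /ZS[_] := phiZ t; exact].
Qed.

Definition line_poly (t u : 'rV[C]_d) (i : 'I_d) : {poly C} :=
  (t 0 i)%:P + u 0 i *: 'X.

Lemma horner_line_poly t u i s : (line_poly t u i).[s] = (t + s *: u) 0 i.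
Proof. by rewrite !hornerE !mxE mulrC. Qed.

Definition chart_line (t u : 'rV[C]_d) (j : 'I_n) : {poly C} :=
  pullback (line_poly t u) (tnth phi j).

Lemma horner_chart_line t u j s :
  (chart_line t u j).[s] = chart_map (t + s *: u) 0 j.
Proof.
rewrite horner_pullback mxE; apply: meval_eq => i; exact: horner_line_poly.
Qed.

(** If neither of two closed sets contains the closure, each misses the image
    of some parameter, [t1] or [t2]. Two forms that witness this restrict to
    nonzero polynomials on the line through [t1] and [t2], which is part of the
    slice, so their product cannot vanish on that line. *)
Lemma slice_closure_irreducible k : irreducible_closed (slice_closure k).
Proof.
split; first exact: slice_closure_closed.
  by exists (chart_map t0); apply: slice_closure_chart.
move=> Z1 Z2 [S1 [S1h ZS1]] [S2 [S2h ZS2]] W12; apply: contrapT => /not_orP[].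
have missed S Z' : (forall F, S F -> exists e, F \is e.-homog) ->
    (forall x : 'rV[C]_n, Z' x <-> x != 0 /\ forall F, S F -> F.@[x 0] = 0) ->
    ~ slice_closure k `<=` Z' ->
    exists F t, [/\ S F, chart_slice k t & F.@[(chart_map t) 0] != 0].
  move=> Sh ZS /existsNP[x /not_implyP[[x0 Fx] nZ'x]].
  have /existsNP[F /not_implyP[SF Fx0]] : ~ forall F, S F -> F.@[x 0] = 0.
    by move=> Sx; apply: nZ'x; apply/ZS.
  have /existsNP[t /not_implyP[tk Ft]] :
      ~ forall t, chart_slice k t -> F.@[(chart_map t) 0] = 0.
    by move=> Ft; apply: Fx0; apply: Fx => //; exact: Sh.
  by exists F, t; split=> //; apply/eqP.
move=> /(missed _ _ S1h ZS1)[F1 [t1 [SF1 t1k Ft1]]].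
move=> /(missed _ _ S2h ZS2)[F2 [t2 [SF2 t2k Ft2]]].
pose P F := pullback (chart_line t1 (t2 - t1)) F.
have PE F s : (P F).[s] = F.@[(chart_map (t1 + s *: (t2 - t1))) 0].
  rewrite horner_pullback; apply: meval_eq => j; exact: horner_chart_line.
have P12 : P F1 * P F2 != 0.
  rewrite mulf_neq0//; [apply: contra_neq Ft1|apply: contra_neq Ft2] => P0.
    by rewrite -[t1]addr0 -[X in _ + X](scale0r (t2 - t1)) -PE P0 horner0.
  have -> : t2 = t1 + 1 *: (t2 - t1) by rewrite scale1r addrC subrK.
  by rewrite -PE P0 horner0.
apply/negP: P12; apply/negPn/eqP/poly_vanishing_everywhere => s.
set t := t1 + s *: (t2 - t1).
have tk : chart_slice k t.
  by move=> i ki; rewrite !mxE t1k// t2k// subrr mulr0 addr0.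
rewrite hornerM; case: (W12 _ (slice_closure_chart tk)).
  by move=> /ZS1[_ /(_ F1 SF1) F1t]; rewrite [X in X * _](etrans (PE F1 s) F1t) mul0r.
by move=> /ZS2[_ /(_ F2 SF2) F2t]; rewrite [X in _ * X](etrans (PE F2 s) F2t) mulr0.
Qed.

(** The affine coordinate with index [k] is constant on the slice [k], but not
    on the next one. *)
Lemma slice_closure_properS k : (k < d)%N ->
  slice_closure k `<` slice_closure k.+1.
Proof.
move=> kd; split=> [x [x0 Fx]|].
  split=> // F Fh Ft; apply: Fx => // t tk; apply: Ft => i ki.
  by apply: tk; exact: ltnW.
pose i := Ordinal kd; pose t := t0 + delta_mx 0 i.
have tk : chart_slice k.+1 t.
  move=> j kj; rewrite !mxE eqxx /=; case: eqP => [ji|_]; last by rewrite addr0.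
  by rewrite ji ltnn in kj.
move=> /(_ _ (slice_closure_chart tk))[_].
pose G := linform (col i l) - t0 0 i *: linform l0.
have GE s : G.@[(chart_map s) 0] = s 0 i - t0 0 i.
  rewrite mevalB mevalZ !linformE phi_l0 mulr1; congr (_ - _).
  rewrite -[in RHS](phi_l s) !mxE; apply: eq_bigr => j _; by rewrite !mxE.
move=> H; have /eqP : G.@[(chart_map t) 0] = 0.
  apply: H => [|s /(_ i (leqnn _)) si]; last by rewrite GE si subrr.
  exists 1%N; apply: rpredB; first exact: linform_homog.
  exact/dhomogZ/linform_homog.
by rewrite GE !mxE !eqxx addrAC subrr add0r oner_eq0.
Qed.

End Slices.

Lemma chart_normalize p : Z p -> (p *m l0) 0 0 != 0 ->
  p = (p *m l0) 0 0 *: chart_map (((p *m l0) 0 0)^-1 *: (p *m l)).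
Proof.
move=> Zp p0; set a := (p *m l0) 0 0.
have Zy : Z (a^-1 *: p) by apply: zariski_closedZ => //; rewrite invr_eq0.
have y1 : (a^-1 *: p *m l0) 0 0 = 1 by rewrite -scalemxAl mxE mulVf.
by rewrite scalemxAl -(Zphi Zy y1) scalerA mulfV// scale1r.
Qed.

Lemma chart_local_dim p : Z p -> (p *m l0) 0 0 != 0 -> local_dim Z p d.
Proof.
move=> Zp p0; set a := (p *m l0) 0 0.
pose t0 := a^-1 *: (p *m l); have pE : p = a *: chart_map t0 := chart_normalize Zp p0.
split.
  exists (slice_closure t0); split=> [i _|i id]; last exact: slice_closure_properS.
  split; [exact: slice_closure_irreducible| |exact: slice_closure_sub].
  rewrite pE; apply: zariski_closedZ => //; first exact: slice_closure_closed.
  by apply: slice_closure_chart.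
move=> k [W [Wirr Wlt]].
have [Wk Wkp _] := Wirr k (leqnn k).
have Wcl : zariski_closed (W k) by case: Wk.
have Wkq := zariski_closedZ Wcl (invr_neq0 p0) Wkp.
apply: (@chain_length_leq R n d k W p (a^-1 *: p) l0 l 1 phi) => //.
- by move=> i /Wirr[].
- by move=> i /Wirr[].
- by rewrite -scalemxAl mxE mulVf.
- by rewrite meval1 oner_eq0.
- move=> x Wx x1 j; rewrite meval1 mul1r.
  by have [_ _ /(_ x Wx) Zx] := Wirr k (leqnn k); rewrite {1}(Zphi Zx x1) mxE.
Qed.

Section TangentSpace.
Variable p : 'rV[C]_n.
Hypothesis Zp : Z p.
Hypothesis p0 : (p *m l0) 0 0 != 0.
Let a := (p *m l0) 0 0.
Let t0 := a^-1 *: (p *m l).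

Let pE j : p 0 j = a * chart_map t0 0 j.
Proof.
have := congr1 (fun v : 'rV_n => v 0 j) (chart_normalize Zp p0).
by rewrite -/a -/t0; move: (chart_map t0) => y ->; rewrite mxE.
Qed.

Definition chart_partial (i : 'I_d) : 'rV[C]_n :=
  \row_j (tnth phi j)^`M(i).@[t0 0].

Lemma deriv_line_poly (t u : 'rV[C]_d) (i : 'I_d) :
  (line_poly t u i)^`() = (u 0 i)%:P.
Proof. by rewrite derivD derivC derivZ derivX add0r alg_polyC. Qed.

Lemma deriv_chart_line i j : (chart_line t0 (delta_mx 0 i) j)^`().[0] =
  chart_partial i 0 j.
Proof.
rewrite deriv_pullback (bigD1 i)//= big1 => [|k ki]; last first.
  by rewrite deriv_line_poly mxE (negbTE ki) mulr0.
rewrite deriv_line_poly mxE !eqxx mulr1 addr0 horner_pullback mxE.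
apply: meval_eq => k; by rewrite horner_line_poly scale0r addr0.
Qed.

Lemma chart_partial_tangent i : cone_tangent Z p (a *: chart_partial i).
Proof.
pose g j := a *: chart_line t0 (delta_mx 0 i) j.
have gp : \row_j (g j).[0] = p.
  apply/rowP => j; rewrite mxE hornerZ horner_chart_line scale0r addr0.
  by rewrite pE.
have g'p : \row_j (g j)^`().[0] = a *: chart_partial i.
  by apply/rowP => j; rewrite !mxE derivZ hornerZ deriv_chart_line mxE.
have := @cone_tangent_curve R n g Z 1 0; rewrite gp g'p; apply.
  exact: oner_neq0.
move=> s _; rewrite [X in Z X](_ : _ = a *: chart_map (t0 + s *: delta_mx 0 i)).
  exact: zariski_closedZ.
by apply/rowP => j; rewrite [in RHS]mxE mxE hornerZ horner_chart_line.
Qed.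

Lemma linear_chart_line (w : 'cV[C]_n) i (f : {poly C}) :
  (forall s, (chart_map (t0 + s *: delta_mx 0 i) *m w) 0 0 = f.[s]) ->
  (chart_partial i *m w) 0 0 = f^`().[0].
Proof.
move=> wf; rewrite (_ : chart_partial i =
    \row_j (chart_line t0 (delta_mx 0 i) j)^`().[0]); last first.
  by apply/rowP => j; rewrite [RHS]mxE deriv_chart_line.
apply: deriv_linear_functional => s; rewrite -wf; congr ((_ *m w) 0 0).
by apply/rowP => j; rewrite mxE horner_chart_line.
Qed.

Lemma chart_partial_l0 i : (chart_partial i *m l0) 0 0 = 0.
Proof.
rewrite (@linear_chart_line _ _ 1%:P) ?derivC ?horner0// => s.
by rewrite phi_l0 hornerC.
Qed.

Lemma chart_partial_l i : chart_partial i *m l = delta_mx 0 i.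
Proof.
apply/rowP => m; have -> : (chart_partial i *m l) 0 m =
    (chart_partial i *m col m l) 0 0.
  by rewrite !mxE; apply: eq_bigr => j _; rewrite !mxE.
rewrite (@linear_chart_line _ _ (line_poly t0 (delta_mx 0 i) m)).
  by rewrite deriv_line_poly hornerC.
move=> s; rewrite horner_line_poly -[in RHS](phi_l (t0 + s *: _)) !mxE.
by apply: eq_bigr => j _; rewrite !mxE.
Qed.

(** In the homogeneous ideal lies the form [F] which says that the
    coordinate [j] is the polynomial [phi j] of the affine coordinates. Along
    the line [p + s *: u] the affine coordinates are constant, so that the
    differential of [F] at [p] sends [u] to a nonzero multiple of [u 0 j]. *)
Lemma chart_tangent_inj u : cone_tangent Z p u ->
  (u *m l0) 0 0 = 0 -> u *m l = 0 -> u = 0.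
Proof.
move=> tu ul0 ul; apply/rowP => j; rewrite [RHS]mxE.
pose L := linform l0; pose h := homogenize l0 l (tnth phi j).
pose m := msize (tnth phi j).
pose F := L * (L * h - 'X_j * L ^+ m).
have LE (x : 'rV[C]_n) : L.@[x 0] = (x *m l0) 0 0 by exact: linformE.
have hE (x : 'rV[C]_n) : (x *m l0) 0 0 != 0 ->
    h.@[x 0] = (x *m l0) 0 0 ^+ m * chart_map (((x *m l0) 0 0)^-1 *: (x *m l)) 0 j.
  by move=> x0; rewrite homogenizeE// chart_mapE.
have FZ : in_homog_ideal Z F.
  split.
    exists (1 + (1 + m))%N; apply: dhomogM; first exact: linform_homog.
    apply: rpredB; first exact: dhomogM (linform_homog l0) (homogenize_homog l0 l _).
    apply: dhomogM; first by rewrite dhomogX /= mdeg1.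
    by have := dhomogMn m (linform_homog l0); rewrite mul1n.
  move=> x Zx; rewrite /F mevalM mevalB !mevalM rmorphXn /= mevalXU LE.
  have [->|x0] := eqVneq ((x *m l0) 0 0) 0; first by rewrite mul0r.
  rewrite hE//; have := congr1 (fun v : 'rV_n => v 0 j) (chart_normalize Zx x0).
  move: (chart_map _) => y; rewrite [in X in _ = X -> _]mxE => ->.
  by rewrite -mulrA [y 0 j * _]mulrC subrr mulr0.
pose g k : {poly C} := (p 0 k)%:P + u 0 k *: 'X.
have gE s : \row_k (g k).[s] = p + s *: u.
  by apply/rowP => k; rewrite !mxE !hornerE mulrC.
have meval_g G s : (pullback g G).[s] = G.@[(p + s *: u) 0].
  by rewrite horner_pullback; apply: meval_eq => k; rewrite -gE mxE.
have psl0 s : ((p + s *: u) *m l0) 0 0 = a.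
  by rewrite mulmxDl -scalemxAl mxE [in X in _ + X]mxE ul0 mulr0 addr0.
have psl s : (p + s *: u) *m l = p *m l.
  by rewrite mulmxDl -scalemxAl ul scaler0 addr0.
have hps s : h.@[(p + s *: u) 0] = h.@[p 0].
  by rewrite [LHS]hE ?psl0// psl [RHS]hE.
have gF : pullback g F = (a * (a * h.@[p 0] - p 0 j * a ^+ m))%:P
    - (a * u 0 j * a ^+ m) *: 'X.
  apply/eqP; rewrite -subr_eq0; apply/eqP/poly_vanishing_everywhere => s.
  rewrite hornerD hornerN meval_g /F mevalM mevalB !mevalM rmorphXn /= mevalXU LE psl0.
  rewrite hps !hornerE !mxE -/a.
  move: (h.@[p 0]) (a ^+ m) => x b; ring.
have := congr1 (fun f : {poly C} => f^`().[0]) gF.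
rewrite deriv_pullback horner_sum derivB derivC derivZ derivX.
rewrite (eq_bigr (fun k => F^`M(k).@[p 0] * u 0 k)) => [|k _]; last first.
  rewrite hornerM meval_g scale0r addr0 /g derivD derivC derivZ derivX add0r.
  by rewrite alg_polyC hornerC.
rewrite (tu F FZ) !hornerE => /esym/eqP.
by rewrite oppr_eq0 !mulf_eq0 expf_eq0 (negbTE p0) andbF orbF => /eqP.
Qed.

(** A basis of the tangent space of the cone is [p] with the partial
    derivatives of the chart: what remains of a tangent vector after
    its components along these are removed is annihilated by [l0] and [l]. *)
Lemma chart_tangent_dim : tangent_dim Z p d.
Proof.
pose c (v : 'rV[C]_n) i := a^-1 * (v *m l - (a^-1 * (v *m l0) 0 0) *: (p *m l)) 0 i.
have l0D x y : ((x + y) *m l0) 0 0 = (x *m l0) 0 0 + (y *m l0) 0 0.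
  by rewrite mulmxDl mxE.
have l0N x : (- x *m l0) 0 0 = - (x *m l0) 0 0 by rewrite mulNmx mxE.
have l0Z e x : (e *: x *m l0) 0 0 = e * (x *m l0) 0 0.
  by rewrite -scalemxAl mxE.
have l0S (I : finType) (v : I -> 'rV_n) :
    ((\sum_i v i) *m l0) 0 0 = \sum_i (v i *m l0) 0 0.
  by rewrite mulmx_suml summxE.
pose T := [tuple of p :: [tuple a *: chart_partial i | i < d]].
have decomp v : cone_tangent Z p v ->
    v = (a^-1 * (v *m l0) 0 0) *: p + \sum_i c v i *: (a *: chart_partial i).
  move=> tv; set w := (X in _ = X).
  have tw : cone_tangent Z p w.
    apply: cone_tangentD; first exact: cone_tangent_self.
    by apply: cone_tangent_sum => i; exact: chart_partial_tangent.
  have tvw : cone_tangent Z p (v - w).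
    by rewrite addrC -scaleN1r; exact: cone_tangentD.
  apply/eqP; rewrite -subr_eq0; apply/eqP/(chart_tangent_inj tvw).
    rewrite l0D l0N /w l0D l0Z l0S big1 => [|i _].
      by rewrite addr0 mulrAC mulVf// mul1r subrr.
    by rewrite !l0Z chart_partial_l0 !mulr0.
  rewrite mulmxBl /w mulmxDl mulmx_suml -scalemxAl.
  under eq_bigr => i _ do rewrite -!scalemxAl chart_partial_l.
  apply/eqP; rewrite subr_eq0 addrC -subr_eq; apply/eqP/rowP => i.
  rewrite summxE (bigD1 i)//= [X in _ = _ + X]big1 => [|k ki].
    have -> : (c v i *: (a *: delta_mx 0 i) : 'rV[C]_d) 0 i = c v i * a.
      by rewrite [LHS]mxE [X in _ * X]mxE [X in _ * (_ * X)]mxE !eqxx mulr1.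
    by rewrite addr0 /c mulrAC mulVf// mul1r.
  by rewrite !mxE eq_sym (negbTE ki) andbF !mulr0.
have Tl (i : 'I_d) : T`_(lift ord0 i) = a *: chart_partial i.
  by rewrite /= -(tnth_nth 0 [tuple a *: chart_partial j | j < d]) tnth_mktuple.
have freeT : free T.
  apply/freeP => e; rewrite big_ord_recl.
  rewrite (eq_bigr (fun i => e (lift ord0 i) *: (a *: chart_partial i))) => [|i _].
    2: by rewrite Tl.
  rewrite -[T`_ord0]/p => eT.
  have e0 : e ord0 = 0.
    have := congr1 (fun v : 'rV_n => (v *m l0) 0 0) eT.
    rewrite mul0mx [RHS]mxE l0D l0Z l0S [X in _ + X]big1 => [|i _].
      by rewrite addr0 => /eqP; rewrite mulf_eq0 (negbTE p0) orbF => /eqP.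
    by rewrite !l0Z chart_partial_l0 !mulr0.
  move=> i; case: (unliftP ord0 i) => [k|] -> //.
  have := congr1 (fun v : 'rV_n => (v *m l) 0 k) eT.
  rewrite e0 scale0r add0r mul0mx [RHS]mxE mulmx_suml summxE (bigD1 k)//=.
  rewrite [X in _ + X]big1 => [|m mk].
    rewrite -!scalemxAl chart_partial_l !mxE !eqxx.
    by rewrite mulr1 addr0 => /eqP; rewrite mulf_eq0 (negbTE p0) orbF => /eqP.
  rewrite -!scalemxAl chart_partial_l !mxE.
  by rewrite eq_sym (negbTE mk) andbF !mulr0.
exists <<T>>%VS; last by apply/eqP; rewrite (eqnP freeT) size_tuple.
move=> v; split=> [/coord_span ->|tv].
  apply: cone_tangent_sum => i; case: (unliftP ord0 i) => [k|] ->.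
    by rewrite Tl; exact: chart_partial_tangent.
  exact: cone_tangent_self.
rewrite (decomp v tv); apply: memvD.
  by apply/memvZ/memv_span; rewrite inE eqxx.
apply: memv_suml => i _; apply/memvZ/memv_span.
by rewrite -Tl mem_nth// size_tuple ltn_ord.
Qed.

(** [chart_map] identifies the part of [Z] where [l0] is nonzero, as a subset
    of projective space, with an affine space of dimension [d]. *)
Lemma affine_chart_smooth : smooth_point Z p.
Proof.
split=> //; exists d; [exact: chart_local_dim | exact: chart_tangent_dim].
Qed.

End TangentSpace.
End AffineChart.

(** * Pluecker coordinates *)

Local Notation O := (4 + 4)%N.

(** The increasing columns that form the Pluecker index number [k]. *)
Definition pidx (k : 'I_70) (b : 'I_4) : 'I_O :=
  inord (nth 0%N (nth [::] plucker_index k) b).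

Lemma plucker_index_sorted k : (k < 70)%N ->
  [&& size (nth [::] plucker_index k) == 4%N,
      sorted ltn (nth [::] plucker_index k) &
      all (ltn^~ 8) (nth [::] plucker_index k)].
Proof.
move=> k70; apply: (allP (_ : all (fun s => [&& size s == 4%N, sorted ltn s &
  all (ltn^~ 8) s]) plucker_index)); first by vm_compute.
by rewrite mem_nth// size_plucker_index.
Qed.

Lemma mem_plucker_index s : sorted ltn s -> size s = 4%N -> all (ltn^~ 8) s ->
  s \in plucker_index.
Proof.
case: s => [//|a [//|b [//|c [//|d [|//]]]]] srt _ /and5P[a8 b8 c8 d8 _].
have : all (fun a => all (fun b => all (fun c => all (fun d =>
    sorted ltn [:: a; b; c; d] ==> ([:: a; b; c; d] \in plucker_index))
    (iota 0 8)) (iota 0 8)) (iota 0 8)) (iota 0 8) by vm_compute.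
move=> /allP/(_ a); rewrite mem_iota => /(_ a8).
move=> /allP/(_ b); rewrite mem_iota => /(_ b8).
move=> /allP/(_ c); rewrite mem_iota => /(_ c8).
move=> /allP/(_ d); rewrite mem_iota => /(_ d8).
by rewrite srt.
Qed.

Lemma map_pidx k : [seq val (pidx k b) | b <- enum 'I_4] = nth [::] plucker_index k.
Proof.
have /and3P[/eqP s4 _ s8] := plucker_index_sorted (ltn_ord k).
have s'4 : size [seq val (pidx k b) | b <- enum 'I_4] = 4%N.
  by rewrite size_map size_enum_ord.
apply: (@eq_from_nth _ 0%N) => [|b]; first by rewrite s'4 s4.
rewrite s'4 => b4; rewrite (nth_map (Ordinal b4)) ?size_enum_ord//.
rewrite -[b]/(val (Ordinal b4)) nth_ord_enum /= inordK//.
by apply: (allP s8); rewrite mem_nth// s4.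
Qed.

Lemma pidx_inj k : injective (pidx k).
Proof.
have /and3P[_ srt _] := plucker_index_sorted (ltn_ord k).
have := sorted_uniq ltn_trans ltnn srt; rewrite -map_pidx.
by move=> /injectiveP inj b c bc; apply: inj; rewrite /= bc.
Qed.

(** With [pidx_uniq], injections of four columns are in bijection with pairs of
    a Pluecker index and a permutation. *)
Lemma pidx_surj (f : 'I_4 -> 'I_O) : injective f ->
  exists (k : 'I_70) (s : 'S_4), forall b, f b = pidx k (s b).
Proof.
move=> finj; pose t := [tuple val (f b) | b < 4].
have t_uniq : uniq t.
  rewrite map_inj_uniq ?enum_uniq// => b c bc; exact/finj/val_inj.
have t8 : all (ltn^~ 8) t by apply/allP => _ /mapP[b _ ->]; exact: ltn_ord.
have : sort leq t \in plucker_index.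
  apply: mem_plucker_index; rewrite ?size_sort ?size_tuple ?all_sort//.
  by rewrite ltn_sorted_uniq_leq sort_uniq t_uniq sort_sorted//; exact: leq_total.
move=> /(nthP [::])[k k70 kt]; rewrite size_plucker_index in k70.
pose t' := [tuple val (pidx (Ordinal k70) b) | b < 4].
have : perm_eq t t'.
  rewrite /= (map_pidx (Ordinal k70)) /= kt perm_sym; exact/permPl/perm_sort.
move=> /tuple_permP[s tE]; exists (Ordinal k70), s => b; apply: val_inj.
have := congr1 (nth 0%N ^~ b) tE.
by rewrite -!tnth_nth !tnth_mktuple.
Qed.

Lemma pidx_uniq k k' (s s' : 'S_4) :
  (forall b, pidx k (s b) = pidx k' (s' b)) -> k = k' /\ s = s'.
Proof.
move=> kk'; have kE : k = k'.
  have /and3P[_ srt _] := plucker_index_sorted (ltn_ord k).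
  have /and3P[_ srt' _] := plucker_index_sorted (ltn_ord k').
  have enum_s (u : 'S_4) : perm_eq [seq u b | b <- enum 'I_4] (enum 'I_4).
    apply: uniq_perm; rewrite ?enum_uniq//.
      by rewrite map_inj_uniq ?enum_uniq//; exact: perm_inj.
    move=> b; rewrite mem_enum; apply/mapP; exists (u^-1 b)%g; rewrite ?mem_enum//.
    by rewrite permKV.
  have : perm_eq (nth [::] plucker_index k) (nth [::] plucker_index k').
    rewrite -!map_pidx.
    apply: (perm_trans (y := [seq val (pidx k (s b)) | b <- enum 'I_4])).
      rewrite perm_sym (map_comp (fun b => val (pidx k b)) s).
      exact/perm_map/enum_s.
    rewrite (eq_map (fun b => congr1 val (kk' b))).
    rewrite (map_comp (fun b => val (pidx k' b)) s').
    exact/perm_map/enum_s.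
  move=> /perm_mem/(irr_sorted_eq ltn_trans ltnn srt srt')/eqP.
  rewrite nth_uniq ?size_plucker_index//.
  by move=> /eqP; exact: val_inj.
by split=> //; apply/permP => b; apply: (@pidx_inj k); rewrite kk' kE.
Qed.

Section PluckerVector.
Variable K : comNzRingType.
Implicit Types (X : 'M[K]_(4, O)) (Y : 'M[K]_(O, 4)).

Definition pluck X : 'rV[K]_70 := \row_k \det (colsub (pidx k) X).

(** The linear form on Pluecker vectors that [Y] defines through the
    Cauchy-Binet formula [det_mulmx_pluck]. *)
Definition dual_pluck Y : 'cV[K]_70 := \col_k \det (rowsub (pidx k) Y).

Lemma det_mulmx_expand X Y : \det (X *m Y) =
  \sum_(f : {ffun 'I_4 -> 'I_O}) (\prod_b Y (f b) b) * \det (colsub f X).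
Proof.
rewrite -det_tr [LHS]/determinant.
under eq_bigr => s _.
  under eq_bigr => b _ do rewrite mxE mxE.
  rewrite bigA_distr_bigA /= mulr_sumr; over.
rewrite exchange_big; apply: eq_bigr => f _ /=.
rewrite -det_tr /determinant mulr_sumr; apply: eq_bigr => s _.
rewrite mulrCA; congr (_ * _); rewrite mulrC -big_split.
by apply: eq_bigr => b _; rewrite !mxE.
Qed.

Lemma det_colsub_pluck X (f : {ffun 'I_4 -> 'I_O}) : \det (colsub f X) =
  \sum_k \sum_(s : 'S_4 | f == [ffun b => pidx k (s b)])
     (-1) ^+ s * \det (colsub (pidx k) X).
Proof.
have [/injectiveP finj|/injectivePn[b [c bc fbc]]] := boolP (injectiveb f).
  have [k [s fE]] := pidx_surj finj.
  have {}fE : f = [ffun b => pidx k (s b)] by apply/ffunP => b; rewrite ffunE fE.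
  rewrite (bigD1 k)//= (bigD1 s)/= ?fE//.
  rewrite big1 => [|s' /andP[/eqP/ffunP fs' s's]]; last first.
    have [|_ ss'] := @pidx_uniq k k s s'; last by rewrite ss' eqxx in s's.
    by move=> b; have := fs' b; rewrite !ffunE.
  rewrite big1 => [|k' k'k]; last first.
    rewrite big1// => s' /eqP/ffunP fs'.
    have [|kk' _] := @pidx_uniq k k' s s'; last by rewrite kk' eqxx in k'k.
    by move=> b; have := fs' b; rewrite !ffunE.
  rewrite !addr0 (_ : colsub _ X = col_perm s (colsub (pidx k) X)).
    by rewrite col_permE det_mulmx det_perm odd_permV mulrC.
  by apply/matrixP => i j; rewrite !mxE ffunE.
rewrite big1 => [|k _]; last first.
  rewrite big1// => s /eqP/ffunP fE; case/negP: bc; apply/eqP.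
  by apply: (@perm_inj _ s); apply: (@pidx_inj k); have := fbc; rewrite !fE !ffunE.
rewrite -det_tr (determinant_alternate bc)// => j.
by rewrite !mxE fbc.
Qed.

(** The Cauchy-Binet formula. It makes every minor of [X *m V], for a fixed
    [V], a linear form in the Pluecker vector of [X]. *)
Lemma det_mulmx_pluck X Y : \det (X *m Y) = (pluck X *m dual_pluck Y) 0 0.
Proof.
rewrite det_mulmx_expand mxE.
under eq_bigr => f _ do rewrite det_colsub_pluck mulr_sumr.
rewrite exchange_big; apply: eq_bigr => k _ /=.
under eq_bigr => f _ do rewrite mulr_sumr.
rewrite (exchange_big_dep xpredT)//= !mxE [in RHS]mulrC -(det_tr (rowsub _ _)).
rewrite [\det (_^T)]/determinant mulr_suml.
apply: eq_bigr => s _; rewrite big_pred1_eq mulrCA mulrA; congr (_ * _ * _).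
by apply: eq_bigr => b _; rewrite ffunE !mxE.
Qed.

Lemma pluck_mull (A : 'M[K]_4) X : pluck (A *m X) = \det A *: pluck X.
Proof.
apply/rowP => k; rewrite !mxE -det_mulmx; congr (\det _).
by apply/matrixP => i j; rewrite !mxE; apply: eq_bigr => m _; rewrite !mxE.
Qed.

Lemma pluck_mulr X (V : 'M[K]_O) :
  pluck (X *m V) = pluck X *m \matrix_(i, k) dual_pluck (colsub (pidx k) V) i 0.
Proof.
apply/rowP => k; rewrite mxE.
have -> : colsub (pidx k) (X *m V) = X *m colsub (pidx k) V.
  by apply/matrixP => i j; rewrite !mxE; apply: eq_bigr => m _; rewrite !mxE.
rewrite det_mulmx_pluck [LHS]mxE [RHS]mxE; apply: eq_bigr => j _.
by rewrite [X in _ = _ * X]mxE.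
Qed.

End PluckerVector.

(** * The Cayley equations as polynomials *)

Section OctonionPolynomials.
Variable K : comNzRingType.
Local Notation "x # k" := (x k%N) (at level 2, k at level 0).
Implicit Types (x y r s t u v w : nat -> K) (z : K).

(** Octonions are represented here by their coordinate functions on the
    indices below 8, so that identities between them are polynomial identities
    over any commutative ring. *)
Definition oc_mul x y (k : nat) : K := nth 0 [::
     x#0 * y#0 - x#1 * y#1 - x#2 * y#2 - x#3 * y#3 - x#4 * y#4 - x#5 * y#5 - x#6 * y#6 - x#7 * y#7;
     x#0 * y#1 + x#1 * y#0 + x#2 * y#3 - x#3 * y#2 - x#4 * y#5 + x#5 * y#4 - x#6 * y#7 + x#7 * y#6;
     x#0 * y#2 - x#1 * y#3 + x#2 * y#0 + x#3 * y#1 - x#4 * y#6 + x#5 * y#7 + x#6 * y#4 - x#7 * y#5;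
     x#0 * y#3 + x#1 * y#2 - x#2 * y#1 + x#3 * y#0 - x#4 * y#7 - x#5 * y#6 + x#6 * y#5 + x#7 * y#4;
     x#0 * y#4 + x#1 * y#5 + x#2 * y#6 + x#3 * y#7 + x#4 * y#0 - x#5 * y#1 - x#6 * y#2 - x#7 * y#3;
     x#0 * y#5 - x#1 * y#4 - x#2 * y#7 + x#3 * y#6 + x#4 * y#1 + x#5 * y#0 - x#6 * y#3 + x#7 * y#2;
     x#0 * y#6 + x#1 * y#7 - x#2 * y#4 - x#3 * y#5 + x#4 * y#2 + x#5 * y#3 + x#6 * y#0 - x#7 * y#1;
     x#0 * y#7 - x#1 * y#6 + x#2 * y#5 - x#3 * y#4 + x#4 * y#3 - x#5 * y#2 + x#6 * y#1
       + x#7 * y#0] k.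

Definition oc_conj x (k : nat) : K := if k is 0%N then x#0 else - x k.

(** Twice the triple product, to avoid denominators. *)
Definition oc_cross3 u v w (k : nat) : K :=
  oc_mul (oc_mul u (oc_conj v)) w k - oc_mul (oc_mul w (oc_conj v)) u k.

(** Eight times the fourfold product: the factor 4 of its definition and the
    factor 2 of [oc_cross3]. *)
Definition oc_cross4 x u v w (k : nat) : K :=
  - (oc_mul (oc_cross3 x u v) (oc_conj w) k - oc_mul (oc_cross3 w x u) (oc_conj v) k
   + oc_mul (oc_cross3 v w x) (oc_conj u) k - oc_mul (oc_cross3 u v w) (oc_conj x) k).

Definition minor2 r s a b := r a * s b - r b * s a.
Definition minor3 r s t a b c :=
  r a * minor2 s t b c - r b * minor2 s t a c + r c * minor2 s t a b.
Definition minor4 r s t u (a b c d : nat) : K :=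
  r a * minor3 s t u b c d - r b * minor3 s t u a c d
  + r c * minor3 s t u a b d - r d * minor3 s t u a b c.

(** The triple product is alternating, hence linear in the 3x3 minors. Each
    minor in the formula is m_abc with e_k = e_a e_b e_c up to sign. *)
Definition cross3_form u v w (k : nat) : K :=
  let m := minor3 u v w in nth 0 [::
    m 1%N 2%N 3%N - m 1%N 4%N 5%N - m 1%N 6%N 7%N - m 2%N 4%N 6%N + m 2%N 5%N 7%N
      - m 3%N 4%N 7%N - m 3%N 5%N 6%N;
    - m 0%N 2%N 3%N + m 0%N 4%N 5%N + m 0%N 6%N 7%N - m 2%N 4%N 7%N - m 2%N 5%N 6%N
      + m 3%N 4%N 6%N - m 3%N 5%N 7%N;
    m 0%N 1%N 3%N + m 0%N 4%N 6%N - m 0%N 5%N 7%N + m 1%N 4%N 7%N + m 1%N 5%N 6%N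
      - m 3%N 4%N 5%N - m 3%N 6%N 7%N;
    - m 0%N 1%N 2%N + m 0%N 4%N 7%N + m 0%N 5%N 6%N - m 1%N 4%N 6%N + m 1%N 5%N 7%N
      + m 2%N 4%N 5%N + m 2%N 6%N 7%N;
    - m 0%N 1%N 5%N - m 0%N 2%N 6%N - m 0%N 3%N 7%N - m 1%N 2%N 7%N + m 1%N 3%N 6%N
      - m 2%N 3%N 5%N + m 5%N 6%N 7%N;
    m 0%N 1%N 4%N + m 0%N 2%N 7%N - m 0%N 3%N 6%N - m 1%N 2%N 6%N - m 1%N 3%N 7%N
      + m 2%N 3%N 4%N - m 4%N 6%N 7%N;
    - m 0%N 1%N 7%N + m 0%N 2%N 4%N + m 0%N 3%N 5%N + m 1%N 2%N 5%N - m 1%N 3%N 4%N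
      - m 2%N 3%N 7%N + m 4%N 5%N 7%N;
    m 0%N 1%N 6%N - m 0%N 2%N 5%N + m 0%N 3%N 4%N + m 1%N 2%N 4%N + m 1%N 3%N 5%N
      + m 2%N 3%N 6%N - m 4%N 5%N 6%N] k.

Lemma oc_cross3E u v w k : (k < 8)%N ->
  oc_cross3 u v w k = 2%:R * cross3_form u v w k.
Proof.
do 8?[case: k => [_|k]]; last by [].
all: cbv [oc_cross3 oc_mul oc_conj cross3_form minor3 minor2 nth]; ring.
Qed.

(** The Pluecker equations of the Cayley Grassmannian in the standard basis are
    the components 1 to 7. *)
Definition cross4_form x u v w (k : nat) : K :=
  let q := minor4 x u v w in nth 0 [::
    q 0%N 1%N 2%N 3%N - q 0%N 1%N 4%N 5%N - q 0%N 1%N 6%N 7%N - q 0%N 2%N 4%N 6%N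
      + q 0%N 2%N 5%N 7%N - q 0%N 3%N 4%N 7%N - q 0%N 3%N 5%N 6%N - q 1%N 2%N 4%N 7%N
      - q 1%N 2%N 5%N 6%N + q 1%N 3%N 4%N 6%N - q 1%N 3%N 5%N 7%N - q 2%N 3%N 4%N 5%N
      - q 2%N 3%N 6%N 7%N + q 4%N 5%N 6%N 7%N;
    - q 0%N 2%N 4%N 7%N - q 0%N 2%N 5%N 6%N + q 0%N 3%N 4%N 6%N - q 0%N 3%N 5%N 7%N
      + q 1%N 2%N 4%N 6%N - q 1%N 2%N 5%N 7%N + q 1%N 3%N 4%N 7%N + q 1%N 3%N 5%N 6%N;
    q 0%N 1%N 4%N 7%N + q 0%N 1%N 5%N 6%N - q 0%N 3%N 4%N 5%N - q 0%N 3%N 6%N 7%N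
      - q 1%N 2%N 4%N 5%N - q 1%N 2%N 6%N 7%N + q 2%N 3%N 4%N 7%N + q 2%N 3%N 5%N 6%N;
    - q 0%N 1%N 4%N 6%N + q 0%N 1%N 5%N 7%N + q 0%N 2%N 4%N 5%N + q 0%N 2%N 6%N 7%N
      - q 1%N 3%N 4%N 5%N - q 1%N 3%N 6%N 7%N - q 2%N 3%N 4%N 6%N + q 2%N 3%N 5%N 7%N;
    - q 0%N 1%N 2%N 7%N + q 0%N 1%N 3%N 6%N - q 0%N 2%N 3%N 5%N + q 0%N 5%N 6%N 7%N
      + q 1%N 2%N 3%N 4%N - q 1%N 4%N 6%N 7%N + q 2%N 4%N 5%N 7%N - q 3%N 4%N 5%N 6%N;
    - q 0%N 1%N 2%N 6%N - q 0%N 1%N 3%N 7%N + q 0%N 2%N 3%N 4%N - q 0%N 4%N 6%N 7%N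
      + q 1%N 2%N 3%N 5%N - q 1%N 5%N 6%N 7%N + q 2%N 4%N 5%N 6%N + q 3%N 4%N 5%N 7%N;
    q 0%N 1%N 2%N 5%N - q 0%N 1%N 3%N 4%N - q 0%N 2%N 3%N 7%N + q 0%N 4%N 5%N 7%N
      + q 1%N 2%N 3%N 6%N - q 1%N 4%N 5%N 6%N - q 2%N 5%N 6%N 7%N + q 3%N 4%N 6%N 7%N;
    q 0%N 1%N 2%N 4%N + q 0%N 1%N 3%N 5%N + q 0%N 2%N 3%N 6%N - q 0%N 4%N 5%N 6%N
      + q 1%N 2%N 3%N 7%N - q 1%N 4%N 5%N 7%N - q 2%N 4%N 6%N 7%N - q 3%N 5%N 6%N 7%N] k.

(** Expanding first the triple products into 3x3 minors keeps the polynomials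
    small. *)
Lemma oc_cross4E x u v w k : (0 < k < 8)%N ->
  oc_cross4 x u v w k = 8%:R * cross4_form x u v w k.
Proof.
case: k => [//|k]; do 7?[case: k => [_|k]]; last by [].
all: rewrite /oc_cross4 /oc_mul /oc_conj /= !oc_cross3E//.
all: cbv [cross3_form cross4_form minor4 minor3 minor2 nth]; ring.
Qed.

(** The equations in the basis of eigenvectors of the torus. *)
Definition cayley_form r s t u (m : nat) : K :=
  let q := minor4 r s t u in nth 0 [::
    q 0%N 2%N 5%N 7%N - q 1%N 3%N 4%N 6%N;
    q 0%N 1%N 4%N 6%N - q 0%N 2%N 4%N 5%N - q 0%N 2%N 6%N 7%N + q 2%N 3%N 4%N 6%N;
    - q 0%N 1%N 5%N 7%N + q 1%N 3%N 4%N 5%N + q 1%N 3%N 6%N 7%N - q 2%N 3%N 5%N 7%N;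
    q 0%N 1%N 2%N 7%N - q 1%N 2%N 3%N 4%N + q 1%N 4%N 6%N 7%N - q 2%N 4%N 5%N 7%N;
    - q 0%N 1%N 3%N 6%N + q 0%N 2%N 3%N 5%N - q 0%N 5%N 6%N 7%N + q 3%N 4%N 5%N 6%N;
    - q 0%N 1%N 2%N 5%N - q 1%N 2%N 3%N 6%N + q 1%N 4%N 5%N 6%N + q 2%N 5%N 6%N 7%N;
    q 0%N 1%N 3%N 4%N + q 0%N 2%N 3%N 7%N - q 0%N 4%N 5%N 7%N - q 3%N 4%N 6%N 7%N] m.

(** The five shears are unipotent substitutions [1 + z N], one for each of five
    nilpotent elements [N] of the Lie algebra of the symmetry group of the
    equations, with [N ^+ 2 = 0]. *)
Definition shear1 z r (k : nat) : K := nth 0 [::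
  r#0 - z * r#5; r#1; r#2; r#3; r#4 + z * r#1; r#5; r#6; r#7] k.

Lemma cayley_form_shear1 z r s t u (E := cayley_form r s t u) m :
  cayley_form (shear1 z r) (shear1 z s) (shear1 z t) (shear1 z u) m =
  nth 0 [:: E#0; E#1 - z * E#5; E#2; E#3; E#4; E#5; E#6 + z * E#2] m.
Proof.
rewrite /E; do 7?[case: m => [|m]]; last by case: m.
all: cbv [cayley_form minor4 minor3 minor2 shear1 nth]; ring.
Qed.

Definition shear2 z r (k : nat) : K := nth 0 [::
  r#0 - z * r#7; r#1; r#2; r#3; r#4; r#5; r#6 + z * r#1; r#7] k.

Lemma cayley_form_shear2 z r s t u (E := cayley_form r s t u) m :
  cayley_form (shear2 z r) (shear2 z s) (shear2 z t) (shear2 z u) m =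
  nth 0 [:: E#0; E#1 + z * E#3; E#2; E#3; E#4 - z * E#2; E#5; E#6] m.
Proof.
rewrite /E; do 7?[case: m => [|m]]; last by case: m.
all: cbv [cayley_form minor4 minor3 minor2 shear2 nth]; ring.
Qed.

Definition shear3 z r (k : nat) : K := nth 0 [::
  r#0; r#1 - z * r#5; r#2 + z * r#6; r#3; r#4 + z * r#0; r#5; r#6; r#7 - z * r#3] k.

Lemma cayley_form_shear3 z r s t u (E := cayley_form r s t u) m :
  cayley_form (shear3 z r) (shear3 z s) (shear3 z t) (shear3 z u) m =
  nth 0 [:: E#0 + z * E#4; E#1; E#2; E#3 + 2%:R * z * E#0 + z ^+ 2 * E#4; E#4; E#5; E#6] m.
Proof.
rewrite /E; do 7?[case: m => [|m]]; last by case: m.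
all: cbv [cayley_form minor4 minor3 minor2 shear3 nth]; ring.
Qed.

Definition shear4 z r (k : nat) : K := nth 0 [::
  r#0 - z * r#3; r#1; r#2 + z * r#1; r#3; r#4 - z * r#7; r#5; r#6 + z * r#5; r#7] k.

Lemma cayley_form_shear4 z r s t u (E := cayley_form r s t u) m :
  cayley_form (shear4 z r) (shear4 z s) (shear4 z t) (shear4 z u) m =
  nth 0 [:: E#0 - z * E#2; E#1 - 2%:R * z * E#0 + z ^+ 2 * E#2; E#2; E#3; E#4; E#5; E#6] m.
Proof.
rewrite /E; do 7?[case: m => [|m]]; last by case: m.
all: cbv [cayley_form minor4 minor3 minor2 shear4 nth]; ring.
Qed.

Definition shear5 z r (k : nat) : K := nth 0 [::
  r#0 - z * r#6; r#1; r#2; r#3 - z * r#5; r#4 + z * r#2; r#5; r#6; r#7 + z * r#1] k.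

Lemma cayley_form_shear5 z r s t u (E := cayley_form r s t u) m :
  cayley_form (shear5 z r) (shear5 z s) (shear5 z t) (shear5 z u) m =
  nth 0 [:: E#0 - z * E#5; E#1; E#2; E#3; E#4; E#5; E#6 - 2%:R * z * E#0 + z ^+ 2 * E#5] m.
Proof.
rewrite /E; do 7?[case: m => [|m]]; last by case: m.
all: cbv [cayley_form minor4 minor3 minor2 shear5 nth]; ring.
Qed.

(** This symmetry carries the six singular coordinate planes into each other. *)
Definition label_cycle (k : nat) : nat := nth k [:: 1; 0; 6; 7; 2; 3; 5; 4]%N k.

Lemma cayley_form_cycle r s t u (E := cayley_form r s t u) m :
  cayley_form (r \o label_cycle) (s \o label_cycle) (t \o label_cycle)
    (u \o label_cycle) m =
  nth 0 [:: - E#0; E#5; E#6; E#1; E#2; E#4; E#3] m.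
Proof.
rewrite /E; do 7?[case: m => [|m]]; last by case: m.
all: cbv [cayley_form minor4 minor3 minor2 label_cycle comp nth]; ring.
Qed.

Variable im : K.
Hypothesis im2 : im * im = -1.

(** The coordinates in the standard basis of the vector with coordinates [r] in
    the basis of eigenvectors; [im] is a square root of -1. *)
Definition etilde_comb r (k : nat) : K := nth 0 [::
  r#0 + r#1; im * (r#0 - r#1); r#2 + r#3; im * (r#2 - r#3);
  r#4 + r#5; im * (r#4 - r#5); r#6 + r#7; im * (r#6 - r#7)] k.

(** The equations of the standard basis and those of the eigenbasis are
    invertible combinations of each other, since 2 and [im] are invertible over
    the complex numbers. *)
Lemma cross4_form_etilde r s t u (E := cayley_form r s t u)
    (y := cross4_form (etilde_comb r) (etilde_comb s) (etilde_comb t) (etilde_comb u)) :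
  [/\ [/\ y#1 = 8%:R * im * E#0, y#2 = 4%:R * (E#1 + E#2),
          y#3 = 4%:R * im * (E#1 - E#2) & y#4 = 4%:R * (E#3 + E#4)],
      y#5 = 4%:R * im * (E#3 - E#4), y#6 = 4%:R * (E#5 + E#6)
    & y#7 = 4%:R * im * (E#5 - E#6)].
Proof.
cbv [E y cross4_form etilde_comb cayley_form minor4 minor3 minor2 nth].
split; [split|..].
all: ring: im2.
Qed.
End OctonionPolynomials.

(** * Octonions in coordinates *)

Lemma cross3_scaling (K : numFieldType) (a : K) : 2%:R * (2%:R^-1 * a) = a.
Proof. by rewrite mulVKf// pnatr_eq0. Qed.

Lemma cross4_scaling (K : numFieldType) (a b c d : K) :
  8%:R * - (4%:R^-1 * (a - b + c - d)) =
  - (2%:R * a - 2%:R * b + 2%:R * c - 2%:R * d).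
Proof. by field. Qed.

Section Octonions.
Variable R : realType.
Local Notation C := R[i].
Local Notation oct := 'rV[C]_O.
Implicit Types x y u v w : oct.

(** Coordinates indexed by natural numbers compute with the formulas of the
    preceding section. *)
Definition ocoord n (x : 'rV[C]_n.+1) (k : nat) : C := x 0 (inord k).

Lemma ocoord_inj n (x y : 'rV[C]_n.+1) :
  (forall k, (k < n.+1)%N -> ocoord x k = ocoord y k) -> x = y.
Proof.
by move=> xy; apply/rowP => j; have := xy j (ltn_ord j); rewrite /ocoord inord_val.
Qed.

Lemma ocoordD x y k : ocoord (x + y) k = ocoord x k + ocoord y k.
Proof. by rewrite /ocoord mxE. Qed.
Lemma ocoordB x y k : ocoord (x - y) k = ocoord x k - ocoord y k.
Proof. by rewrite /ocoord !mxE. Qed.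
Lemma ocoordN x k : ocoord (- x) k = - ocoord x k.
Proof. by rewrite /ocoord mxE. Qed.
Lemma ocoordZ a x k : ocoord (a *: x) k = a * ocoord x k.
Proof. by rewrite /ocoord mxE. Qed.

Lemma qcoord_mkquat (a b c d : C) m : (m < 4)%N ->
  qcoord (mkquat a b c d) m = [:: a; b; c; d]`_m.
Proof. by move=> m4; rewrite /qcoord mxE inordK. Qed.

Lemma qcoord_lsubmx x m : (m < 4)%N -> qcoord (lsubmx x) m = ocoord x m.
Proof.
move=> m4; rewrite /qcoord /ocoord mxE; congr (x 0 _); apply: val_inj.
by rewrite /= !inordK// (leq_trans m4).
Qed.

Lemma qcoord_rsubmx x m : (m < 4)%N -> qcoord (rsubmx x) m = ocoord x (4 + m).
Proof.
move=> m4; rewrite /qcoord /ocoord mxE; congr (x 0 _); apply: val_inj.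
by rewrite /= !inordK// ltn_add2l.
Qed.

Lemma ocoord_row_mxl (a b : 'rV[C]_4) m : (m < 4)%N ->
  ocoord (row_mx a b : oct) m = qcoord a m.
Proof.
move=> m4; rewrite /ocoord /qcoord -(row_mxEl a b); congr (row_mx a b 0 _).
by apply: val_inj; rewrite /= !inordK// (leq_trans m4).
Qed.

Lemma ocoord_row_mxr (a b : 'rV[C]_4) m : (m < 4)%N ->
  ocoord (row_mx a b : oct) (4 + m) = qcoord b m.
Proof.
move=> m4; rewrite /ocoord /qcoord -(row_mxEr a b); congr (row_mx a b 0 _).
by apply: val_inj; rewrite /= !inordK// ltn_add2l.
Qed.

Lemma qcoordD (a b : 'rV[C]_4) m : qcoord (a + b) m = qcoord a m + qcoord b m.
Proof. by rewrite /qcoord mxE. Qed.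
Lemma qcoordB (a b : 'rV[C]_4) m : qcoord (a - b) m = qcoord a m - qcoord b m.
Proof. by rewrite /qcoord !mxE. Qed.

Lemma ocoord_omul x y k : (k < 8)%N ->
  ocoord (omul x y) k = oc_mul (ocoord x) (ocoord y) k.
Proof.
have coords := (qcoordB, qcoordD, qcoord_mkquat, qcoord_lsubmx, qcoord_rsubmx).
case: k => [|[|[|[|[|[|[|[|//]]]]]]]] _; rewrite /omul.
1-4: rewrite ocoord_row_mxl//.
5: rewrite (@ocoord_row_mxr _ _ 0)//.
6: rewrite (@ocoord_row_mxr _ _ 1)//.
7: rewrite (@ocoord_row_mxr _ _ 2)//.
8: rewrite (@ocoord_row_mxr _ _ 3)//.
all: rewrite /qmul /qconj ?qcoordB ?qcoordD !qcoord_mkquat//= !qcoord_lsubmx//.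
all: rewrite !qcoord_rsubmx// /oc_mul /=; ring.
Qed.

Lemma ocoord_obasis m k : (m < 8)%N -> (k < 8)%N ->
  ocoord (obasis R m) k = (k == m)%:R.
Proof. by move=> m8 k8; rewrite /ocoord mxE /= -val_eqE /= !inordK. Qed.

Lemma ocoord_oRe x k : (k < 8)%N ->
  ocoord (oRe x) k = if k is 0%N then ocoord x 0 else 0.
Proof.
move=> k8; rewrite ocoordZ ocoord_obasis//.
have -> : x 0 0 = ocoord x 0 by congr (x 0 _); apply: val_inj; rewrite /= inordK.
by case: k k8 => [|k] _; rewrite ?mulr1 ?mulr0.
Qed.

Lemma ocoord_oIm x k : (k < 8)%N ->
  ocoord (oIm x) k = if k is 0%N then 0 else ocoord x k.
Proof.
move=> k8; rewrite ocoordB ocoord_oRe//; case: k k8 => [|k] _.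
  exact: subrr.
exact: subr0.
Qed.

Lemma ocoord_oconj x k : (k < 8)%N -> ocoord (oconj x) k = oc_conj (ocoord x) k.
Proof.
move=> k8; rewrite ocoordB ocoord_oRe// ocoord_oIm//; case: k k8 => [|k] _ /=.
  exact: subr0.
exact: sub0r.
Qed.

Lemma eq_oc_mul (K : comNzRingType) (x x' y y' : nat -> K) k :
  (forall j, (j < 8)%N -> x j = x' j) -> (forall j, (j < 8)%N -> y j = y' j) ->
  oc_mul x y k = oc_mul x' y' k.
Proof. by move=> xx yy; rewrite /oc_mul !xx// !yy. Qed.

Local Opaque omul oconj.

Lemma ocoord_cross3 u v w k : (k < 8)%N ->
  2%:R * ocoord (cross3 u v w) k = oc_cross3 (ocoord u) (ocoord v) (ocoord w) k.
Proof.
move=> k8; rewrite ocoordZ cross3_scaling ocoordB !ocoord_omul//.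
rewrite /oc_cross3; congr (_ - _); apply: eq_oc_mul => // j j8.
  by rewrite ocoord_omul//; apply: eq_oc_mul => // i i8; rewrite ocoord_oconj.
by rewrite ocoord_omul//; apply: eq_oc_mul => // i i8; rewrite ocoord_oconj.
Qed.

Lemma oc_mulZl (K : comNzRingType) (a : K) (x y : nat -> K) k :
  oc_mul (fun j => a * x j) y k = a * oc_mul x y k.
Proof.
case: k => [|[|[|[|[|[|[|[|k]]]]]]]]; rewrite /oc_mul /= ?nth_nil ?mulr0//; ring.
Qed.

Local Opaque cross3 omul oconj.

Lemma ocoord_cross4 x u v w k : (k < 8)%N ->
  8%:R * ocoord (cross4 x u v w) k =
  oc_cross4 (ocoord x) (ocoord u) (ocoord v) (ocoord w) k.
Proof.
have cross3_mul a b c d : (k < 8)%N ->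
    2%:R * ocoord (omul (cross3 a b c) (oconj d)) k =
    oc_mul (oc_cross3 (ocoord a) (ocoord b) (ocoord c)) (oc_conj (ocoord d)) k.
  move=> k8; rewrite ocoord_omul// -oc_mulZl; apply: eq_oc_mul => j j8.
    exact: ocoord_cross3.
  exact: ocoord_oconj.
move=> k8; rewrite ocoordN ocoordZ !(ocoordB, ocoordD) /oc_cross4 -!cross3_mul//.
exact: cross4_scaling.
Qed.

Lemma oIm_eq0P x : oIm x = 0 <-> forall k, (0 < k < 8)%N -> ocoord x k = 0.
Proof.
split=> [x0 k /andP[k0 k8]|x0].
  have := ocoord_oIm x k8; rewrite x0; case: k k0 k8 => // k _ _ <-.
  by rewrite /ocoord mxE.
apply: ocoord_inj => k k8; rewrite ocoord_oIm// [RHS]mxE.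
by case: k k8 => // k k8; rewrite x0.
Qed.

End Octonions.

(** * The Cayley equations on matrices *)

Section MatrixRows.
Variable K : comNzRingType.

(** The rows as functions on natural numbers, the form in which the polynomial
    identities take their arguments. *)
Definition mrow m (A : 'M[K]_(m.+1, O)) (i k : nat) : K := A (inord i) (inord k).

Lemma sum_ord8 (F : 'I_O -> K) : \sum_j F j =
  F (inord 0) + F (inord 1) + F (inord 2) + F (inord 3) +
  F (inord 4) + F (inord 5) + F (inord 6) + F (inord 7).
Proof.
transitivity (\sum_(0 <= j < 8) F (inord j)).
  by rewrite big_mkord; apply: eq_bigr => j _; rewrite inord_val.
by rewrite unlock /= addr0 !addrA.
Qed.

Lemma mrow_inj m (A B : 'M[K]_(m.+1, O)) :
  (forall i k, (i < m.+1)%N -> (k < 8)%N -> mrow A i k = mrow B i k) -> A = B.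
Proof.
move=> AB; apply/matrixP => i j; have := AB i j (ltn_ord i) (ltn_ord j).
by rewrite /mrow !inord_val.
Qed.

Lemma det4E (f : nat -> nat -> K) :
  \det (\matrix_(i < 4, j < 4) f i j) =
  minor4 (f 0%N) (f 1%N) (f 2%N) (f 3%N) 0%N 1%N 2%N 3%N.
Proof.
rewrite (expand_det_row _ ord0) !big_ord_recl big_ord0 /cofactor.
rewrite !(expand_det_row _ ord0) !big_ord_recl !big_ord0 /cofactor.
rewrite !(expand_det_row _ ord0) !big_ord_recl !big_ord0 /cofactor.
rewrite !det_mx11 !mxE /= /bump /= /minor4 /minor3 /minor2.
rewrite ?expr0 ?expr1 ?expr2 ?exprS ?expr0; ring.
Qed.

Definition cols4 (a b c d : nat) (i : 'I_4) : 'I_O :=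
  inord (nth 0%N [:: a; b; c; d] i).

Lemma minor4_det (A : 'M[K]_(4, O)) a b c d :
  minor4 (mrow A 0) (mrow A 1) (mrow A 2) (mrow A 3) a b c d =
  \det (colsub (cols4 a b c d) A).
Proof.
have -> : colsub (cols4 a b c d) A =
  \matrix_(i < 4, j < 4) mrow A i (nth 0%N [:: a; b; c; d] j); last first.
  by rewrite (det4E (fun i j => mrow A i (nth 0%N [:: a; b; c; d] j))).
by apply/matrixP => i j; rewrite !mxE /mrow inord_val.
Qed.

Lemma eq_minor4 (r r' s s' t t' u u' : nat -> K) a b c d :
  (forall k, (k < 8)%N -> r k = r' k) -> (forall k, (k < 8)%N -> s k = s' k) ->
  (forall k, (k < 8)%N -> t k = t' k) -> (forall k, (k < 8)%N -> u k = u' k) ->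
  (a < 8)%N -> (b < 8)%N -> (c < 8)%N -> (d < 8)%N ->
  minor4 r s t u a b c d = minor4 r' s' t' u' a b c d.
Proof.
move=> rr ss tt uu a8 b8 c8 d8; rewrite /minor4 /minor3 /minor2.
by rewrite !rr// !ss// !tt// !uu.
Qed.

Lemma eq_cayley_form (r r' s s' t t' u u' : nat -> K) m :
  (forall k, (k < 8)%N -> r k = r' k) -> (forall k, (k < 8)%N -> s k = s' k) ->
  (forall k, (k < 8)%N -> t k = t' k) -> (forall k, (k < 8)%N -> u k = u' k) ->
  cayley_form r s t u m = cayley_form r' s' t' u' m.
Proof.
move=> rr ss tt uu; rewrite /cayley_form; do 7?[case: m => [|m]]; last by case: m.
all: by rewrite /= !(eq_minor4 rr ss tt uu).
Qed.

Lemma eq_cross4_form (r r' s s' t t' u u' : nat -> K) m :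
  (forall k, (k < 8)%N -> r k = r' k) -> (forall k, (k < 8)%N -> s k = s' k) ->
  (forall k, (k < 8)%N -> t k = t' k) -> (forall k, (k < 8)%N -> u k = u' k) ->
  cross4_form r s t u m = cross4_form r' s' t' u' m.
Proof.
move=> rr ss tt uu; rewrite /cross4_form; do 8?[case: m => [|m]]; last by case: m.
all: by rewrite /= !(eq_minor4 rr ss tt uu).
Qed.

Definition cform (A : 'M[K]_(4, O)) (m : nat) : K :=
  cayley_form (mrow A 0) (mrow A 1) (mrow A 2) (mrow A 3) m.

Definition cayley_eqs A := forall m, (m < 7)%N -> cform A m = 0.

(** The equations depend on the plane alone, not on its basis. *)
Lemma cform_mull (B : 'M[K]_4) A m : cform (B *m A) m = \det B * cform A m.
Proof.
have minorM a b c d : \det (colsub (cols4 a b c d) (B *m A)) =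
    \det B * \det (colsub (cols4 a b c d) A).
  rewrite -det_mulmx; congr (\det _); apply/matrixP => i j; rewrite !mxE.
  by apply: eq_bigr => l _; rewrite !mxE.
rewrite /cform /cayley_form; do 7?[case: m => [|m]]; last by case: m => [|m]; rewrite /= mulr0.
all: by rewrite /= !minor4_det !minorM; ring.
Qed.

(** Each minor of [X *m V] is a linear form in the minors of [X], by the
    Cauchy-Binet formula. *)
Lemma cform_linear (V : 'M[K]_O) m : exists c : 'cV[K]_70,
  forall X : 'M[K]_(4, O), cform (X *m V) m = (pluck X *m c) 0 0.
Proof.
pose e a b c d := dual_pluck (colsub (cols4 a b c d) V).
have eE a b c d X : \det (colsub (cols4 a b c d) (X *m V)) =
    (pluck X *m e a b c d) 0 0.
  rewrite -det_mulmx_pluck; congr (\det _); apply/matrixP => i j; rewrite !mxE.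
  by apply: eq_bigr => l _; rewrite !mxE.
exists (nth 0 [:: e 0%N 2%N 5%N 7%N - e 1%N 3%N 4%N 6%N; e 0%N 1%N 4%N 6%N - e 0%N 2%N 4%N 5%N
  - e 0%N 2%N 6%N 7%N + e 2%N 3%N 4%N 6%N;
    - e 0%N 1%N 5%N 7%N + e 1%N 3%N 4%N 5%N + e 1%N 3%N 6%N 7%N - e 2%N 3%N 5%N 7%N;
    e 0%N 1%N 2%N 7%N - e 1%N 2%N 3%N 4%N + e 1%N 4%N 6%N 7%N - e 2%N 4%N 5%N 7%N;
    - e 0%N 1%N 3%N 6%N + e 0%N 2%N 3%N 5%N - e 0%N 5%N 6%N 7%N + e 3%N 4%N 5%N 6%N;
    - e 0%N 1%N 2%N 5%N - e 1%N 2%N 3%N 6%N + e 1%N 4%N 5%N 6%N + e 2%N 5%N 6%N 7%N;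
    e 0%N 1%N 3%N 4%N + e 0%N 2%N 3%N 7%N - e 0%N 4%N 5%N 7%N - e 3%N 4%N 6%N 7%N] m) => X.
have addE (c c' : 'cV[K]_70) : (pluck X *m (c + c')) 0 0 =
  (pluck X *m c) 0 0 + (pluck X *m c') 0 0 by rewrite mulmxDr mxE.
have oppE (c : 'cV[K]_70) : (pluck X *m - c) 0 0 = - (pluck X *m c) 0 0.
  by rewrite mulmxN mxE.
rewrite /cform /cayley_form; do 7?[case: m => [|m]].
1-7: by rewrite /= !(addE, oppE) -!eE -!minor4_det.
by case: m => [|m]; rewrite /= mulmx0 mxE.
Qed.

End MatrixRows.

(** * Symmetries of the Cayley equations *)

Section Operators.
Variable K : comNzRingType.
Implicit Types (f g : (nat -> K) -> nat -> K) (r s : nat -> K).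

Definition linear_op f := forall r s (a b : K) k, (k < 8)%N ->
  f (fun j => a * r j + b * s j) k = a * f r k + b * f s k.

(** Together with [linear_op], this makes [f] a linear map of the first eight
    coordinates, with matrix [opmx f]. *)
Definition extensional_op f := forall r s,
  (forall j, (j < 8)%N -> r j = s j) -> forall k, (k < 8)%N -> f r k = f s k.

Definition unit_row (j : nat) : nat -> K := fun k => (k == j)%:R.

Definition opmx f : 'M[K]_O := \matrix_(j, k) f (unit_row j) k.

Lemma mrow_opmx f m (A : 'M[K]_(m.+1, O)) i k :
  linear_op f -> extensional_op f -> (k < 8)%N ->
  mrow (A *m opmx f) i k = f (mrow A i) k.
Proof.
move=> flin fext k8.
have f0 : f (fun=> 0) k = 0.
  have := flin (fun=> 0) (fun=> 0) 0 0 k k8; rewrite !mul0r addr0 => f00.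
  by rewrite -[RHS]f00; apply: fext => // j _; rewrite mul0r addr0.
have fS n (c : nat -> K) (F : nat -> nat -> K) :
    f (fun j => \sum_(l < n) c l * F l j) k = \sum_(l < n) c l * f (F l) k.
  elim: n => [|n IH].
    by rewrite big_ord0 -f0; apply: fext => // j _; rewrite big_ord0.
  rewrite big_ord_recr /= -IH -[X in X + _]mul1r -flin//.
  by apply: fext => // j _; rewrite big_ord_recr mul1r.
rewrite /mrow mxE.
transitivity (\sum_(l < 8) mrow A i l * f (unit_row l) k).
  by apply: eq_bigr => l _; rewrite mxE /mrow inord_val inordK.
rewrite -(fS 8 (mrow A i) unit_row); apply: fext => // j j8.
rewrite (bigD1 (Ordinal j8))//= /unit_row eqxx mulr1 big1 ?addr0// => l lj.
by rewrite eq_sym; move: lj; rewrite -val_eqE /= => /negbTE ->; rewrite mulr0.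
Qed.

Lemma opmx_cancel f g : linear_op f -> extensional_op f -> linear_op g ->
  extensional_op g -> (forall r k, (k < 8)%N -> g (f r) k = r k) ->
  opmx f *m opmx g = 1%:M.
Proof.
move=> fl fe gl ge gf; apply: mrow_inj => i k i8 k8.
rewrite -[opmx f]mul1mx mrow_opmx//.
rewrite (@ge _ (f (mrow (1%:M : 'M_8) i)))// => [|j j8]; first exact: gf.
exact: mrow_opmx.
Qed.

Lemma shear1_lin z : linear_op (shear1 z).
Proof. by move=> r s a b k k8; do 8?[case: k k8 => [|k] k8 //]; rewrite /shear1 /=; ring. Qed.
Lemma shear2_lin z : linear_op (shear2 z).
Proof. by move=> r s a b k k8; do 8?[case: k k8 => [|k] k8 //]; rewrite /shear2 /=; ring. Qed.
Lemma shear3_lin z : linear_op (shear3 z).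
Proof. by move=> r s a b k k8; do 8?[case: k k8 => [|k] k8 //]; rewrite /shear3 /=; ring. Qed.
Lemma shear4_lin z : linear_op (shear4 z).
Proof. by move=> r s a b k k8; do 8?[case: k k8 => [|k] k8 //]; rewrite /shear4 /=; ring. Qed.
Lemma shear5_lin z : linear_op (shear5 z).
Proof. by move=> r s a b k k8; do 8?[case: k k8 => [|k] k8 //]; rewrite /shear5 /=; ring. Qed.

Lemma shear1_ext z : extensional_op (shear1 z).
Proof. by move=> r s rs k k8; rewrite /shear1 !rs. Qed.
Lemma shear2_ext z : extensional_op (shear2 z).
Proof. by move=> r s rs k k8; rewrite /shear2 !rs. Qed.
Lemma shear3_ext z : extensional_op (shear3 z).
Proof. by move=> r s rs k k8; rewrite /shear3 !rs. Qed.
Lemma shear4_ext z : extensional_op (shear4 z).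
Proof. by move=> r s rs k k8; rewrite /shear4 !rs. Qed.
Lemma shear5_ext z : extensional_op (shear5 z).
Proof. by move=> r s rs k k8; rewrite /shear5 !rs. Qed.

Lemma shear1K z r k : (k < 8)%N -> shear1 (- z) (shear1 z r) k = r k.
Proof. by move=> k8; do 8?[case: k k8 => [|k] k8 //]; rewrite /shear1 /=; ring. Qed.
Lemma shear2K z r k : (k < 8)%N -> shear2 (- z) (shear2 z r) k = r k.
Proof. by move=> k8; do 8?[case: k k8 => [|k] k8 //]; rewrite /shear2 /=; ring. Qed.
Lemma shear3K z r k : (k < 8)%N -> shear3 (- z) (shear3 z r) k = r k.
Proof. by move=> k8; do 8?[case: k k8 => [|k] k8 //]; rewrite /shear3 /=; ring. Qed.
Lemma shear4K z r k : (k < 8)%N -> shear4 (- z) (shear4 z r) k = r k.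
Proof. by move=> k8; do 8?[case: k k8 => [|k] k8 //]; rewrite /shear4 /=; ring. Qed.
Lemma shear5K z r k : (k < 8)%N -> shear5 (- z) (shear5 z r) k = r k.
Proof. by move=> k8; do 8?[case: k k8 => [|k] k8 //]; rewrite /shear5 /=; ring. Qed.

Definition preserves_eqs f := forall r s t u,
  (forall m, (m < 7)%N -> cayley_form r s t u m = 0) ->
  forall m, (m < 7)%N -> cayley_form (f r) (f s) (f t) (f u) m = 0.

Lemma shear1_eqs z : preserves_eqs (shear1 z).
Proof.
move=> r s t u E m m7; rewrite cayley_form_shear1.
by do 7?[case: m m7 => [|m] m7 //]; rewrite /= !E//; ring.
Qed.
Lemma shear2_eqs z : preserves_eqs (shear2 z).
Proof.
move=> r s t u E m m7; rewrite cayley_form_shear2.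
by do 7?[case: m m7 => [|m] m7 //]; rewrite /= !E//; ring.
Qed.
Lemma shear3_eqs z : preserves_eqs (shear3 z).
Proof.
move=> r s t u E m m7; rewrite cayley_form_shear3.
by do 7?[case: m m7 => [|m] m7 //]; rewrite /= !E//; ring.
Qed.
Lemma shear4_eqs z : preserves_eqs (shear4 z).
Proof.
move=> r s t u E m m7; rewrite cayley_form_shear4.
by do 7?[case: m m7 => [|m] m7 //]; rewrite /= !E//; ring.
Qed.
Lemma shear5_eqs z : preserves_eqs (shear5 z).
Proof.
move=> r s t u E m m7; rewrite cayley_form_shear5.
by do 7?[case: m m7 => [|m] m7 //]; rewrite /= !E//; ring.
Qed.

Definition cycle_op (r : nat -> K) := r \o label_cycle.

Lemma cycle_eqs : preserves_eqs cycle_op.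
Proof.
move=> r s t u E m m7; rewrite cayley_form_cycle.
by do 7?[case: m m7 => [|m] m7 //]; rewrite /= !E//; ring.
Qed.

Lemma cycle_lin : linear_op cycle_op. Proof. by []. Qed.
Lemma cycle_ext : extensional_op cycle_op.
Proof.
by move=> r s rs k k8; do 8?[case: k k8 => [|k] k8 //]; rewrite /cycle_op /= rs.
Qed.

(** The inverse of [cycle_op], because [label_cycle] has order six. *)
Definition cycle5_op r := r \o iter 5 label_cycle.
Lemma cycle5_lin : linear_op cycle5_op. Proof. by []. Qed.
Lemma cycle5_ext : extensional_op cycle5_op.
Proof.
by move=> r s rs k k8; do 8?[case: k k8 => [|k] k8 //]; rewrite /cycle5_op /= rs.
Qed.
Lemma cycle5_eqs : preserves_eqs cycle5_op.
Proof.
move=> r s t u E.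
exact: (cycle_eqs (cycle_eqs (cycle_eqs (cycle_eqs (cycle_eqs E))))).
Qed.

End Operators.

(** * Frames *)

Lemma preserves_cayley_eqs (K : comNzRingType) (f : (nat -> K) -> nat -> K)
    (A : 'M[K]_(4, O)) : linear_op f -> extensional_op f -> preserves_eqs f ->
  cayley_eqs A -> cayley_eqs (A *m opmx f).
Proof.
move=> fl fe fE EA m m7; rewrite /cform -(fE _ _ _ _ EA m m7).
by apply: eq_cayley_form => k k8; rewrite mrow_opmx.
Qed.

Section CayleyFrames.
Variable R : realType.
Local Notation C := R[i].
Implicit Types (A X : 'M[C]_(4, O)) (W : 'M[C]_O).

Definition cayley_mx X : Prop :=
  oIm (cross4 (row (inord 0) X) (row (inord 1) X)
              (row (inord 2) X) (row (inord 3) X)) = 0.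

Definition etilde_mx : 'M[C]_O := \matrix_(k < O) etilde R k.

Lemma sqrCi : 'i%C * 'i%C = -1 :> C.
Proof. by rewrite -expr2 sqr_i. Qed.

Lemma etilde_comb_lin : linear_op (etilde_comb ('i%C : C)).
Proof.
by move=> r s a b k k8; do 8?[case: k k8 => [|k] k8 //]; rewrite /etilde_comb /=; ring.
Qed.

Lemma etilde_comb_ext : extensional_op (etilde_comb ('i%C : C)).
Proof. by move=> r s rs k k8; rewrite /etilde_comb !rs. Qed.

Lemma etilde_mxE : etilde_mx = opmx (etilde_comb 'i%C).
Proof.
apply: mrow_inj => i k i8 k8; rewrite /mrow mxE [RHS]mxE inordK// inordK//.
rewrite -/(ocoord (etilde R i) k) ocoordD ocoordZ.
do 8?[case: i i8 => [|i] i8 //]; rewrite !ocoord_obasis//=.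
all: do 8?[case: k k8 => [|k] k8 //]; rewrite /etilde_comb /unit_row /=; ring.
Qed.

Definition etilde_uncomb (r : nat -> C) (k : nat) : C := nth 0 [::
  2^-1 * (r 0%N - 'i%C * r 1%N); 2^-1 * (r 0%N + 'i%C * r 1%N);
  2^-1 * (r 2%N - 'i%C * r 3%N); 2^-1 * (r 2%N + 'i%C * r 3%N);
  2^-1 * (r 4%N - 'i%C * r 5%N); 2^-1 * (r 4%N + 'i%C * r 5%N);
  2^-1 * (r 6%N - 'i%C * r 7%N); 2^-1 * (r 6%N + 'i%C * r 7%N)] k.

Lemma etilde_mx_unit : etilde_mx \in unitmx.
Proof.
suff /mulmx1_unit[//] : etilde_mx *m opmx etilde_uncomb = 1%:M.
rewrite etilde_mxE; apply: opmx_cancel.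
- exact: etilde_comb_lin.
- exact: etilde_comb_ext.
- by move=> r s a b k k8; do 8?[case: k k8 => [|k] k8 //]; rewrite /etilde_uncomb /=; ring.
- by move=> r s rs k k8; rewrite /etilde_uncomb !rs.
have half (a b : C) : 2^-1 * (a + b - 'i%C * ('i%C * (a - b))) = a.
  by rewrite mulrA sqrCi; field.
have half' (a b : C) : 2^-1 * (a + b + 'i%C * ('i%C * (a - b))) = b.
  by rewrite mulrA sqrCi; field.
move=> r k k8; do 8?[case: k k8 => [|k] k8 //].
all: by rewrite /etilde_uncomb /etilde_comb /= ?half ?half'.
Qed.

Lemma cayley_mxP X : cayley_mx X <-> forall k, (0 < k < 8)%N ->
  cross4_form (mrow X 0) (mrow X 1) (mrow X 2) (mrow X 3) k = 0.
Proof.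
have rowE i k : ocoord (row (inord i) X) k = mrow X i k.
  by rewrite /ocoord mxE.
have crossE k : (0 < k < 8)%N ->
    ocoord (cross4 (row (inord 0) X) (row (inord 1) X)
      (row (inord 2) X) (row (inord 3) X)) k =
    cross4_form (mrow X 0) (mrow X 1) (mrow X 2) (mrow X 3) k.
  move=> k18; have /andP[_ k8] := k18.
  have n8 : 8%:R != 0 :> C by rewrite pnatr_eq0.
  apply: (mulfI n8); rewrite ocoord_cross4// oc_cross4E//; congr (_ * _).
  by apply: eq_cross4_form => j _; exact: rowE.
split=> [/oIm_eq0P X0 k k18|X0]; first by rewrite -crossE// X0.
by apply/oIm_eq0P => k k18; rewrite crossE// X0.
Qed.

(** The rows of a frame form a basis of the octonions in which Cayley
    planes have the same equations as in the eigenbasis of the torus. *)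
Definition cayley_frame W : Prop :=
  W \in unitmx /\ forall A, cayley_mx (A *m W) <-> cayley_eqs A.

Lemma cayley_frame_etilde : cayley_frame etilde_mx.
Proof.
split=> [|A]; first exact: etilde_mx_unit.
have im0 : 'i%C != 0 :> C by exact: neq0Ci.
have n0 n : n.+1%:R != 0 :> C by rewrite pnatr_eq0.
pose E := cform A.
pose Y := cross4_form (mrow (A *m etilde_mx) 0) (mrow (A *m etilde_mx) 1)
  (mrow (A *m etilde_mx) 2) (mrow (A *m etilde_mx) 3).
have YE k : Y k = cross4_form (etilde_comb 'i%C (mrow A 0)) (etilde_comb 'i%C (mrow A 1))
    (etilde_comb 'i%C (mrow A 2)) (etilde_comb 'i%C (mrow A 3)) k.
  apply: eq_cross4_form => j j8; rewrite etilde_mxE mrow_opmx//;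
    [exact: etilde_comb_lin|exact: etilde_comb_ext|exact: etilde_comb_lin|exact: etilde_comb_ext|
     exact: etilde_comb_lin|exact: etilde_comb_ext|exact: etilde_comb_lin|exact: etilde_comb_ext].
have [[Y1 Y2 Y3 Y4] Y5 Y6 Y7] :=
  cross4_form_etilde sqrCi (mrow A 0) (mrow A 1) (mrow A 2) (mrow A 3).
rewrite -!YE -!/(cform A _) in Y1 Y2 Y3 Y4 Y5 Y6 Y7.
have solve (a b : C) : a + b = 0 -> a - b = 0 -> a = 0 /\ b = 0.
  move=> ab0 /eqP; rewrite subr_eq0 => /eqP ab; rewrite ab in ab0 *.
  have /eqP := ab0; rewrite -mulr2n -mulr_natl mulf_eq0 (negbTE (n0 1)) /=.
  by move=> /eqP ->.
split=> [/cayley_mxP Y0|E0].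
  have Y0' k (c e : C) : (0 < k < 8)%N -> Y k = c * e -> c != 0 -> e = 0.
    move=> k18 Yk c0; have /eqP := Y0 k k18.
    by rewrite -/(Y k) Yk mulf_eq0 (negbTE c0) => /eqP.
  have c8 n : n.+1%:R * 'i%C != 0 :> C by rewrite mulf_neq0.
  have E0 := Y0' 1%N _ _ isT Y1 (c8 7).
  have [E1 E2] := solve _ _ (Y0' 2%N _ _ isT Y2 (n0 3)) (Y0' 3%N _ _ isT Y3 (c8 3)).
  have [E3 E4] := solve _ _ (Y0' 4%N _ _ isT Y4 (n0 3)) (Y0' 5%N _ _ isT Y5 (c8 3)).
  have [E5 E6] := solve _ _ (Y0' 6%N _ _ isT Y6 (n0 3)) (Y0' 7%N _ _ isT Y7 (c8 3)).
  by move=> m m7; do 7?[case: m m7 => [|m] m7 //].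
apply/cayley_mxP => k k18; rewrite -/(Y k).
do 8?[case: k k18 => [|k] k18 //]; rewrite ?Y1 ?Y2 ?Y3 ?Y4 ?Y5 ?Y6 ?Y7.
all: by rewrite !E0// ?subrr ?addr0 mulr0.
Qed.

(** Both [f] and its inverse [g] must preserve the equations, because a frame
    characterizes Cayley planes by an equivalence. *)
Lemma cayley_frame_op f g W : linear_op f -> extensional_op f -> preserves_eqs f ->
  linear_op g -> extensional_op g -> preserves_eqs g ->
  (forall r k, (k < 8)%N -> g (f r) k = r k) ->
  cayley_frame W -> cayley_frame (opmx f *m W).
Proof.
move=> fl fe fE gl ge gE gf [Wu WE].
have FG := opmx_cancel fl fe gl ge gf.
have [Fu _] := mulmx1_unit FG.
split=> [|A]; first by rewrite unitmx_mul Fu.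
rewrite mulmxA WE; split=> [EA|EA]; last exact: preserves_cayley_eqs.
by rewrite -[A]mulmx1 -FG mulmxA; exact: preserves_cayley_eqs.
Qed.

End CayleyFrames.

(** * Planes as matrices *)

(** Rescaling a Pluecker vector amounts to changing the basis of the plane. *)
Lemma exists_mx_det (K : comNzRingType) (n : nat) (c : K) :
  exists B : 'M[K]_n.+1, \det B = c.
Proof.
exists (diag_mx (\row_a (if a == ord0 then c else 1))); rewrite det_diag.
rewrite big_ord_recl mxE eqxx big1 ?mulr1// => a _.
by rewrite mxE.
Qed.

Section Membership.
Variable R : realType.
Local Notation C := R[i].
Local Notation oct := 'rV[C]_O.
Implicit Types (A X : 'M[C]_(4, O)) (W : 'M[C]_O) (P : {vspace oct}).

Definition mx4 (x u v w : oct) : 'M[C]_(4, O) :=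
  \matrix_(a < 4) nth 0 [:: x; u; v; w] a.

Definition rows4 X : seq oct :=
  [:: row (inord 0) X; row (inord 1) X; row (inord 2) X; row (inord 3) X].

Lemma rows4E X : rows4 X = [tuple row a X | a < 4].
Proof.
apply: (@eq_from_nth _ 0) => [|a]; first by rewrite [RHS]size_tuple.
rewrite /= => a4.
have := tnth_nth 0 [tuple row a X | a < 4] (Ordinal a4).
rewrite tnth_mktuple => <-.
have -> : Ordinal a4 = inord a by apply: val_inj; rewrite /= inordK.
by do 4?[case: a a4 => [|a] a4 //].
Qed.

Lemma row_mx4 x u v w (a : nat) : (a < 4)%N ->
  row (inord a) (mx4 x u v w) = nth 0 [:: x; u; v; w] a.
Proof. by move=> a4; rewrite rowK inordK. Qed.

Lemma rows4_mx4 x u v w : rows4 (mx4 x u v w) = [:: x; u; v; w].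
Proof. by rewrite /rows4 !row_mx4. Qed.

Lemma wedge4E x u v w : wedge4 x u v w = pluck (mx4 x u v w).
Proof.
apply/rowP => k; rewrite !mxE; congr (\det _); apply/matrixP => a b.
by rewrite !mxE.
Qed.

Lemma mx4_rows X : mx4 (row (inord 0) X) (row (inord 1) X)
  (row (inord 2) X) (row (inord 3) X) = X.
Proof.
apply: mrow_inj => a k a4 k8; rewrite /mrow mxE inordK//.
by do 4?[case: a a4 => [|a] a4 //]; rewrite /= mxE.
Qed.

Lemma free_rows4 X : free (rows4 X) = row_free X.
Proof.
rewrite rows4E; apply/freeP/idP => [Xfree|Xfree c cX].
  apply: inj_row_free => v vX; apply/rowP => a; rewrite [RHS]mxE.
  apply: (Xfree (v 0)); rewrite -[RHS]vX mulmx_sum_row; apply: eq_bigr => b _.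
  by rewrite -tnth_nth tnth_mktuple.
suff /rowP c0 : \row_a c a = 0 by move=> a; have := c0 a; rewrite !mxE.
apply: (row_free_inj Xfree); rewrite mul0mx mulmx_sum_row -[RHS]cX.
by apply: eq_bigr => b _; rewrite -tnth_nth tnth_mktuple mxE.
Qed.

Lemma dim_rows4 X : (\dim <<rows4 X>> == 4)%N = row_free X.
Proof. by rewrite -free_rows4 /free eq_sym. Qed.

Lemma mem_rows4 X (a : 'I_4) : row a X \in <<rows4 X>>%VS.
Proof.
apply: memv_span; rewrite rows4E; apply/mapP; exists a => //.
by rewrite mem_enum.
Qed.

Lemma span_rows4P X x : reflect (exists c : 'rV[C]_4, x = c *m X) (x \in <<rows4 X>>%VS).
Proof.
apply: (iffP idP) => [|[c ->]]; last first.
  by rewrite mulmx_sum_row; apply: memv_suml => a _; apply/memvZ/mem_rows4.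
rewrite rows4E => /coord_span ->.
exists (\row_a coord [tuple row a X | a < 4] a x).
by rewrite mulmx_sum_row; apply: eq_bigr => a _; rewrite mxE -tnth_nth tnth_mktuple.
Qed.

Lemma span_rows4_sub X X' : (<<rows4 X'>> <= <<rows4 X>>)%VS ->
  exists B : 'M_4, X' = B *m X.
Proof.
move=> /subvP XX'.
have rowE (a : 'I_4) : exists c : 'rV[C]_4, row a X' = c *m X.
  exact/span_rows4P/XX'/mem_rows4.
have [c cE] := choice rowE.
exists (\matrix_a c a); apply/row_matrixP => a; rewrite cE row_mul rowK //.
Qed.

Lemma span_rows4_mull (B : 'M_4) X : B \in unitmx ->
  <<rows4 (B *m X)>>%VS = <<rows4 X>>%VS.
Proof.
have sub B' X' : (<<rows4 (B' *m X')>> <= <<rows4 X'>>)%VS.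
  apply/subvP => x /span_rows4P[c ->]; apply/span_rows4P.
  by exists (c *m B'); rewrite mulmxA.
move=> Bu; apply/eqP; rewrite eqEsubv sub /=.
by rewrite -{1}[X](mulKmx Bu) sub.
Qed.

Lemma plucker_pointP P omega : plucker_point P omega <->
  exists X, [/\ row_free X, P = <<rows4 X>>%VS & omega = pluck X].
Proof.
split=> [[dimP [x [u [v [w [PE oE]]]]]]|[X [Xf -> ->]]].
  exists (mx4 x u v w); rewrite rows4_mx4 -wedge4E; split=> //.
  by rewrite -dim_rows4 rows4_mx4 -PE dimP.
split; first by apply/eqP; rewrite dim_rows4.
exists (row (inord 0) X), (row (inord 1) X), (row (inord 2) X), (row (inord 3) X).
by rewrite wedge4E mx4_rows.
Qed.

(** The condition on the fourfold product is independent of the basis of the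
    plane, because it is equivalent to equations between Pluecker
    coordinates. *)
Lemma cayley_mx_mull (B : 'M_4) X : cayley_mx X -> cayley_mx (B *m X).
Proof.
have [Eu EE] := cayley_frame_etilde R.
rewrite -[X](mulmxKV Eu) mulmxA !EE => EX m m7.
by rewrite cform_mull EX// mulr0.
Qed.

Lemma cayley_planeP P : cayley_plane P <->
  exists X, [/\ row_free X, P = <<rows4 X>>%VS & cayley_mx X].
Proof.
split=> [[dimP [x [u [v [w [PE oE]]]]]]|[X [Xf -> Xc]]].
  exists (mx4 x u v w); rewrite rows4_mx4 /cayley_mx !row_mx4//; split=> //.
  by rewrite -dim_rows4 rows4_mx4 -PE dimP.
split; first by apply/eqP; rewrite dim_rows4.
by exists (row (inord 0) X), (row (inord 1) X), (row (inord 2) X), (row (inord 3) X).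
Qed.

Lemma cayley_grassmannianP omega : cayley_grassmannian R omega <->
  exists X, [/\ row_free X, cayley_mx X & omega = pluck X].
Proof.
split=> [[P /cayley_planeP[X [Xf PX Xc]] /plucker_pointP[X' [Xf' PX' ->]]]|].
  have [|B X'E] := @span_rows4_sub X X'; first by rewrite -PX -PX'.
  exists X'; split; [exact: Xf'| |reflexivity].
  rewrite X'E; exact: cayley_mx_mull.
move=> [X [Xf Xc ->]]; exists <<rows4 X>>%VS.
  apply/cayley_planeP; exists X; split; [exact: Xf|reflexivity|exact: Xc].
apply/plucker_pointP; exists X; split; [exact: Xf|reflexivity|reflexivity].
Qed.

Lemma row_free_mulmx A W : W \in unitmx -> row_free (A *m W) = row_free A.
Proof. by move=> Wu; rewrite /row_free mxrankMfree// row_free_unit. Qed.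

(** The form in which membership in the Cayley Grassmannian is used from here
    on. *)
Lemma cayley_grassmannian_frameP W omega : cayley_frame W ->
  cayley_grassmannian R omega <->
  exists A, [/\ row_free A, cayley_eqs A & omega = pluck (A *m W)].
Proof.
move=> [Wu WE]; rewrite cayley_grassmannianP; split=> [[X [Xf Xc ->]]|[A [Af EA ->]]].
  exists (X *m invmx W); rewrite (mulmxKV Wu); split; last reflexivity.
    by rewrite row_free_mulmx ?unitmx_inv.
  apply/WE; rewrite (mulmxKV Wu); exact: Xc.
exists (A *m W); split; last reflexivity.
  by rewrite row_free_mulmx.
by apply/WE; exact: EA.
Qed.

Lemma pluck_neq0 X : (pluck X != 0) = row_free X.
Proof.
apply/idP/idP => [|/row_freeP[Y XY]].
  apply: contraR => /negP Xnf; have /existsNP[v] : ~ forall v : 'rV_4, v *m X = 0 -> v = 0.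
    by move=> Xinj; apply: Xnf; exact: inj_row_free.
  move=> /not_implyP[vX /eqP v0]; apply/eqP/rowP => k; rewrite !mxE.
  apply/eqP/det0P; exists v => //; apply/rowP => b.
  have /rowP/(_ (pidx k b)) := vX; rewrite !mxE => vXb; rewrite -[RHS]vXb.
  by apply: eq_bigr => a _; rewrite !mxE.
apply/eqP => X0; have := det_mulmx_pluck X Y.
by rewrite XY det1 X0 mul0mx mxE => /eqP; rewrite oner_eq0.
Qed.

Lemma cayley_grassmannianZ (c : C) omega : c != 0 ->
  cayley_grassmannian R omega -> cayley_grassmannian R (c *: omega).
Proof.
move=> c0 /cayley_grassmannianP[X [Xf Xc ->]]; apply/cayley_grassmannianP.
have [B detB] := exists_mx_det 3 c.
exists (B *m X); rewrite pluck_mull detB; split; last reflexivity.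
  2: by apply: cayley_mx_mull; exact: Xc.
by rewrite -pluck_neq0 pluck_mull detB scaler_eq0 negb_or c0 pluck_neq0.
Qed.

End Membership.

(** * The Cayley Grassmannian is closed *)

Lemma det_homog (R : comNzRingType) (n m : nat) (M : 'M[{mpoly R[n]}]_m) :
  (forall a b, M a b \is 1.-homog) -> \det M \is m.-homog.
Proof.
move=> M1; apply: rpred_sum => s _.
have -> : (-1) ^+ s * \prod_a M a (s a) = (-1) ^+ s *: \prod_a M a (s a) :> {mpoly R[n]}.
  by rewrite -mul_mpolyC rmorphXn rmorphN1.
apply: dhomogZ; rewrite -[m in m.-homog](card_ord m) -sum1_card.
apply: (@big_ind2 _ _ (fun (F : {mpoly R[n]}) (e : nat) => F \is e.-homog)).
- exact: dhomog1.
- by move=> F e G e' Fe Ge; apply: dhomogM.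
- by move=> a _.
Qed.

Lemma colsub_mulmx (K : pzSemiRingType) (m n p q : nat) (f : 'I_q -> 'I_p)
    (A : 'M[K]_(m, n)) (B : 'M[K]_(n, p)) :
  colsub f (A *m B) = A *m colsub f B.
Proof.
by apply/matrixP => i j; rewrite !mxE; apply: eq_bigr => l _; rewrite !mxE.
Qed.

Definition exchange (f : 'I_4 -> 'I_O) (a : 'I_4) (j : 'I_O) (b : 'I_4) : 'I_O :=
  if b == a then j else f b.

(** Cramer's rule: the entries of [X], after the columns [f] have been reduced
    to the identity by the adjugate, are the minors with one column
    exchanged. *)
Lemma det_colsub_exchange (K : comNzRingType) (f : 'I_4 -> 'I_O)
    (X : 'M[K]_(4, O)) a j :
  \det (colsub (exchange f a j) X) = (\adj (colsub f X) *m X) a j.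
Proof.
rewrite (expand_det_col _ a) mxE; apply: eq_bigr => i _.
rewrite [in RHS]mxE mulrC [X in _ * X]mxE /exchange eqxx.
congr (_ * _); congr (_ * \det _); apply/matrixP => b c.
by rewrite !mxE eq_sym (negbTE (neq_lift a c)).
Qed.

Section Closedness.
Variable R : realType.
Local Notation C := R[i].
Implicit Types (A X : 'M[C]_(4, O)) (x : 'rV[C]_70).

Section PluckerRelations.
Variable k : 'I_70.

(** A basis of the plane with Pluecker vector [x], up to a factor, on the chart
    where the coordinate [k] is nonzero: its entries are the Pluecker coordinates
    of the exchanged columns, which are linear forms. *)
Definition rebuild x : 'M[C]_(4, O) := \matrix_(a, j)
  (x *m dual_pluck (colsub (exchange (pidx k) a j) 1%:M)) 0 0.

Lemma rebuild_pluck X :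
  rebuild (pluck X) = \adj (colsub (pidx k) X) *m X.
Proof.
apply/matrixP => a j; rewrite mxE -det_mulmx_pluck -colsub_mulmx mulmx1.
exact: det_colsub_exchange.
Qed.

(** States that the Pluecker vector of [rebuild x] is a multiple of [x]; the
    factor ['X_k] makes both sides forms of degree 5. *)
Definition plucker_relation (j : 'I_70) : {mpoly C[70]} :=
  'X_k * \det (\matrix_(a < 4, b < 4)
      linform (dual_pluck (colsub (exchange (pidx k) a (pidx j b)) 1%:M))) - 'X_k ^+ 4 * 'X_j.

Lemma plucker_relation_homog j : plucker_relation j \is 5.-homog.
Proof.
have X1 (i : 'I_70) : ('X_i : {mpoly C[70]}) \is 1.-homog by rewrite dhomogX /= mdeg1.
apply: rpredB.
  apply: (@dhomogM _ _ _ 1 _ 4) => //; apply: det_homog => a b; rewrite mxE.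
  exact: linform_homog.
by apply: (@dhomogM _ _ _ 4 _ 1) => //; exact: (dhomogMn 4 (X1 k)).
Qed.

Lemma plucker_relationE j x : (plucker_relation j).@[x 0] =
  x 0 k * pluck (rebuild x) 0 j - x 0 k ^+ 4 * x 0 j.
Proof.
rewrite mevalB mevalM [in X in _ - X]mevalM rmorphXn /= !mevalXU.
congr (_ * _ - _).
rewrite -det_map_mx mxE; congr (\det _); apply/matrixP => a b.
rewrite [RHS]mxE [RHS]mxE -linformE [LHS]mxE /= mxE.
by [].
Qed.

Lemma plucker_relation_pluck j X : (plucker_relation j).@[pluck X 0] = 0.
Proof.
rewrite plucker_relationE rebuild_pluck pluck_mull [in X in _ * X - _]mxE.
have detE : pluck X 0 k = \det (colsub (pidx k) X) by rewrite mxE.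
have := congr1 determinant (mul_mx_adj (colsub (pidx k) X)).
rewrite det_mulmx det_scalar -detE => adjE.
by rewrite mulrA adjE subrr.
Qed.

End PluckerRelations.

(** A vector on which all the forms vanish that vanish on X satisfies the
    Pluecker relations, hence comes from a matrix, and the Cayley equations,
    which are linear in the Pluecker vector. *)
Lemma cayley_grassmannian_closed : zariski_closed (cayley_grassmannian R).
Proof.
exists [set F | (exists d, F \is d.-homog) /\ vanishes F (cayley_grassmannian R)].
split=> [F []//|x]; split=> [Zx|[x0 Fx]].
  split=> [|F [_ FZ]]; last exact: FZ.
  by have /cayley_grassmannianP[X [Xf _ ->]] := Zx; rewrite pluck_neq0.
have [k xk] : exists k, x 0 k != 0.
  apply/existsP; apply: contraR x0; rewrite negb_exists => /forallP x0.
  by apply/eqP/rowP => k; rewrite mxE; have /negPn/eqP := x0 k.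
have pluckE : pluck (rebuild k x) = x 0 k ^+ 3 *: x.
  apply/rowP => j; rewrite [RHS]mxE; apply: (mulfI xk); apply/eqP.
  rewrite mulrA -exprS -subr_eq0 -plucker_relationE; apply/eqP/Fx; split.
    by exists 5%N; exact: plucker_relation_homog.
  by move=> _ /cayley_grassmannianP[X [_ _ ->]]; exact: plucker_relation_pluck.
suff Zp : cayley_grassmannian R (pluck (rebuild k x)).
  rewrite -[x](scalerK (expf_neq0 3 xk)) -pluckE.
  by apply: cayley_grassmannianZ => //; rewrite invr_eq0 expf_neq0.
have [Eu EE] := cayley_frame_etilde R.
apply/(cayley_grassmannian_frameP _ (cayley_frame_etilde R)).
exists (rebuild k x *m invmx (etilde_mx R)); rewrite (mulmxKV Eu); split; last reflexivity.
  rewrite row_free_mulmx ?unitmx_inv// -pluck_neq0 pluckE.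
  by rewrite scaler_eq0 negb_or expf_neq0.
move=> m m7; have [c cE] := cform_linear (invmx (etilde_mx R)) m.
rewrite cE pluckE -scalemxAl mxE.
have -> : (x *m c) 0 0 = 0; last by rewrite mulr0.
rewrite -linformE; apply: Fx; split; first by exists 1%N; exact: linform_homog.
move=> _ /(cayley_grassmannian_frameP _ (cayley_frame_etilde R))[A [_ EA ->]].
by rewrite linformE -cE (mulmxK Eu) EA.
Qed.

End Closedness.

(** * The affine chart of dimension 12 *)

Section BigCell.
Variable K : comNzRingType.
Implicit Types (t : nat -> K) (a b c d : K).

(** The rows of a matrix whose columns 0, 2, 4, 7 form the identity; a variable
    xij below is the entry in column j of the row with its 1 in column i. *)
Definition row0 a b c d (k : nat) : K := nth 0 [:: 1; a; 0; b; 0; c; d; 0] k.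
Definition row2 a b c d (k : nat) : K := nth 0 [:: 0; a; 1; b; 0; c; d; 0] k.
Definition row4 a b c d (k : nat) : K := nth 0 [:: 0; a; 0; b; 1; c; d; 0] k.
Definition row7 a b c d (k : nat) : K := nth 0 [:: 0; a; 0; b; 0; c; d; 1] k.

Section Coordinates.
Variables x01 x03 x05 x06 x21 x23 x25 x26 x41 x43 x45 x46 x71 x73 x75 x76 : K.
Let E := cayley_form (row0 x01 x03 x05 x06) (row2 x21 x23 x25 x26)
  (row4 x41 x43 x45 x46) (row7 x71 x73 x75 x76).

(** These four equations are solved for x45, x46, x05 and x25, each of which
    occurs exactly once. *)
Lemma cayley_form_cell :
  [/\ E 0%N = x45 - (x01*x23*x76 - x01*x26*x73 - x03*x21*x76 + x03*x26*x71
                   + x06*x21*x73 - x06*x23*x71),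
      E 1%N = - x75 - x03*x76 + x06*x73 + x21*x76 - x26*x71 - x46,
      E 3%N = - x41 - x01*x26 + x01*x73 - x03*x71 + x06*x21 - x05 &
      E 6%N = x25 - (- x43 - x03*x26 + x06*x23 + x21*x73 - x23*x71)].
Proof.
split; cbv [E row0 row2 row4 row7 cayley_form minor4 minor3 minor2 nth]; ring.
Qed.
End Coordinates.

(** The parameters are the twelve entries that remain free. *)
Definition cell_row t (i : nat) : nat -> K :=
  let x01 := t 0%N in let x03 := t 1%N in let x06 := t 2%N in
  let x21 := t 3%N in let x23 := t 4%N in let x26 := t 5%N in
  let x41 := t 6%N in let x43 := t 7%N in
  let x71 := t 8%N in let x73 := t 9%N in let x75 := t 10%N in let x76 := t 11%N in
  nth (fun=> 0) [::
    row0 x01 x03 (- x41 - x01*x26 + x01*x73 - x03*x71 + x06*x21) x06;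
    row2 x21 x23 (- x43 - x03*x26 + x06*x23 + x21*x73 - x23*x71) x26;
    row4 x41 x43 (x01*x23*x76 - x01*x26*x73 - x03*x21*x76 + x03*x26*x71
                   + x06*x21*x73 - x06*x23*x71)
                 (- x75 - x03*x76 + x06*x73 + x21*x76 - x26*x71);
    row7 x71 x73 x75 x76] i.

Definition cell_mx t : 'M[K]_(4, O) := \matrix_(i, j) cell_row t i j.

Definition cell_index : seq (nat * nat) := [:: (0, 1); (0, 3); (0, 6);
  (1, 1); (1, 3); (1, 6); (2, 1); (2, 3); (3, 1); (3, 3); (3, 5); (3, 6)]%N.

Definition cell_coord (A : 'M[K]_(4, O)) (i : nat) : K :=
  mrow A (nth (0, 0)%N cell_index i).1 (nth (0, 0)%N cell_index i).2.

Lemma mrow_cell_mx t i k : (i < 4)%N -> (k < 8)%N -> mrow (cell_mx t) i k = cell_row t i k.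
Proof. by move=> i4 k8; rewrite /mrow mxE !inordK. Qed.

Lemma cell_coordK t i : (i < 12)%N -> cell_coord (cell_mx t) i = t i.
Proof.
by move=> i12; do 12?[case: i i12 => [|i] i12 //]; rewrite /cell_coord mrow_cell_mx.
Qed.

(** Once the four equations are solved, the three others hold identically. *)
Lemma cell_mx_eqs t : cayley_eqs (cell_mx t).
Proof.
move=> m m7; rewrite /cform.
rewrite (eq_cayley_form (r' := cell_row t 0) (s' := cell_row t 1)
  (t' := cell_row t 2) (u' := cell_row t 3)).
  2-5: by move=> k k8; exact: mrow_cell_mx.
do 7?[case: m m7 => [|m] m7 //].
all: cbv [cell_row row0 row2 row4 row7 cayley_form minor4 minor3 minor2 nth]; ring.
Qed.

Lemma colsub_cell_mx t : colsub (cols4 0 2 4 7) (cell_mx t) = 1%:M.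
Proof.
apply/matrixP => i j; rewrite !mxE -val_eqE /=; case: i => i /= i4; case: j => j /= j4.
rewrite inordK; last by do 4?[case: j j4 => [|j] j4 //].
by do 4?[case: i i4 => [|i] i4 //]; do 4?[case: j j4 => [|j] j4 //].
Qed.

Lemma cell_mx_unique (A : 'M[K]_(4, O)) :
  colsub (cols4 0 2 4 7) A = 1%:M -> cayley_eqs A -> A = cell_mx (cell_coord A).
Proof.
move=> A1 EA.
have A1E i k : (i < 4)%N -> (k < 4)%N ->
    mrow A i (nth 0%N [:: 0; 2; 4; 7]%N k) = (i == k)%:R.
  move=> i4 k4; have := congr1 (fun M : 'M_4 => M (inord i) (inord k)) A1.
  by rewrite mxE [in RHS]mxE /cols4 -val_eqE /= !inordK.
have rowE : forall k, (k < 8)%N ->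
  [/\ mrow A 0 k = row0 (mrow A 0 1) (mrow A 0 3) (mrow A 0 5) (mrow A 0 6) k,
      mrow A 1 k = row2 (mrow A 1 1) (mrow A 1 3) (mrow A 1 5) (mrow A 1 6) k,
      mrow A 2 k = row4 (mrow A 2 1) (mrow A 2 3) (mrow A 2 5) (mrow A 2 6) k &
      mrow A 3 k = row7 (mrow A 3 1) (mrow A 3 3) (mrow A 3 5) (mrow A 3 6) k].
  have A1' i := (A1E i 0%N, A1E i 1%N, A1E i 2%N, A1E i 3%N); rewrite /= in A1'.
  by move=> k k8; do 8?[case: k k8 => [|k] k8 //]; split=> //; rewrite !A1'.
have formE m : cform A m = cayley_form
    (row0 (mrow A 0 1) (mrow A 0 3) (mrow A 0 5) (mrow A 0 6))
    (row2 (mrow A 1 1) (mrow A 1 3) (mrow A 1 5) (mrow A 1 6))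
    (row4 (mrow A 2 1) (mrow A 2 3) (mrow A 2 5) (mrow A 2 6))
    (row7 (mrow A 3 1) (mrow A 3 3) (mrow A 3 5) (mrow A 3 6)) m.
  by apply: eq_cayley_form => k /rowE[].
have [E0 E1 E3 E6] := cayley_form_cell (mrow A 0 1) (mrow A 0 3) (mrow A 0 5)
  (mrow A 0 6) (mrow A 1 1) (mrow A 1 3) (mrow A 1 5) (mrow A 1 6) (mrow A 2 1)
  (mrow A 2 3) (mrow A 2 5) (mrow A 2 6) (mrow A 3 1) (mrow A 3 3) (mrow A 3 5)
  (mrow A 3 6).
rewrite -!formE !EA// in E0 E1 E3 E6.
have sub0 (a b : K) : 0 = a - b -> a = b.
  by move=> /esym/eqP; rewrite subr_eq0 => /eqP.
move: E0 E1 E3 E6 => /sub0 E45 /sub0/esym E46 /sub0/esym E05 /sub0 E25.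
apply: mrow_inj => i k i4 k8; rewrite mrow_cell_mx//.
have [r0 r1 r2 r3] := rowE k k8.
do 4?[case: i i4 => [|i] i4 //]; rewrite /cell_row /cell_coord /=.
- by rewrite {}r0 E05.
- by rewrite {}r1 E25.
- by rewrite {}r2 E45 E46.
Qed.

End BigCell.

Lemma map_cell_mx (K L : comNzRingType) (f : {rmorphism K -> L}) (t : nat -> K) :
  map_mx f (cell_mx t) = cell_mx (f \o t).
Proof.
apply/matrixP => i j; rewrite !mxE; case: i => i /= i4; case: j => j /= j8.
do 4?[case: i i4 => [|i] i4 //]; do 8?[case: j j8 => [|j] j8 //].
all: by rewrite /cell_row /row0 /row2 /row4 /row7 /= ?(rmorph0, rmorph1, rmorphD, rmorphN, rmorphM).
Qed.

Section ChartSmoothness.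
Variable R : realType.
Local Notation C := R[i].
Implicit Types A X : 'M[C]_(4, O).

(** Since the minor is 1, the plane keeps its Pluecker vector when the columns
    [f] are reduced to the identity. *)
Lemma unit_minor_frame (f : 'I_4 -> 'I_O) A : \det (colsub f A) = 1 ->
  exists2 B, colsub f (B *m A) = 1%:M & \det B = 1.
Proof.
move=> detA; have Au : colsub f A \in unitmx by rewrite unitmxE detA unitr1.
exists (invmx (colsub f A)); first by rewrite colsub_mulmx mulVmx.
by rewrite det_inv detA invr1.
Qed.

Variable W : 'M[C]_O.
Hypothesis frameW : cayley_frame W.
Let Wu : W \in unitmx. Proof. by case: frameW. Qed.
Let V := invmx W.
Let If := cols4 0 2 4 7.

(** The Pluecker coordinate 0247 with respect to the frame [W]; where it is 1,
    the columns of [cell_l] give the twelve parameters. *)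
Definition cell_l0 : 'cV[C]_70 := dual_pluck (colsub If V).
Definition cell_l : 'M[C]_(70, 12) := \matrix_(k, i)
  dual_pluck (colsub (exchange If (inord (nth (0, 0)%N cell_index i).1)
                                  (inord (nth (0, 0)%N cell_index i).2)) V) k 0.

Definition cell_phi : 70.-tuple {mpoly C[12]} :=
  [tuple \det (colsub (pidx k)
     (cell_mx (fun i => 'X_(inord i : 'I_12)) *m map_mx (@mpolyC 12 C) W)) | k < 70].

Lemma cell_chart_map (t : 'rV[C]_12) :
  chart_map cell_phi t = pluck (cell_mx (fun i => t 0 (inord i)) *m W).
Proof.
apply/rowP => k; rewrite chart_mapE tnth_mktuple [RHS]mxE.
rewrite -det_map_mx; congr (\det _).
rewrite map_mxsub map_mxM map_cell_mx; congr (colsub _ (_ *m _)).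
  by congr cell_mx; apply/funext => i; rewrite /= mevalXU.
by apply/matrixP => a b; rewrite mxE /= mxE; exact: mevalC.
Qed.

Lemma cell_lE X i : (pluck X *m cell_l) 0 i = (pluck X *m
  dual_pluck (colsub (exchange If (inord (nth (0, 0)%N cell_index i).1)
                                  (inord (nth (0, 0)%N cell_index i).2)) V)) 0 0.
Proof. by rewrite !mxE; apply: eq_bigr => k _; rewrite [X in _ * X = _]mxE. Qed.

Lemma frame_l0E A : (pluck (A *m W) *m cell_l0) 0 0 = \det (colsub If A).
Proof. by rewrite -det_mulmx_pluck -colsub_mulmx mulmxK. Qed.

Lemma frame_lE A i : (pluck (A *m W) *m cell_l) 0 i =
  \det (colsub (exchange If (inord (nth (0, 0)%N cell_index i).1)
                            (inord (nth (0, 0)%N cell_index i).2)) A).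
Proof. by rewrite cell_lE -det_mulmx_pluck -colsub_mulmx mulmxK. Qed.

Lemma frame_l_unit A : colsub If A = 1%:M ->
  pluck (A *m W) *m cell_l = \row_i cell_coord A i.
Proof.
move=> A1; apply/rowP => i; rewrite frame_lE det_colsub_exchange A1 [RHS]mxE.
have -> : \adj (1%:M : 'M[C]_4) = 1%:M.
  by rewrite -[LHS]mul1mx mul_mx_adj det1.
by rewrite mul1mx.
Qed.

Lemma row_free_colsub_unit (f : 'I_4 -> 'I_O) A : colsub f A \in unitmx -> row_free A.
Proof.
move=> Au; apply: inj_row_free => v vA.
rewrite -[v]mulmx1 -(mulmxV Au) mulmxA -colsub_mulmx vA.
rewrite [colsub f 0](_ : _ = 0) ?mul0mx//.
by apply/matrixP => a b; rewrite !mxE.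
Qed.

Lemma frame_chart_smooth A : row_free A -> cayley_eqs A ->
  \det (colsub If A) != 0 -> smooth_point (cayley_grassmannian R) (pluck (A *m W)).
Proof.
move=> Af EA detA.
have cellZ (t : 'rV[C]_12) : colsub If (cell_mx (fun i => t 0 (inord i))) = 1%:M.
  exact: colsub_cell_mx.
apply: (@affine_chart_smooth R 70 12 _ cell_l0 cell_l cell_phi).
- exact: cayley_grassmannian_closed.
- move=> t; rewrite cell_chart_map; apply/(cayley_grassmannian_frameP _ frameW).
  exists (cell_mx (fun i => t 0 (inord i))); split; last reflexivity.
    by apply: (@row_free_colsub_unit If); rewrite cellZ unitmx1.
  exact: cell_mx_eqs.
- by move=> t; rewrite cell_chart_map frame_l0E cellZ det1.
- move=> t; rewrite cell_chart_map frame_l_unit//; apply/rowP => i.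
  by rewrite mxE cell_coordK ?inord_val.
- move=> x /(cayley_grassmannian_frameP _ frameW)[B [Bf EB ->]].
  rewrite frame_l0E => detB.
  have [D DB detD] := unit_minor_frame detB.
  have EDB : cayley_eqs (D *m B) by move=> m m7; rewrite cform_mull EB ?mulr0.
  have -> : pluck (B *m W) = pluck (D *m B *m W).
    by rewrite -mulmxA pluck_mull detD scale1r.
  move: (D *m B) DB EDB => B' B'1 EB'.
  rewrite cell_chart_map (frame_l_unit B'1); congr (pluck (_ *m W)).
  rewrite [LHS](cell_mx_unique B'1 EB'); apply/matrixP => a b; rewrite !mxE.
  have cell_rowE t t' i : (forall j, (j < 12)%N -> t j = t' j) ->
      cell_row t i = cell_row t' i :> (nat -> C).
    by move=> tt; rewrite /cell_row !tt.
  by rewrite (@cell_rowE _ (cell_coord B'))// => j j12; rewrite mxE inordK.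
- apply/(cayley_grassmannian_frameP _ frameW); exists A; split; [exact: Af|exact: EA|reflexivity].
- by rewrite frame_l0E.
Qed.

End ChartSmoothness.

(** * Coordinate planes and the smooth fixed points *)

(** With respect to a frame, the plane spanned by four of its vectors. *)
Definition label_mx (K : comNzRingType) (s : seq nat) : 'M[K]_(4, O) :=
  \matrix_(a, j) unit_row K (nth 0%N s a) j.

Lemma mrow_label_mx (K : comNzRingType) s a k : (a < 4)%N -> (k < 8)%N ->
  mrow (label_mx K s) a k = unit_row K (nth 0%N s a) k.
Proof. by move=> a4 k8; rewrite /mrow mxE !inordK. Qed.

Section IntegerEntries.
Variable K : comNzRingType.
Implicit Types r : nat -> int.

(** Coordinate planes and their images under shears have integral coordinates,
    so that conditions on them are decided by computation with integers. *)
Definition intro_row r : nat -> K := fun k => (r k)%:~R.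

Lemma unit_row_int j : unit_row K j = intro_row (unit_row int j).
Proof. by apply/funext => k; rewrite /intro_row /unit_row; case: (k == j). Qed.

Lemma shear1_int r : shear1 1 (intro_row r) = intro_row (shear1 1 r).
Proof.
apply/funext => k; rewrite /intro_row; do 8?[case: k => [|k]]; last by case: k.
all: by rewrite /shear1 /= ?mul1r ?intrD ?intrN.
Qed.
Lemma shear2_int r : shear2 1 (intro_row r) = intro_row (shear2 1 r).
Proof.
apply/funext => k; rewrite /intro_row; do 8?[case: k => [|k]]; last by case: k.
all: by rewrite /shear2 /= ?mul1r ?intrD ?intrN.
Qed.
Lemma shear3_int r : shear3 1 (intro_row r) = intro_row (shear3 1 r).
Proof.
apply/funext => k; rewrite /intro_row; do 8?[case: k => [|k]]; last by case: k.
all: by rewrite /shear3 /= ?mul1r ?intrD ?intrN.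
Qed.
Lemma shear4_int r : shear4 1 (intro_row r) = intro_row (shear4 1 r).
Proof.
apply/funext => k; rewrite /intro_row; do 8?[case: k => [|k]]; last by case: k.
all: by rewrite /shear4 /= ?mul1r ?intrD ?intrN.
Qed.
Lemma shear5_int r : shear5 1 (intro_row r) = intro_row (shear5 1 r).
Proof.
apply/funext => k; rewrite /intro_row; do 8?[case: k => [|k]]; last by case: k.
all: by rewrite /shear5 /= ?mul1r ?intrD ?intrN.
Qed.

Lemma minor4_int r r' r'' r''' a b c d :
  minor4 (intro_row r) (intro_row r') (intro_row r'') (intro_row r''') a b c d =
  (minor4 r r' r'' r''' a b c d)%:~R.
Proof.
by rewrite /minor4 /minor3 /minor2 /intro_row !(intrD, intrN, intrM).
Qed.

Lemma cayley_form_int r r' r'' r''' m :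
  cayley_form (intro_row r) (intro_row r') (intro_row r'') (intro_row r''') m =
  (cayley_form r r' r'' r''' m)%:~R.
Proof.
rewrite /cayley_form; do 7?[case: m => [|m]]; last by case: m => [|m] /=; rewrite mulr0z.
all: by rewrite /= !minor4_int !(intrD, intrN).
Qed.

End IntegerEntries.

Definition label_form (s : seq nat) (m : nat) : int :=
  cayley_form (unit_row int (nth 0%N s 0)) (unit_row int (nth 0%N s 1))
    (unit_row int (nth 0%N s 2)) (unit_row int (nth 0%N s 3)) m.

Lemma cform_label_mx (K : comNzRingType) s m :
  cform (label_mx K s) m = (label_form s m)%:~R.
Proof.
rewrite -cayley_form_int -!unit_row_int; apply: eq_cayley_form => k k8;
  exact: mrow_label_mx.
Qed.

Definition cayley_label (s : seq nat) : bool :=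
  all (fun m => label_form s m == 0) (iota 0 7).

Lemma cayley_labelP (K : numDomainType) s :
  reflect (cayley_eqs (label_mx K s)) (cayley_label s).
Proof.
apply: (iffP allP) => [Es m m7|Es m].
  by rewrite cform_label_mx (eqP (Es m _)) ?mem_iota.
rewrite mem_iota => m7; have := Es m m7; rewrite cform_label_mx => /eqP.
by rewrite intr_eq0.
Qed.

Lemma fixed_labels_cayley s : s \in fixed_labels -> cayley_label s.
Proof.
have : all cayley_label fixed_labels by vm_compute.
by move=> /allP; exact.
Qed.

Lemma cayley_label_fixed s : s \in plucker_index -> cayley_label s -> s \in fixed_labels.
Proof.
have : all (fun s => cayley_label s ==> (s \in fixed_labels)) plucker_index.
  by vm_compute.
by move=> /allP H /H/implyP; exact.
Qed.

Lemma fixed_labels_plucker s : s \in fixed_labels -> s \in plucker_index.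
Proof.
have : all (fun s => s \in plucker_index) fixed_labels by vm_compute.
by move=> /allP; exact.
Qed.

Definition shear_row (K : comNzRingType) (r : nat -> K) : nat -> K :=
  shear5 1 (shear4 1 (shear3 1 (shear2 1 (shear1 1 r)))).

(** The images of the unit vectors under [shear_row], tabulated once to keep the
    computation with minors small. *)
Definition shear_table : seq (seq int) := [::
  [:: 1; 0; 0; 0; 1; 0; 0; 0];
  [:: -1; 1; 2; 0; 3; 0; 1; 1];
  [:: 0; 0; 1; 0; 1; 0; 0; 0];
  [:: -1; 0; 0; 1; 1; 0; 0; -1];
  [:: 0; 0; 0; 0; 1; 0; 0; 0];
  [:: -2; -1; -1; -1; -2; 1; 1; -1];
  [:: -1; 0; 1; 0; 1; 0; 1; 0];
  [:: -1; 0; 0; 0; -2; 0; 0; 1]].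

Definition shear_table_row (j k : nat) : int := nth 0 (nth [::] shear_table j) k.

Lemma shear_tableE j k : (j < 8)%N -> (k < 8)%N ->
  shear_row (unit_row int j) k = shear_table_row j k.
Proof.
have : all (fun j => all (fun k =>
    shear_row (unit_row int j) k == shear_table_row j k) (iota 0 8)) (iota 0 8).
  by vm_compute.
move=> /allP/(_ j); rewrite mem_iota => H /H/allP/(_ k).
by rewrite mem_iota => Hk /Hk/eqP.
Qed.

(** After the shears, the coordinate 0247 of the plane is nonzero. *)
Definition big_cell_label (s : seq nat) : bool :=
  minor4 (shear_table_row (nth 0%N s 0)) (shear_table_row (nth 0%N s 1))
    (shear_table_row (nth 0%N s 2)) (shear_table_row (nth 0%N s 3)) 0%N 2%N 4%N 7%N != 0.

Lemma nonsingular_labels_big_cell s : s \in fixed_labels -> s \notin singular_labels ->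
  big_cell_label s.
Proof.
have : all (fun s => (s \notin singular_labels) ==> big_cell_label s) fixed_labels.
  by vm_compute.
by move=> /allP H /H/implyP; exact.
Qed.

Section SmoothLabels.
Variable R : realType.
Local Notation C := R[i].

Lemma etilde4_label_mx s : all (ltn^~ 8) s -> size s = 4%N ->
  etilde4 R s = pluck (label_mx C s *m etilde_mx R).
Proof.
move=> s8 s4; rewrite /etilde4 wedge4E; congr pluck; apply: mrow_inj => a k a4 k8.
have sa8 : (nth 0%N s a < 8)%N by apply: (allP s8); rewrite mem_nth ?s4.
rewrite /mrow mxE [RHS]mxE inordK// (bigD1 (Ordinal sa8))//= mxE /unit_row inordK// eqxx.
rewrite mul1r big1 => [|j jsa]; last first.
  rewrite mxE /unit_row inordK//.
  by move: jsa; rewrite -val_eqE /= => /negbTE ->; rewrite mul0r.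
rewrite addr0 mxE /=.
by do 4?[case: a a4 sa8 => [|a] a4 sa8 //].
Qed.

Lemma plucker_index_label s : s \in plucker_index -> all (ltn^~ 8) s /\ size s = 4%N.
Proof.
move=> /(nthP [::])[k]; rewrite size_plucker_index => k70 <-.
by have /and3P[/eqP] := plucker_index_sorted k70.
Qed.

(** In this frame the coordinates of e~_j are those of the unit vector [j] after
    the five shears. *)
Definition big_cell_frame : 'M[C]_O :=
  opmx (shear5 (-1)) *m (opmx (shear4 (-1)) *m (opmx (shear3 (-1)) *m
    (opmx (shear2 (-1)) *m (opmx (shear1 (-1)) *m etilde_mx R)))).

Lemma big_cell_frame_cayley : cayley_frame big_cell_frame.
Proof.
apply: (@cayley_frame_op R _ (shear5 1)); [exact: shear5_lin|exact: shear5_ext|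
  exact: shear5_eqs|exact: shear5_lin|exact: shear5_ext|exact: shear5_eqs| |].
  by move=> r k k8; rewrite -{1}[1]opprK shear5K.
apply: (@cayley_frame_op R _ (shear4 1)); [exact: shear4_lin|exact: shear4_ext|
  exact: shear4_eqs|exact: shear4_lin|exact: shear4_ext|exact: shear4_eqs| |].
  by move=> r k k8; rewrite -{1}[1]opprK shear4K.
apply: (@cayley_frame_op R _ (shear3 1)); [exact: shear3_lin|exact: shear3_ext|
  exact: shear3_eqs|exact: shear3_lin|exact: shear3_ext|exact: shear3_eqs| |].
  by move=> r k k8; rewrite -{1}[1]opprK shear3K.
apply: (@cayley_frame_op R _ (shear2 1)); [exact: shear2_lin|exact: shear2_ext|
  exact: shear2_eqs|exact: shear2_lin|exact: shear2_ext|exact: shear2_eqs| |].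
  by move=> r k k8; rewrite -{1}[1]opprK shear2K.
apply: (@cayley_frame_op R _ (shear1 1)); [exact: shear1_lin|exact: shear1_ext|
  exact: shear1_eqs|exact: shear1_lin|exact: shear1_ext|exact: shear1_eqs| |].
  by move=> r k k8; rewrite -{1}[1]opprK shear1K.
exact: cayley_frame_etilde.
Qed.

Definition big_cell_coords (A : 'M[C]_(4, O)) : 'M[C]_(4, O) :=
  A *m opmx (shear1 1) *m opmx (shear2 1) *m opmx (shear3 1) *m opmx (shear4 1)
    *m opmx (shear5 1).

Lemma big_cell_coordsK A : big_cell_coords A *m big_cell_frame = A *m etilde_mx R.
Proof.
have K1 : opmx (shear1 1) *m opmx (shear1 (-1)) = 1%:M :> 'M[C]_O.
  by apply: opmx_cancel; [exact: shear1_lin|exact: shear1_ext|exact: shear1_lin|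
    exact: shear1_ext|exact: shear1K].
have K2 : opmx (shear2 1) *m opmx (shear2 (-1)) = 1%:M :> 'M[C]_O.
  by apply: opmx_cancel; [exact: shear2_lin|exact: shear2_ext|exact: shear2_lin|
    exact: shear2_ext|exact: shear2K].
have K3 : opmx (shear3 1) *m opmx (shear3 (-1)) = 1%:M :> 'M[C]_O.
  by apply: opmx_cancel; [exact: shear3_lin|exact: shear3_ext|exact: shear3_lin|
    exact: shear3_ext|exact: shear3K].
have K4 : opmx (shear4 1) *m opmx (shear4 (-1)) = 1%:M :> 'M[C]_O.
  by apply: opmx_cancel; [exact: shear4_lin|exact: shear4_ext|exact: shear4_lin|
    exact: shear4_ext|exact: shear4K].
have K5 : opmx (shear5 1) *m opmx (shear5 (-1)) = 1%:M :> 'M[C]_O.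
  by apply: opmx_cancel; [exact: shear5_lin|exact: shear5_ext|exact: shear5_lin|
    exact: shear5_ext|exact: shear5K].
have cancel (M N B : 'M[C]_O) (D : 'M[C]_(4, O)) : M *m N = 1%:M ->
    D *m M *m (N *m B) = D *m B.
  by move=> MN; rewrite mulmxA -(mulmxA D) MN mulmx1.
rewrite /big_cell_coords /big_cell_frame.
by rewrite (cancel _ _ _ _ K5) (cancel _ _ _ _ K4) (cancel _ _ _ _ K3)
  (cancel _ _ _ _ K2) (cancel _ _ _ _ K1).
Qed.

Lemma mrow_big_cell_coords A i k : (k < 8)%N ->
  mrow (big_cell_coords A) i k = shear_row (mrow A i) k.
Proof.
move=> k8; rewrite mrow_opmx//; [|exact: shear5_lin|exact: shear5_ext].
apply: shear5_ext => // j j8; rewrite mrow_opmx//; [|exact: shear4_lin|exact: shear4_ext].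
apply: shear4_ext => // {j8}j j8; rewrite mrow_opmx//; [|exact: shear3_lin|exact: shear3_ext].
apply: shear3_ext => // {j8}j j8; rewrite mrow_opmx//; [|exact: shear2_lin|exact: shear2_ext].
apply: shear2_ext => // {j8}j j8; rewrite mrow_opmx//; [exact: shear1_lin|exact: shear1_ext].
Qed.

Lemma big_cell_coords_eqs A : cayley_eqs A -> cayley_eqs (big_cell_coords A).
Proof.
move=> EA; apply: preserves_cayley_eqs; [exact: shear5_lin|exact: shear5_ext|exact: shear5_eqs|].
apply: preserves_cayley_eqs; [exact: shear4_lin|exact: shear4_ext|exact: shear4_eqs|].
apply: preserves_cayley_eqs; [exact: shear3_lin|exact: shear3_ext|exact: shear3_eqs|].
apply: preserves_cayley_eqs; [exact: shear2_lin|exact: shear2_ext|exact: shear2_eqs|].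
by apply: preserves_cayley_eqs; [exact: shear1_lin|exact: shear1_ext|exact: shear1_eqs|].
Qed.

Lemma nonsingular_label_smooth s : s \in fixed_labels -> s \notin singular_labels ->
  smooth_point (cayley_grassmannian R) (etilde4 R s).
Proof.
move=> sf sns; have [s8 s4] := plucker_index_label (fixed_labels_plucker sf).
rewrite etilde4_label_mx// -big_cell_coordsK.
have shear_rowE a k : (a < 4)%N -> (k < 8)%N -> mrow (big_cell_coords (label_mx C s)) a k =
    intro_row C (shear_table_row (nth 0%N s a)) k.
  move=> a4 k8; rewrite [RHS]/intro_row -shear_tableE//; last first.
    by apply: (allP s8); rewrite mem_nth ?s4.
  rewrite -/(intro_row C (shear_row _) k) mrow_big_cell_coords// /shear_row.
  rewrite -shear5_int -shear4_int -shear3_int -shear2_int -shear1_int -unit_row_int.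
  apply: shear5_ext => // j j8; apply: shear4_ext => // {j8}j j8.
  apply: shear3_ext => // {j8}j j8; apply: shear2_ext => // {j8}j j8.
  by apply: shear1_ext => // {j8}j j8; exact: mrow_label_mx.
have det_neq0 : \det (colsub (cols4 0 2 4 7) (big_cell_coords (label_mx C s))) != 0.
  rewrite -minor4_det (eq_minor4 (r' := intro_row C (shear_table_row (nth 0%N s 0)))
    (s' := intro_row C (shear_table_row (nth 0%N s 1)))
    (t' := intro_row C (shear_table_row (nth 0%N s 2)))
    (u' := intro_row C (shear_table_row (nth 0%N s 3)))) //;
    try (by move=> k k8; exact: shear_rowE).
  by rewrite minor4_int intr_eq0; exact: nonsingular_labels_big_cell.
apply: frame_chart_smooth => //; first exact: big_cell_frame_cayley.
  by apply: (@row_free_colsub_unit _ (cols4 0 2 4 7)); rewrite unitmxE unitfE.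
apply: big_cell_coords_eqs; apply/cayley_labelP; exact: fixed_labels_cayley.
Qed.

End SmoothLabels.

(** * The torus *)

Section TorusAction.
Variable R : realType.
Local Notation C := R[i].
Local Notation oct := 'rV[C]_O.
Implicit Types A X : 'M[C]_(4, O).

Definition torus4 (l : nat -> C) : 'M[C]_O :=
  block_diag4 (torus_L (l 0%N)) (torus_L (l 1%N)) (torus_L (l 2%N)) (torus_L (l 3%N)).

(** The vectors e~_(2j) and e~_(2j+1) are eigenvectors of the block L_l, with
    eigenvalues l and its inverse. *)
Definition torus_weight (l : nat -> C) (k : nat) : C :=
  if odd k then (l k./2)^-1 else l k./2.

Lemma block_diag4E (M0 M1 M2 M3 : 'M[C]_2) (j k : nat) : (j < 8)%N -> (k < 8)%N ->
  block_diag4 M0 M1 M2 M3 (inord j) (inord k) =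
  if (j./2 == k./2)%N then (nth 0 [:: M0; M1; M2; M3] j./2) (inord (odd j)) (inord (odd k))
  else 0.
Proof.
move=> j8 k8.
pose e (b : nat) (r : 'I_2) : 'I_(4 + 4) := nth (lshift 4 (lshift 2 r))
  [:: lshift 4 (lshift 2 r); lshift 4 (rshift 2 r);
      rshift 4 (lshift 2 r); rshift 4 (rshift 2 r)] b.
have eE m : (m < 8)%N -> inord m = e m./2 (inord (odd m)) :> 'I_(4 + 4).
  move=> m8; apply: val_inj; rewrite /= inordK//.
  by do 8?[case: m m8 => [|m] m8 //]; rewrite /e /= inordK.
have ul (M N : 'M[C]_2) (r s : 'I_2) :
    @fun_of_matrix C 4 4 (block_mx M 0 0 N : 'M_(2 + 2))
      (lshift 2 r : 'I_(2 + 2)) (lshift 2 s : 'I_(2 + 2)) = M r s.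
  exact: block_mxEul.
have ur (M N : 'M[C]_2) (r s : 'I_2) :
    @fun_of_matrix C 4 4 (block_mx M 0 0 N : 'M_(2 + 2))
      (lshift 2 r : 'I_(2 + 2)) (rshift 2 s : 'I_(2 + 2)) = 0.
  by apply: etrans (block_mxEur _ _ _ _ _ _) _; rewrite mxE.
have dl (M N : 'M[C]_2) (r s : 'I_2) :
    @fun_of_matrix C 4 4 (block_mx M 0 0 N : 'M_(2 + 2))
      (rshift 2 r : 'I_(2 + 2)) (lshift 2 s : 'I_(2 + 2)) = 0.
  by apply: etrans (block_mxEdl _ _ _ _ _ _) _; rewrite mxE.
have dr (M N : 'M[C]_2) (r s : 'I_2) :
    @fun_of_matrix C 4 4 (block_mx M 0 0 N : 'M_(2 + 2))
      (rshift 2 r : 'I_(2 + 2)) (rshift 2 s : 'I_(2 + 2)) = N r s.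
  exact: block_mxEdr.
rewrite !eE// /block_diag4.
do 8?[case: j j8 => [|j] j8 //]; do 8?[case: k k8 => [|k] k8 //].
all: by rewrite /e /= (block_mxEul, block_mxEur, block_mxEdl, block_mxEdr) ?(ul, ur, dl, dr) ?mxE.
Qed.

Lemma torus_L1 : torus_L (1 : C) = 1%:M.
Proof.
have half1 : (1 + 1) / 2 = 1 :> C by rewrite -[1 + 1]/2%:R divff ?pnatr_eq0.
apply/matrixP => a b; rewrite !mxE invr1 half1 subrr mul0r !mulr0.
by case: (a == b); case: (a == 0).
Qed.

Lemma torus_scaling (K : numFieldType) (im a b l l' : K) : im * im = -1 ->
  [/\ (a + b) * ((l + l') / 2) + im * (a - b) * (- im * ((l - l') / 2)) = l * a + l' * b &
      (a + b) * (im * ((l - l') / 2)) + im * (a - b) * ((l + l') / 2) =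
      im * (l * a - l' * b)].
Proof.
move=> im2; split.
  have -> : im * (a - b) * (- im * ((l - l') / 2)) = - (im * im) * (a - b) * ((l - l') / 2).
    by ring.
  by rewrite im2; field.
by field.
Qed.

Lemma torus_LE (l : C) :
  [/\ torus_L l (inord 0) (inord 0) = (l + l^-1) / 2,
      torus_L l (inord 0) (inord 1) = - 'i%C * ((l - l^-1) / 2),
      torus_L l (inord 1) (inord 0) = 'i%C * ((l - l^-1) / 2) &
      torus_L l (inord 1) (inord 1) = (l + l^-1) / 2].
Proof. by split; rewrite mxE -!val_eqE /= !inordK. Qed.

Lemma torus_even_row (a b l : C) :
  (a + b) * torus_L l (inord 0) (inord 0) + 'i%C * (a - b) * torus_L l (inord 0) (inord 1)
  = l * a + l^-1 * b.
Proof.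
by have [-> -> _ _] := torus_LE l; have [-> _] := torus_scaling a b l l^-1 (sqrCi R).
Qed.

Lemma torus_odd_row (a b l : C) :
  (a + b) * torus_L l (inord 1) (inord 0) + 'i%C * (a - b) * torus_L l (inord 1) (inord 1)
  = 'i%C * (l * a - l^-1 * b).
Proof.
by have [_ _ -> ->] := torus_LE l; have [_ ->] := torus_scaling a b l l^-1 (sqrCi R).
Qed.

Definition weight_op (w : nat -> C) (r : nat -> C) (k : nat) : C := w k * r k.

Lemma weight_op_lin w : linear_op (weight_op w).
Proof. by move=> r s a b k _; rewrite /weight_op; ring. Qed.
Lemma weight_op_ext w : extensional_op (weight_op w).
Proof. by move=> r s rs k k8; rewrite /weight_op rs. Qed.

Lemma etilde_mx_torus4 (l : nat -> C) :
  etilde_mx R *m (torus4 l)^T = opmx (weight_op (torus_weight l)) *m etilde_mx R.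
Proof.
pose w := torus_weight l.
apply: mrow_inj => i k i8 k8.
rewrite [in RHS]etilde_mxE [RHS]mrow_opmx//; [|exact: etilde_comb_lin|exact: etilde_comb_ext].
rewrite (@etilde_comb_ext R _ (weight_op w (unit_row C i)))//; last first.
  by move=> j j8; rewrite /mrow mxE !inordK.
rewrite /mrow mxE sum_ord8 etilde_mxE.
have etE j : (j < 8)%N -> opmx (etilde_comb 'i%C) (inord i) (inord j) =
    etilde_comb 'i%C (unit_row C i) j.
  by move=> j8; rewrite mxE !inordK.
have LE j : (j < 8)%N -> ((torus4 l)^T) (inord j) (inord k) =
    if (k./2 == j./2)%N then torus_L (l k./2) (inord (odd k)) (inord (odd j)) else 0.
  move=> j8; rewrite mxE /torus4 block_diag4E//.
  by case: ifP => // _; do 8?[case: k k8 => [|k] k8 //].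
rewrite !etE// !LE//; move: (unit_row C i) => u.
do 8?[case: k k8 LE => [|k] k8 LE //].
all: rewrite /w /etilde_comb /weight_op /torus_weight /= ?mulr0 ?addr0 ?add0r.
all: by rewrite ?torus_even_row ?torus_odd_row.
Qed.

(** The eigenvalues of h(l, m, g). *)
Definition torus_char (l m g : C) : nat -> C :=
  torus_weight (nth 0 [:: l * m; l / m; l * g; l / g]).

Lemma torus_char_neq0 l m g k : l != 0 -> m != 0 -> g != 0 -> (k < 8)%N ->
  torus_char l m g k != 0.
Proof.
move=> l0 m0 g0 k8; do 8?[case: k k8 => [|k] k8 //].
all: by rewrite /torus_char /torus_weight /= ?invr_eq0 ?mulf_neq0 ?invr_eq0.
Qed.

Lemma etilde_mx_torus (l m g : C) : etilde_mx R *m (torus_A l *m torus_B m *m torus_C g)^T =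
  opmx (weight_op (torus_char l m g)) *m etilde_mx R.
Proof.
rewrite (_ : torus_A l = torus4 (fun=> l))//.
rewrite (_ : torus_B m = torus4 (nth 0 [:: m; m^-1; 1; 1])); last first.
  by rewrite /torus4 /= torus_L1.
rewrite (_ : torus_C g = torus4 (nth 0 [:: 1; 1; g; g^-1])); last first.
  by rewrite /torus4 /= torus_L1.
rewrite !trmx_mul !mulmxA etilde_mx_torus4 -(mulmxA _ (etilde_mx R)) etilde_mx_torus4.
rewrite !mulmxA -(mulmxA _ (etilde_mx R)) etilde_mx_torus4 !mulmxA; congr (_ *m _).
apply: mrow_inj => i k i8 k8.
rewrite !mrow_opmx//; try exact: weight_op_lin; try exact: weight_op_ext.
rewrite /weight_op; rewrite mrow_opmx//; try exact: weight_op_lin; try exact: weight_op_ext.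
have -> : mrow (opmx (weight_op (torus_weight (nth 0 [:: 1; 1; g; g^-1])))) i k =
    torus_weight (nth 0 [:: 1; 1; g; g^-1]) k * unit_row C i k.
  by rewrite /mrow mxE !inordK.
have -> : mrow (opmx (weight_op (torus_char l m g))) i k =
    torus_char l m g k * unit_row C i k.
  by rewrite /mrow mxE !inordK.
rewrite !mulrA; congr (_ * _).
do 8?[case: k k8 => [|k] k8 //].
all: by rewrite /torus_char /torus_weight /= ?invr1 ?invfM ?invrK ?mulr1.
Qed.

Lemma mrow_weight_op w A i k : (k < 8)%N ->
  mrow (A *m opmx (weight_op w)) i k = w k * mrow A i k.
Proof.
by move=> k8; rewrite mrow_opmx//; [exact: weight_op_lin|exact: weight_op_ext].
Qed.

(** Multiplied by 30, the eigenvalues of h(2, 3, 5) are eight distinct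
    integers. *)
Lemma torus_char_inj j k : (j < 8)%N -> (k < 8)%N ->
  torus_char 2%:R 3%:R 5%:R j = torus_char 2%:R 3%:R 5%:R k -> j = k.
Proof.
pose n := nth 0%N [:: 180; 5; 20; 45; 300; 3; 12; 75]%N.
have nE i : (i < 8)%N -> 30%:R * torus_char 2%:R 3%:R 5%:R i = (n i)%:R.
  have numE (K : numFieldType) : [/\ 30%:R * (2 * 3) = 180%:R :> K,
      30%:R * (2 * 3)^-1 = 5%:R :> K, 30%:R * (2 / 3) = 20%:R :> K &
      30%:R * (2 / 3)^-1 = 45%:R :> K] by split; field.
  have numE' (K : numFieldType) : [/\ 30%:R * (2 * 5) = 300%:R :> K,
      30%:R * (2 * 5)^-1 = 3%:R :> K, 30%:R * (2 / 5) = 12%:R :> K &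
      30%:R * (2 / 5)^-1 = 75%:R :> K] by split; field.
  have [n0 n1 n2 n3] := numE C; have [n4 n5 n6 n7] := numE' C.
  move=> i8; do 8?[case: i i8 => [|i] i8 //].
move=> j8 k8 jk; have /eqP : (n j)%:R = (n k)%:R :> C by rewrite -!nE// jk.
rewrite eqr_nat {jk}; do 8?[case: j j8 => [|j] j8 //]; do 8?[case: k k8 => [|k] k8 //].
all: by rewrite /n.
Qed.

Lemma mx_act_rows4 (h : 'M[C]_O) X :
  mx_act h <<rows4 X>>%VS = <<rows4 (X *m h^T)>>%VS.
Proof.
rewrite /mx_act limg_span; congr <<_>>%VS.
rewrite /= !lfunE /= /rows4 !row_mul //.
Qed.

Lemma label_mx_weight s w : all (ltn^~ 8) s -> size s = 4%N ->
  exists2 B : 'M[C]_4, \det B = \prod_(a < 4) w (nth 0%N s a) &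
    label_mx C s *m opmx (weight_op w) = B *m label_mx C s.
Proof.
move=> s8 s4; exists (diag_mx (\row_a w (nth 0%N s a))).
  by rewrite det_diag; apply: eq_bigr => a _; rewrite mxE.
apply: mrow_inj => a k a4 k8; rewrite mrow_weight_op// mrow_label_mx//.
rewrite /mrow mul_diag_mx !mxE !inordK// /unit_row.
by have [->|_] := eqVneq k (nth 0%N s a); rewrite ?mulr1 ?mulr0.
Qed.

Lemma label_point_fixed s c omega : all (ltn^~ 8) s -> size s = 4%N ->
  omega = c *: etilde4 R s -> torus_fixed omega.
Proof.
move=> s8 s4 oE h P [l [m [g [l0 m0 g0 hE]]]] /plucker_pointP[X [Xf PE oX]].
have hT := etilde_mx_torus l m g; rewrite -hE in hT.
have [B detB BE] := label_mx_weight (torus_char l m g) s8 s4.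
have detB0 : \det B != 0.
  rewrite detB; apply/prodf_neq0 => a _; apply: torus_char_neq0 => //.
  by apply: (allP s8); rewrite mem_nth ?s4.
have [D detD] := exists_mx_det 3 (\det B)^-1.
have Du : D \in unitmx by rewrite unitmxE detD unitfE invr_eq0.
have plE : pluck (D *m (X *m h^T)) = omega.
  rewrite pluck_mull detD pluck_mulr -oX oE etilde4_label_mx// -scalemxAl -pluck_mulr.
  rewrite -mulmxA hT mulmxA BE -mulmxA pluck_mull !scalerA.
  by congr (_ *: _); rewrite mulrAC mulVf// mul1r.
apply/plucker_pointP; exists (D *m (X *m h^T)); split.
- by rewrite -pluck_neq0 plE oX pluck_neq0.
- by rewrite PE mx_act_rows4 span_rows4_mull.
- by rewrite plE.
Qed.

(** Let [k] index a nonzero minor. Exchanging one column for a column outside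
    of [k] changes the weight of a minor by the quotient of two distinct
    eigenvalues, so that the exchanged minors vanish; these are the
    entries, outside of the columns [k], of the reduced matrix. *)
Lemma fixed_point_label omega : cayley_grassmannian R omega -> torus_fixed omega ->
  exists2 s, s \in fixed_labels & exists2 c : C, c != 0 & omega = c *: etilde4 R s.
Proof.
move=> /(cayley_grassmannian_frameP _ (cayley_frame_etilde R))[A [Af EA oE]] fix_o.
have [Eu _] := cayley_frame_etilde R.
pose h := torus_A (2%:R : C) *m torus_B 3%:R *m torus_C 5%:R.
pose w := torus_char (2%:R : C) 3%:R 5%:R.
have nz n : n.+1%:R != 0 :> C by rewrite pnatr_eq0.
have th : torus h by exists 2%:R, 3%:R, 5%:R; split; [exact: nz|exact: nz|exact: nz|].
have hT : etilde_mx R *m h^T = opmx (weight_op w) *m etilde_mx R := etilde_mx_torus _ _ _.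
have Xf : row_free (A *m etilde_mx R) by rewrite row_free_mulmx.
have /plucker_pointP[X' [Xf' PX' oX']] : plucker_point (mx_act h <<rows4 (A *m etilde_mx R)>>%VS) omega.
  by apply: fix_o => //; apply/plucker_pointP; exists (A *m etilde_mx R).
have [|B X'E] := @span_rows4_sub R (A *m opmx (weight_op w) *m etilde_mx R) X'.
  by rewrite -mulmxA -hT mulmxA -mx_act_rows4 -PX'.
(* The torus multiplies each minor by a product of eigenvalues, and the
   plane is fixed, so that the minors are multiplied by a common factor. *)
have minorE (f : 'I_4 -> 'I_O) : \det (colsub f A) =
    \det B * ((\prod_a w (f a)) * \det (colsub f A)).
  have := congr1 (fun v : 'rV_70 => (v *m dual_pluck (colsub f (invmx (etilde_mx R)))) 0 0) oX'.
  rewrite /= oE X'E -!det_mulmx_pluck -!colsub_mulmx (mulmxK Eu) !mulmxA (mulmxK Eu).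
  rewrite -mulmxA colsub_mulmx det_mulmx => detE; rewrite [LHS]detE; congr (_ * _).
  have -> : colsub f (A *m opmx (weight_op w)) = colsub f A *m diag_mx (\row_a w (f a)).
    apply/matrixP => i a; rewrite mul_mx_diag [RHS]mxE [LHS]mxE.
    rewrite [X in _ = X * _]mxE [X in _ = _ * X]mxE mulrC.
    have := @mrow_weight_op w A i (f a) (ltn_ord _).
    by rewrite /mrow !inord_val.
  rewrite det_mulmx mulrC det_diag; congr (_ * _).
  by apply: eq_bigr => a _; rewrite mxE.
have [k Ak] : exists k, \det (colsub (pidx k) A) != 0.
  have A0 : pluck A != 0 by rewrite pluck_neq0.
  apply/existsP; apply: contraR A0; rewrite negb_exists => /forallP A0.
  by apply/eqP/rowP => k; rewrite !mxE; have /negPn/eqP := A0 k.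
have Au : colsub (pidx k) A \in unitmx by rewrite unitmxE unitfE.
pose s := nth [::] plucker_index k.
have s_mem : s \in plucker_index by rewrite mem_nth// size_plucker_index.
have [s8 s4] := plucker_index_label s_mem.
have BA : invmx (colsub (pidx k) A) *m A = label_mx C s.
  apply/matrixP => a j.
  have skE (b : 'I_4) : nth 0%N s b = pidx k b.
    by rewrite /pidx inordK//; apply: (allP s8); rewrite mem_nth ?s4.
  have -> : label_mx C s a j = (j == pidx k a)%:R by rewrite mxE /unit_row skE.
  have [[b ->]|nj] := pselect (exists b, j = pidx k b).
    have := congr1 (fun M : 'M_4 => M a b) (mulVmx Au).
    rewrite -colsub_mulmx mxE => ->.
    by rewrite mxE (inj_eq (@pidx_inj k)) eq_sym.
  have -> : (j == pidx k a) = false.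
    by apply/negP => /eqP ja; apply: nj; exists a.
  have ex0 : \det (colsub (exchange (pidx k) a j) A) = 0.
    pose z := \prod_(b < 4 | b != a) w (pidx k b).
    have pk : \prod_b w (pidx k b) = w (pidx k a) * z by rewrite (bigD1 a).
    have pe : \prod_b w (exchange (pidx k) a j b) = w j * z.
      rewrite (bigD1 a)//= /exchange eqxx; congr (_ * _).
      by apply: eq_bigr => b /negbTE ->.
    have e1 : \det B * (w (pidx k a) * z) = 1.
      have := minorE (pidx k); rewrite pk mulrA -{1}[\det _]mul1r.
      by move=> /(mulIf Ak) <-.
    have := minorE (exchange (pidx k) a j); rewrite pe; set d := \det (colsub _ _).
    move=> dE; apply: contrapT => /eqP d0; apply: nj; exists a.
    have e2 : \det B * (w j * z) = 1.
      by move: dE; rewrite mulrA -{1}[d]mul1r => /(mulIf d0) <-.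
    have Bz : \det B * z != 0.
      by apply/eqP => Bz; move/eqP: e1; rewrite mulrCA Bz mulr0 eq_sym oner_eq0.
    apply/val_inj/(torus_char_inj (ltn_ord _) (ltn_ord _)); apply: (mulIf Bz).
    by rewrite mulrCA e2 mulrCA e1.
  by rewrite /invmx Au -scalemxAl [LHS]mxE -det_colsub_exchange ex0 mulr0.
have o_label : omega = \det (colsub (pidx k) A) *: etilde4 R s.
  rewrite etilde4_label_mx// -BA -mulmxA pluck_mull det_inv oE scalerA mulfV// ?scale1r//.
exists s.
  apply: cayley_label_fixed => //; apply/(cayley_labelP C) => m m7.
  by rewrite -BA cform_mull EA// mulr0.
by exists (\det (colsub (pidx k) A)).
Qed.

End TorusAction.

(** * The cell of a singular point *)

Section SingularCell.
Variable K : comNzRingType.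
Implicit Types x y : nat -> K.

(** The cell of e~_0246: the columns 0, 2, 4, 6 form the identity, and the
    variable [x (4 * a + b)] is the entry of row [a] in column [2 * b + 1]. *)
Definition scell_row x (a : nat) : nat -> K := fun k => nth 0
  (nth [::] [:: [:: 1; x 0%N; 0; x 1%N; 0; x 2%N; 0; x 3%N];
                [:: 0; x 4%N; 1; x 5%N; 0; x 6%N; 0; x 7%N];
                [:: 0; x 8%N; 0; x 9%N; 1; x 10%N; 0; x 11%N];
                [:: 0; x 12%N; 0; x 13%N; 0; x 14%N; 1; x 15%N]] a) k.

Definition scell_mx x : 'M[K]_(4, O) := \matrix_(a, j) scell_row x a j.

Lemma mrow_scell_mx x a k : (a < 4)%N -> (k < 8)%N ->
  mrow (scell_mx x) a k = scell_row x a k.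
Proof. by move=> a4 k8; rewrite /mrow mxE !inordK. Qed.

Lemma cform_scell_mx x m : cform (scell_mx x) m =
  cayley_form (scell_row x 0%N) (scell_row x 1%N) (scell_row x 2%N) (scell_row x 3%N) m.
Proof. by apply: eq_cayley_form => k k8; exact: mrow_scell_mx. Qed.

Lemma colsub_scell_mx x : colsub (cols4 0 2 4 6) (scell_mx x) = 1%:M.
Proof.
apply/matrixP => i j; rewrite !mxE -val_eqE /=; case: i => i /= i4; case: j => j /= j4.
rewrite inordK; last by do 4?[case: j j4 => [|j] j4 //].
by do 4?[case: i i4 => [|i] i4 //]; do 4?[case: j j4 => [|j] j4 //].
Qed.

Definition scell_coord (A : 'M[K]_(4, O)) (j : nat) : K :=
  mrow A (j %/ 4) (j %% 4).*2.+1.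

Lemma scell_mx_unique (A : 'M[K]_(4, O)) :
  colsub (cols4 0 2 4 6) A = 1%:M -> A = scell_mx (scell_coord A).
Proof.
move=> A1.
have A1E i k : (i < 4)%N -> (k < 4)%N -> mrow A i k.*2 = (i == k)%:R.
  move=> i4 k4; have := congr1 (fun M : 'M_4 => M (inord i) (inord k)) A1.
  rewrite mxE [in RHS]mxE /cols4 -val_eqE /= !inordK// => <-.
  by do 4?[case: k k4 => [|k] k4 //].
apply: mrow_inj => i k i4 k8; rewrite mrow_scell_mx//.
have A1' := (A1E i 0%N i4, A1E i 1%N i4, A1E i 2%N i4, A1E i 3%N i4).
rewrite /= in A1'.
by do 8?[case: k k8 => [|k] k8 //]; do 4?[case: i i4 A1' => [|i] i4 A1' //]; rewrite ?A1'.
Qed.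

Lemma eq_scell_mx x y : (forall j, (j < 16)%N -> x j = y j) -> scell_mx x = scell_mx y.
Proof.
by move=> xy; apply/matrixP => i j; rewrite !mxE /scell_row !xy.
Qed.

(** The equations on the cell, expanded. Only the second has a linear
    part, and it is linear; together with the first it carries the bound for
    the dimension. *)
Definition singular_form x (m : nat) : K := nth 0 [::
     - x 0%N*x 5%N + x 1%N*x 4%N + x 10%N*x 15%N - x 11%N*x 14%N;
     - x 1%N + x 4%N + x 11%N - x 14%N;
     - x 0%N*x 5%N*x 11%N + x 0%N*x 5%N*x 14%N - x 0%N*x 6%N*x 13%N + x 0%N*x 7%N*x 9%N
       + x 1%N*x 4%N*x 11%N - x 1%N*x 4%N*x 14%N + x 1%N*x 6%N*x 12%N - x 1%N*x 7%N*x 8%N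
       + x 1%N*x 10%N*x 15%N - x 1%N*x 11%N*x 14%N + x 2%N*x 4%N*x 13%N - x 2%N*x 5%N*x 12%N
       - x 2%N*x 9%N*x 15%N + x 2%N*x 11%N*x 13%N - x 3%N*x 4%N*x 9%N + x 3%N*x 5%N*x 8%N
       + x 3%N*x 9%N*x 14%N - x 3%N*x 10%N*x 13%N - x 4%N*x 10%N*x 15%N + x 4%N*x 11%N*x 14%N
       + x 6%N*x 8%N*x 15%N - x 6%N*x 11%N*x 12%N - x 7%N*x 8%N*x 14%N + x 7%N*x 10%N*x 12%N;
     x 0%N*x 7%N + x 0%N*x 13%N - x 1%N*x 12%N - x 2%N*x 15%N - x 3%N*x 4%N + x 3%N*x 14%N
       - x 8%N*x 15%N + x 11%N*x 12%N;
     - x 1%N*x 6%N + x 2%N*x 5%N - x 4%N*x 9%N + x 5%N*x 8%N + x 6%N*x 11%N - x 7%N*x 10%N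
       + x 9%N*x 14%N - x 10%N*x 13%N;
     - x 0%N*x 6%N - x 0%N*x 9%N + x 1%N*x 8%N + x 2%N*x 4%N + x 2%N*x 11%N - x 3%N*x 10%N
       + x 8%N*x 14%N - x 10%N*x 12%N;
     - x 1%N*x 7%N + x 3%N*x 5%N - x 4%N*x 13%N + x 5%N*x 12%N + x 6%N*x 15%N - x 7%N*x 14%N
       + x 9%N*x 15%N - x 11%N*x 13%N] m.

Lemma cform_scell_mxE x m : cform (scell_mx x) m = singular_form x m.
Proof.
rewrite cform_scell_mx; do 7?[case: m => [|m]]; last by case: m.
all: cbv [cayley_form minor4 minor3 minor2 scell_row singular_form nth]; ring.
Qed.

Lemma singular_equations x : cayley_eqs (scell_mx x) ->
  x 1%N = x 4%N + x 11%N - x 14%N /\ x 10%N * x 15%N = x 0%N * x 5%N - x 1%N * x 4%N + x 11%N * x 14%N.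
Proof.
move=> Ex; have := Ex 0%N isT; have := Ex 1%N isT; rewrite !cform_scell_mxE /singular_form /= => E1 E0.
split; apply/eqP; rewrite -subr_eq0; apply/eqP.
  transitivity (- (- x 1%N + x 4%N + x 11%N - x 14%N)); first by ring.
  by rewrite E1 oppr0.
by rewrite -[RHS]E0; ring.
Qed.

(** For each coordinate but 14, a line through the origin inside X: the
    coordinate axis, except that the directions 1, 4 and 11 need a second
    coordinate to satisfy the linear equation. *)
Definition singular_direction (i : 'I_15) (j : nat) : K :=
  (bump 14 i == j)%:R - ((i == 1%N :> nat) && (j == 14%N))%:R
  + ((i == 4%N :> nat) && (j == 14%N))%:R + ((i == 11%N :> nat) && (j == 1%N))%:R.

Lemma singular_direction_eqs (i : 'I_15) (t : K) :
  cayley_eqs (scell_mx (fun j => t * singular_direction i j)).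
Proof.
move=> m m7; rewrite cform_scell_mxE; case: i => i i15.
do 15?[case: i i15 => [|i] i15 //]; do 7?[case: m m7 => [|m] m7 //].
all: rewrite /singular_form /singular_direction /=; ring.
Qed.

Lemma singular_direction_free (e : 'I_15 -> K) :
  (forall j, (j < 16)%N -> \sum_i e i * singular_direction i j = 0) ->
  forall i, e i = 0.
Proof.
move=> esum; pose E n := e (inord n).
have sumE j : \sum_i e i * singular_direction i j =
    \sum_(0 <= n < 15) E n * singular_direction (inord n) j.
  by rewrite big_mkord; apply: eq_bigr => i _; rewrite /E inord_val.
have dirE n j : (n < 15)%N -> singular_direction (inord n) j =
    (bump 14 n == j)%:R - ((n == 1%N) && (j == 14%N))%:R
    + ((n == 4%N) && (j == 14%N))%:R + ((n == 11%N) && (j == 1%N))%:R.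
  by move=> n15; rewrite /singular_direction inordK.
have Ej j : (j < 16)%N -> nth 0 [:: E 0%N; E 1%N + E 11%N; E 2%N; E 3%N; E 4%N; E 5%N; E 6%N; E 7%N;
    E 8%N; E 9%N; E 10%N; E 11%N; E 12%N; E 13%N; - E 1%N + E 4%N; E 14%N] j = 0.
  move=> j16; rewrite -(esum j j16) sumE unlock /= !dirE//.
  by do 16?[case: j j16 => [|j] j16 //]; rewrite /=; ring.
have E11 := Ej 11%N isT; rewrite /= in E11.
have E1 := Ej 1%N isT; rewrite /= E11 addr0 in E1.
move=> i; have -> : e i = E i by rewrite /E inord_val.
case: i => i i15 /=.
do 15?[case: i i15 => [|i] i15 //].
- exact: (Ej 0%N).
- exact: (Ej 2%N).
- exact: (Ej 3%N).
- exact: (Ej 4%N).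
- exact: (Ej 5%N).
- exact: (Ej 6%N).
- exact: (Ej 7%N).
- exact: (Ej 8%N).
- exact: (Ej 9%N).
- exact: (Ej 10%N).
- exact: (Ej 12%N).
- exact: (Ej 13%N).
- exact: (Ej 15%N).
Qed.

(** The coordinates 1 and 10 eliminated by [singular_equations], the second
    after multiplying the row 2, in which it occurs, by the coordinate 15. *)
Definition drop_1_10 x (a : nat) : nat -> K := fun k => nth 0
  (nth [::] [:: [:: 1; x 0%N; 0; x 4%N + x 11%N - x 14%N; 0; x 2%N; 0; x 3%N];
                [:: 0; x 4%N; 1; x 5%N; 0; x 6%N; 0; x 7%N];
                [:: 0; x 15%N * x 8%N; 0; x 15%N * x 9%N; x 15%N;
                    x 0%N * x 5%N - (x 4%N + x 11%N - x 14%N) * x 4%N + x 11%N * x 14%N;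
                    0; x 15%N * x 11%N];
                [:: 0; x 12%N; 0; x 13%N; 0; x 14%N; 1; x 15%N]] a) k.

(** The coordinate 1 eliminated, where the coordinate 15 is zero. *)
Definition drop_1_15 x (a : nat) : nat -> K := fun k => nth 0
  (nth [::] [:: [:: 1; x 0%N; 0; x 4%N + x 11%N - x 14%N; 0; x 2%N; 0; x 3%N];
                [:: 0; x 4%N; 1; x 5%N; 0; x 6%N; 0; x 7%N];
                [:: 0; x 8%N; 0; x 9%N; 1; x 10%N; 0; x 11%N];
                [:: 0; x 12%N; 0; x 13%N; 0; x 14%N; 1; 0]] a) k.

End SingularCell.

(** * The tangent space at a singular point *)

Section SingularMaps.
Variables (K L : comNzRingType) (f : {rmorphism K -> L}).

Lemma map_scell_mx (x : nat -> K) : map_mx f (scell_mx x) = scell_mx (f \o x).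
Proof.
apply/matrixP => i j; rewrite !mxE; case: i => i /= i4; case: j => j /= j8.
do 4?[case: i i4 => [|i] i4 //]; do 8?[case: j j8 => [|j] j8 //].
all: by rewrite /scell_row /= ?(rmorph0, rmorph1).
Qed.

Lemma rmorph_drop_1_10 (x : nat -> K) a k : f (drop_1_10 x a k) = drop_1_10 (f \o x) a k.
Proof.
rewrite /drop_1_10; case: a => [|[|[|[|[|a]]]]]; do 9?[case: k => [|k]]; rewrite /=.
all: by do ?[rewrite (rmorph0, rmorph1, rmorphD, rmorphN, rmorphM)].
Qed.

Lemma rmorph_drop_1_15 (x : nat -> K) a k : f (drop_1_15 x a k) = drop_1_15 (f \o x) a k.
Proof.
rewrite /drop_1_15; case: a => [|[|[|[|[|a]]]]]; do 9?[case: k => [|k]]; rewrite /=.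
all: by do ?[rewrite (rmorph0, rmorph1, rmorphD, rmorphN, rmorphM)].
Qed.
End SingularMaps.

Section SingularFrame.
Variable R : realType.
Local Notation C := R[i].
Variable W : 'M[C]_O.
Hypothesis frameW : cayley_frame W.
Let Wu : W \in unitmx. Proof. by case: frameW. Qed.
Let If := cols4 0 2 4 6.
Local Notation Z := (cayley_grassmannian R).

(** The Pluecker coordinates with respect to the frame [W], as linear forms on
    Pluecker vectors in the standard basis. *)
Definition minor_form (f : 'I_4 -> 'I_O) : 'cV[C]_70 := dual_pluck (colsub f (invmx W)).

Lemma minor_formE f A : (pluck (A *m W) *m minor_form f) 0 0 = \det (colsub f A).
Proof. by rewrite -det_mulmx_pluck -colsub_mulmx mulmxK. Qed.

(** The entries of a matrix with identity columns 0, 2, 4, 6 are the minors with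
    one column exchanged. *)
Definition entry_form (j : nat) : 'cV[C]_70 :=
  minor_form (exchange If (inord (j %/ 4)) (inord (j %% 4).*2.+1)).

Lemma entry_formE A j : colsub If A = 1%:M ->
  (pluck (A *m W) *m entry_form j) 0 0 = scell_coord A j.
Proof.
move=> A1; rewrite minor_formE det_colsub_exchange A1.
have -> : \adj (1%:M : 'M[C]_4) = 1%:M by rewrite -[LHS]mul1mx mul_mx_adj det1.
by rewrite mul1mx.
Qed.

Lemma scell_coordK (x : nat -> C) j : (j < 16)%N -> scell_coord (scell_mx x) j = x j.
Proof.
move=> j16; rewrite /scell_coord mrow_scell_mx ?ltn_divLR//; last first.
  by rewrite -doubleS (leq_double _ 4) ltn_mod.
by do 16?[case: j j16 => [|j] j16 //].
Qed.

Lemma entry_form_scell (x : nat -> C) j : (j < 16)%N ->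
  (pluck (scell_mx x *m W) *m entry_form j) 0 0 = x j.
Proof. by move=> j16; rewrite entry_formE ?colsub_scell_mx// scell_coordK. Qed.

Lemma minor_form_scell (x : nat -> C) :
  (pluck (scell_mx x *m W) *m minor_form If) 0 0 = 1.
Proof. by rewrite minor_formE colsub_scell_mx det1. Qed.

Lemma scell_point x : Z x -> (x *m minor_form If) 0 0 = 1 ->
  exists2 xc, cayley_eqs (scell_mx xc) & x = pluck (scell_mx xc *m W).
Proof.
move=> /(cayley_grassmannian_frameP _ frameW)[A [Af EA ->]]; rewrite minor_formE => detA.
have [B BA detB] := unit_minor_frame detA.
have EBA : cayley_eqs (B *m A) by move=> m m7; rewrite cform_mull EA ?mulr0.
exists (scell_coord (B *m A)); rewrite -scell_mx_unique//.
by rewrite -mulmxA pluck_mull detB scale1r.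
Qed.

Variable c : C.
Hypothesis c0 : c != 0.
Let p := c *: pluck (scell_mx (fun=> 0) *m W).

Lemma singular_point_in : Z p.
Proof.
apply: cayley_grassmannianZ => //; apply/(cayley_grassmannian_frameP _ frameW).
exists (scell_mx (fun=> 0)); split; last reflexivity.
  by apply: (@row_free_colsub_unit _ If); rewrite colsub_scell_mx unitmx1.
move=> m m7; rewrite cform_scell_mxE /singular_form.
by do 7?[case: m m7 => [|m] m7 //]; rewrite /=; ring.
Qed.

Section Directions.
Variable i : 'I_15.
Let dir (j : nat) : C := singular_direction C i j.

(** The line of direction [dir], lifted to the cone of Pluecker vectors. *)
Definition singular_curve (k : 'I_70) : {poly C} := c *:
  \det (colsub (pidx k) (scell_mx (fun j => dir j *: 'X) *m map_mx polyC W)).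

Lemma horner_singular_curve t : \row_k (singular_curve k).[t] =
  c *: pluck (scell_mx (fun j => t * dir j) *m W).
Proof.
apply/rowP => k; rewrite !mxE hornerZ; congr (_ * _).
rewrite -horner_evalE -det_map_mx map_mxsub map_mxM map_scell_mx.
congr (\det (colsub _ (_ *m _))).
  by apply: eq_scell_mx => j _; rewrite /= ?horner_evalE hornerZ hornerX mulrC.
by apply/matrixP => a b; rewrite !mxE ?horner_evalE /= ?horner_evalE hornerC.
Qed.

Definition singular_tangent : 'rV[C]_70 := \row_k (singular_curve k)^`().[0].

Lemma singular_tangentP : cone_tangent Z p singular_tangent.
Proof.
have -> : p = \row_k (singular_curve k).[0].
  rewrite horner_singular_curve; congr (_ *: pluck (_ *m _)).
  by apply: eq_scell_mx => j _; rewrite mul0r.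
apply: (@cone_tangent_curve R 70 singular_curve Z 1); first exact: oner_neq0.
move=> t _; rewrite horner_singular_curve; apply: cayley_grassmannianZ => //.
apply/(cayley_grassmannian_frameP _ frameW).
exists (scell_mx (fun j => t * dir j)); split; last reflexivity.
  by apply: (@row_free_colsub_unit _ If); rewrite colsub_scell_mx unitmx1.
exact: singular_direction_eqs.
Qed.

Lemma singular_tangent_entry j : (j < 16)%N ->
  (singular_tangent *m entry_form j) 0 0 = c * dir j.
Proof.
move=> j16; rewrite (@deriv_linear_functional _ _ _ _ ((c * dir j) *: 'X)) => [|t].
  by rewrite derivZ derivX hornerZ hornerC mulr1.
rewrite horner_singular_curve -scalemxAl mxE entry_form_scell// hornerZ hornerX.
by rewrite mulrA mulrAC.
Qed.

Lemma singular_tangent_l0 : (singular_tangent *m minor_form If) 0 0 = 0.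
Proof.
rewrite (@deriv_linear_functional _ _ _ _ c%:P) => [|t].
  by rewrite derivC horner0.
by rewrite horner_singular_curve -scalemxAl mxE minor_form_scell mulr1 hornerC.
Qed.

End Directions.

(** The point itself and the fifteen velocities are independent: the linear form
    of the cell separates the point from the velocities, and the entries
    separate the velocities. *)
Lemma singular_tangent_dim d : tangent_dim Z p d -> (15 <= d)%N.
Proof.
move=> [U UE dimU]; rewrite -ltnS -dimU.
pose T := [tuple of p :: [tuple singular_tangent i | i < 15]].
have Tl (i : 'I_15) : T`_(lift ord0 i) = singular_tangent i.
  by rewrite /= -(tnth_nth 0 [tuple singular_tangent j | j < 15]) tnth_mktuple.
have freeT : free T.
  apply/freeP => e; rewrite big_ord_recl.
  rewrite (eq_bigr (fun i => e (lift ord0 i) *: singular_tangent i)) => [|i _].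
    2: by rewrite Tl.
  rewrite -[T`_ord0]/p => eT.
  have pl0 : (p *m minor_form If) 0 0 = c by rewrite -scalemxAl mxE minor_form_scell mulr1.
  have e0 : e ord0 = 0.
    have := congr1 (fun v : 'rV_70 => (v *m minor_form If) 0 0) eT.
    rewrite mul0mx [RHS]mxE mulmxDl mulmx_suml mxE summxE -scalemxAl.
    rewrite [X in _ + X]big1 => [|i _]; last first.
      by rewrite -scalemxAl mxE singular_tangent_l0 mulr0.
    by rewrite mxE pl0 addr0 => /eqP; rewrite mulf_eq0 (negbTE c0) orbF => /eqP.
  have eS : forall i, e (lift ord0 i) = 0.
    apply: singular_direction_free => j j16; apply: (mulfI c0); rewrite mulr0.
    have := congr1 (fun v : 'rV_70 => (v *m entry_form j) 0 0) eT.
    rewrite e0 scale0r add0r mul0mx [RHS]mxE mulmx_suml summxE => eTj.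
    rewrite -[RHS]eTj mulr_sumr; apply: eq_bigr => i _.
    by rewrite -scalemxAl mxE singular_tangent_entry// mulrCA.
  by move=> i; case: (unliftP ord0 i) => [k|] ->.
have dimT : \dim <<T>> = 16%N by rewrite (eqP freeT) size_tuple.
apply: (@leq_trans (\dim <<T>>)); first by rewrite dimT.
apply: dimvS.
apply/span_subvP => v; rewrite inE => /orP[/eqP ->|/mapP[i _ ->]]; apply/UE.
  apply: cone_tangent_self; [exact: cayley_grassmannian_closed|exact: singular_point_in].
exact: singular_tangentP.
Qed.

(** Specializes [chain_length_leq] to the cell: [P] expresses, up to the
    factor [D] and a change of basis [B], the matrix of a point through
    fourteen of its entries. *)
Lemma singular_chain_aux k (Ws : nat -> set 'rV[C]_70) (q : 'rV[C]_70) (idx : 'I_14 -> nat)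
    (P : 'M[{mpoly C[14]}]_(4, O)) (D : {mpoly C[14]}) :
  (forall i, (i <= k)%N -> [/\ irreducible_closed (Ws i), Ws i p & Ws i `<=` Z]) ->
  (forall i, (i < k)%N -> Ws i `<` Ws i.+1) ->
  Ws k q -> (q *m minor_form If) 0 0 = 1 ->
  D.@[fun i => (q *m entry_form (idx i)) 0 0] != 0 ->
  (forall i, (idx i < 16)%N) ->
  (forall xc, cayley_eqs (scell_mx xc) -> Ws k (pluck (scell_mx xc *m W)) ->
     exists2 B : 'M[C]_4, \det B = D.@[xc \o idx] &
       map_mx (meval (xc \o idx)) P = B *m scell_mx xc) ->
  (k <= 14)%N.
Proof.
move=> Wirr Wlt Wq q1 Dq idx16 PE.
pose l : 'M[C]_(70, 14) := \matrix_(m, i) entry_form (idx i) m 0.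
have lE (x : 'rV[C]_70) i : (x *m l) 0 i = (x *m entry_form (idx i)) 0 0.
  by rewrite !mxE; apply: eq_bigr => m _; rewrite [X in _ * X = _]mxE.
pose N := [tuple \det (colsub (pidx m) (P *m map_mx (@mpolyC 14 C) W)) | m < 70].
apply: (@chain_length_leq R 70 14 k Ws p q (minor_form If) l D N) => //.
- by move=> i /Wirr[].
- by move=> i /Wirr[].
- by rewrite -scalemxAl mxE minor_form_scell mulr1.
- by rewrite (meval_eq _ (lE q)).
move=> x Wx x1 m; have [_ _ /(_ x Wx) Zx] := Wirr k (leqnn k).
have [xc Exc xE] := scell_point Zx x1.
have xlE i : (x *m l) 0 i = (xc \o idx) i.
  by rewrite lE xE entry_form_scell.
have [|B detB BE] := PE xc Exc; first by rewrite -xE.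
rewrite !(meval_eq _ xlE) tnth_mktuple -det_map_mx map_mxsub map_mxM BE.
have -> : map_mx (meval (xc \o idx)) (map_mx (@mpolyC 14 C) W) = W.
  by apply/matrixP => a b; rewrite mxE /= mxE; exact: mevalC.
rewrite -detB -mulmxA colsub_mulmx det_mulmx; congr (_ * _).
by rewrite xE mxE.
Qed.

End SingularFrame.

(** * The dimension at a singular point *)

Section SingularChains.
Variable R : realType.
Local Notation C := R[i].
Variable W : 'M[C]_O.
Hypothesis frameW : cayley_frame W.
Let If := cols4 0 2 4 6.
Local Notation Z := (cayley_grassmannian R).
Variable c : C.
Hypothesis c0 : c != 0.
Let p := c *: pluck (scell_mx (fun=> 0) *m W).

Lemma eq_drop_1_10 (K : comNzRingType) (x y : nat -> K) :
  (forall j, (j < 16)%N -> j \notin [:: 1; 10]%N -> x j = y j) ->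
  forall a k, drop_1_10 x a k = drop_1_10 y a k.
Proof. by move=> xy a k; rewrite /drop_1_10 !xy. Qed.

Lemma eq_drop_1_15 (K : comNzRingType) (x y : nat -> K) :
  (forall j, (j < 16)%N -> j \notin [:: 1; 15]%N -> x j = y j) ->
  forall a k, drop_1_15 x a k = drop_1_15 y a k.
Proof. by move=> xy a k; rewrite /drop_1_15 !xy. Qed.

(** The two cases of the bound drop, besides the coordinate 1, the coordinate
    [j0], which is 10 or 15. *)
Definition free_coords (j0 : nat) (i : 'I_14) : nat :=
  nth 0%N [seq j <- iota 0 16 | j \notin [:: 1; j0]%N] i.

Definition coord_var (j0 j : nat) : {mpoly C[14]} :=
  'X_(inord (index j [seq j <- iota 0 16 | j \notin [:: 1; j0]%N])).

Lemma coord_varE j0 (x : nat -> C) j : j0 \in [:: 10; 15]%N -> (j < 16)%N ->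
  j \notin [:: 1; j0]%N -> (coord_var j0 j).@[x \o free_coords j0] = x j.
Proof.
set L := [seq i <- iota 0 16 | i \notin [:: 1; j0]%N] => j0E j16 jN.
have jL : j \in L by rewrite mem_filter jN mem_iota.
have L14 : size L = 14%N by move: j0E; rewrite /L !inE => /orP[]/eqP->.
rewrite /coord_var -/L mevalXU /free_coords -/L; congr (x _).
by rewrite inordK ?nth_index// -L14 index_mem.
Qed.

Lemma free_coords_lt j0 i : j0 \in [:: 10; 15]%N -> (free_coords j0 i < 16)%N.
Proof.
by case: i => i /= i14; rewrite !inE /free_coords => /orP[]/eqP->; do 14?[case: i i14 => [|i] i14 //].
Qed.

(** If the coordinate 15 does not vanish on the part of the largest member of
    the chain in the cell, the coordinate 10 is a quotient with that
    denominator; if it does vanish there, it is the one to be dropped. In both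
    cases fourteen coordinates remain. *)
Lemma singular_chain_leq k : irreducible_chain Z p k -> (k <= 14)%N.
Proof.
move=> [Ws [Wirr Wlt]].
case: (pselect (exists2 q, Ws k q /\ (q *m minor_form W If) 0 0 = 1 &
                           (q *m entry_form W 15) 0 0 != 0)) => [[q [Wq q1] q15]|no].
  apply: (@singular_chain_aux R W frameW c c0 k Ws q (free_coords 10)
    (\matrix_(a, j) drop_1_10 (coord_var 10) a j) 'X_(inord 13) Wirr Wlt Wq q1).
  - by rewrite mevalXU /free_coords inordK.
  - by move=> i; exact: free_coords_lt.
  move=> x Ex _; have [x1 x45] := singular_equations Ex.
  exists (diag_mx (\row_i if i == 2 :> nat then x 15%N else 1)).
    rewrite det_diag mevalXU /free_coords /= inordK//=.
    by rewrite !big_ord_recl big_ord0 !mxE /= !mul1r mulr1.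
  apply/matrixP => a j; rewrite mul_diag_mx !mxE rmorph_drop_1_10.
  rewrite (@eq_drop_1_10 _ _ x); last by move=> i i16 iN; exact: coord_varE.
  case: a => a /= a4; case: j => j /= j8; rewrite /drop_1_10 /scell_row.
  do 4?[case: a a4 => [|a] a4 //]; do 8?[case: j j8 => [|j] j8 //]; rewrite /= ?mul1r ?mulr1 ?mulr0//.
  by rewrite [RHS]mulrC x45 x1.
have [Wcl Wp _] : [/\ zariski_closed (Ws k), Ws k p & True].
  by have [[? _ _] ? _] := Wirr k (leqnn k).
apply: (@singular_chain_aux R W frameW c c0 k Ws (c^-1 *: p) (free_coords 15)
    (\matrix_(a, j) drop_1_15 (coord_var 15) a j) 1 Wirr Wlt).
- exact: (zariski_closedZ Wcl (invr_neq0 c0) Wp).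
- by rewrite /p scalerA mulVf// scale1r minor_form_scell.
- by rewrite meval1 oner_neq0.
- by move=> i; exact: free_coords_lt.
move=> x Ex Wx; have [x1 x45] := singular_equations Ex.
have x15 : x 15%N = 0.
  apply/eqP/negPn/negP => x15; apply: no; exists (pluck (scell_mx x *m W)).
    by split=> //; exact: minor_form_scell.
  by rewrite entry_form_scell.
exists 1%:M; first by rewrite det1 meval1.
apply/matrixP => a j; rewrite mul1mx !mxE rmorph_drop_1_15.
rewrite (@eq_drop_1_15 _ _ x); last by move=> i i16 iN; exact: coord_varE.
case: a => a /= a4; case: j => j /= j8; rewrite /drop_1_15 /scell_row.
by do 4?[case: a a4 => [|a] a4 //]; do 8?[case: j j8 => [|j] j8 //]; rewrite /= ?x1 ?x15.
Qed.

Lemma singular_point_not_smooth : ~ smooth_point Z p.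
Proof.
move=> [_ [d [chain_d _] tangent_d]].
have := leq_trans (singular_tangent_dim frameW c0 tangent_d) (singular_chain_leq chain_d).
by [].
Qed.
End SingularChains.

(** * The singular fixed points *)

Section Labels.
Variable K : fieldType.

(** The 0-1 matrix that expresses the coordinate vectors of [s] through those of
    [t]; for reorderings its determinant is a sign. *)
Definition label_change (s t : seq nat) : 'M[K]_4 :=
  \matrix_(a, b) (nth 0%N t b == nth 0%N s a)%:R.

Lemma label_mx_change s t : size s = 4%N -> size t = 4%N -> uniq t -> {subset s <= t} ->
  label_mx K s = label_change s t *m label_mx K t.
Proof.
move=> s4 t4 ut st; apply/matrixP => a k; rewrite !mxE.
have sat : nth 0%N s a \in t by apply: st; rewrite mem_nth ?s4.
have it4 : (index (nth 0%N s a) t < 4)%N by have := index_mem (nth 0%N s a) t; rewrite sat t4.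
rewrite (bigD1 (Ordinal it4))//= !mxE /= nth_index// eqxx mul1r big1 ?addr0// => b bN.
rewrite mxE; case: eqP => [tb|_]; last by rewrite mul0r.
case/eqP: bN; apply/val_inj; rewrite /= -tb index_uniq ?t4//.
Qed.

Lemma row_free_label_mx s : size s = 4%N -> uniq s -> all (ltn^~ 8) s ->
  row_free (label_mx K s).
Proof.
move=> s4 us s8; apply/row_freeP; exists (label_mx K s)^T; apply/matrixP => a b.
have sa8 : (nth 0%N s a < 8)%N by apply: (allP s8); rewrite mem_nth ?s4.
rewrite !mxE (bigD1 (Ordinal sa8))//= !mxE /unit_row /= eqxx mul1r.
rewrite nth_uniq ?s4// big1 ?addr0// => k kN; rewrite !mxE /unit_row.
by move: kN; rewrite -val_eqE /= => /negbTE ->; rewrite mul0r.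
Qed.
End Labels.

Section SingularLabels.
Variable R : realType.
Local Notation C := R[i].
Local Notation Z := (cayley_grassmannian R).

(** The inverse of [label_cycle]: substituting the coordinates by a permutation
    moves the unit vectors by its inverse. *)
Definition cycle_label (j : nat) : nat := nth 0%N [:: 1; 0; 4; 5; 7; 6; 2; 3]%N j.

Lemma label_mx_cycle s : size s = 4%N -> all (ltn^~ 8) s ->
  label_mx C s *m opmx (@cycle_op C) = label_mx C [seq cycle_label j | j <- s].
Proof.
move=> s4 s8; apply: mrow_inj => a k a4 k8.
rewrite mrow_opmx//; last exact: cycle_ext.
have sa8 : (nth 0%N s a < 8)%N by apply: (allP s8); rewrite mem_nth ?s4.
have ck8 : (label_cycle k < 8)%N by do 8?[case: k k8 => [|k] k8 //].
rewrite /cycle_op /= !mrow_label_mx// (nth_map 0%N) ?s4//.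
move: (nth 0%N s a) sa8 {s4 s8} => j j8; rewrite /unit_row; congr (_%:R).
by do 8?[case: j j8 => [|j] j8 //]; do 8?[case: k k8 ck8 => [|k] k8 ck8 //].
Qed.

Definition cycle_frame (k : nat) : 'M[C]_O := iter k (mulmx (opmx (@cycle_op C))) (etilde_mx R).

Lemma cycle_frame_cayley k : cayley_frame (cycle_frame k).
Proof.
elim: k => [|k IH]; first exact: cayley_frame_etilde.
apply: (@cayley_frame_op R _ (@cycle5_op C)) IH;
  [exact: cycle_lin|exact: cycle_ext|exact: cycle_eqs|
   exact: cycle5_lin|exact: cycle5_ext|exact: cycle5_eqs|].
by move=> r j j8; do 8?[case: j j8 => [|j] j8 //].
Qed.

Lemma label_mx_cycle_frame k s : size s = 4%N -> all (ltn^~ 8) s ->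
  label_mx C s *m cycle_frame k = label_mx C (iter k (map cycle_label) s) *m etilde_mx R.
Proof.
elim: k s => [|k IH] s s4 s8 //; rewrite /= mulmxA label_mx_cycle// IH ?size_map//.
  by rewrite -iterSr.
rewrite all_map; apply: sub_all s8 => j /= j8.
by do 8?[case: j j8 => [|j] j8 //].
Qed.

Lemma singular_label_cycle s : s \in singular_labels ->
  exists k, perm_eq s (iter k (map cycle_label) [:: 0; 2; 4; 6]%N).
Proof.
have : all (fun s => has (fun k => perm_eq s (iter k (map cycle_label) [:: 0; 2; 4; 6]%N))
  (iota 0 6)) singular_labels by vm_compute.
by move=> /allP H /H/hasP[k _ sk]; exists k.
Qed.

Lemma plucker_index_uniq s : s \in plucker_index -> uniq s.
Proof.
have : all uniq plucker_index by vm_compute.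
by move=> /allP; exact.
Qed.

Lemma label_pluck_neq0 s : s \in plucker_index -> etilde4 R s != 0.
Proof.
move=> sp; have [s8 s4] := plucker_index_label sp.
rewrite etilde4_label_mx// pluck_neq0 row_free_mulmx ?etilde_mx_unit//.
by rewrite row_free_label_mx// plucker_index_uniq.
Qed.

Lemma fixed_label_point s : s \in fixed_labels -> Z (etilde4 R s).
Proof.
move=> sf; have sp := fixed_labels_plucker sf; have [s8 s4] := plucker_index_label sp.
rewrite etilde4_label_mx//; apply/(cayley_grassmannian_frameP _ (cayley_frame_etilde R)).
exists (label_mx C s); split; last reflexivity.
  by rewrite row_free_label_mx// plucker_index_uniq.
exact/cayley_labelP/fixed_labels_cayley.
Qed.

Lemma singular_labels_fixed s : s \in singular_labels -> s \in fixed_labels.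
Proof.
have : all (fun s => s \in fixed_labels) singular_labels by vm_compute.
by move=> /allP; exact.
Qed.

(** In the frame obtained by a power of the cycle, the point becomes the origin
    of the cell of e~_0246. *)
Lemma singular_label_not_smooth s : s \in singular_labels -> ~ smooth_point Z (etilde4 R s).
Proof.
move=> ss; have sp := fixed_labels_plucker (singular_labels_fixed ss).
have [s8 s4] := plucker_index_label sp; have [k sk] := singular_label_cycle ss.
pose t := iter k (map cycle_label) [:: 0; 2; 4; 6]%N.
have e0 := label_pluck_neq0 sp.
have ut : uniq t by rewrite -(perm_uniq sk) plucker_index_uniq.
have t4 : size t = 4%N by rewrite -(perm_size sk).
have scell0 : scell_mx (fun=> 0) = label_mx C [:: 0; 2; 4; 6]%N.
  apply: mrow_inj => a j a4 j8; rewrite mrow_scell_mx// mrow_label_mx//.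
  by do 4?[case: a a4 => [|a] a4 //]; do 8?[case: j j8 => [|j] j8 //].
have sE : etilde4 R s = \det (label_change C s t) *: pluck (scell_mx (fun=> 0) *m cycle_frame k).
  rewrite scell0 label_mx_cycle_frame// -pluck_mull mulmxA -label_mx_change//.
    exact: etilde4_label_mx.
  by move=> j; rewrite (perm_mem sk).
rewrite sE; apply: singular_point_not_smooth; first exact: cycle_frame_cayley.
by apply: contra e0 => /eqP d0; rewrite sE d0 scale0r.
Qed.

End SingularLabels.

Theorem theorem7p2 (R : realType) :
  (forall omega : 'rV[R[i]]_70,
     (cayley_grassmannian R omega /\ torus_fixed omega) <->
     (exists2 s : seq nat, s \in fixed_labels & same_point (etilde4 R s) omega))
  /\
  (forall s : seq nat, s \in fixed_labels -> s \notin singular_labels ->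
     smooth_point (cayley_grassmannian R) (etilde4 R s))
  /\
  (forall s : seq nat, s \in singular_labels ->
     cayley_grassmannian R (etilde4 R s) /\
     ~ smooth_point (cayley_grassmannian R) (etilde4 R s)).
Proof.
split; [move=> omega; split|split].
- move=> [Xo /(fixed_point_label Xo)[s sf [c c0 oE]]]; exists s => //.
  have e0 := label_pluck_neq0 R (fixed_labels_plucker sf).
  split=> //; last by exists c.
  by rewrite oE scaler_eq0 negb_or c0.
- move=> [s sf [_ _ [c c0 oE]]]; split.
    by rewrite oE; apply: cayley_grassmannianZ => //; exact: fixed_label_point.
  have [s8 s4] := plucker_index_label (fixed_labels_plucker sf).
  exact: label_point_fixed s8 s4 oE.
- exact: nonsingular_label_smooth.
move=> s ss; split; last exact: singular_label_not_smooth.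
exact/fixed_label_point/singular_labels_fixed.
Qed.
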